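(* Consider the Poissonized Karlin occupancy scheme with probabilities $(p_k)_{k\in\mathbb N}$, counting function $\rho$ and variables $K_j(t)$ as in the context. Assume that $\rho\in\Pi_\ell$, i.e. $\lim_{t\to\infty}(\rho(\lambda t)-\rho(t))/\ell(t)=\log\lambda$ for all $\lambda>0$. (1) If $\ell(t)\sim(\log t)^\beta l(\log t)$ as $t\to\infty$ for some $\beta>0$ and some $l$ slowly varying at $\infty$, then, for each $j\in\mathbb N$, $$\limsup_{t\to\infty}\frac{K_j(t)-\mathbb E K_j(t)}{(\operatorname{Var}K_j(t)\log\operatorname{Var}K_j(t))^{1/2}}=\Big(\frac2\beta\Big)^{1/2}\quad\text{almost surely}.$$ (2) If $\ell(t)\sim\exp(\sigma(\log t)^\lambda)$ as $t\to\infty$ for some $\sigma>0$ and $\lambda\in(0,1)$, then, for each $j\in\mathbb N$, $$\limsup_{t\to\infty}\frac{K_j(t)-\mathbb E K_j(t)}{(\operatorname{Var}K_j(t)\log\log\operatorname{Var}K_j(t))^{1/2}}=\Big(\frac2\lambda\Big)^{1/2}\quad\text{almost surely}.$$ (3) If $\rho\in\Pi_{\ell,\infty}$, i.e. $\rho\in\Pi_\ell$ and $\lim_{t\to\infty}\ell(t)=\infty$ (in particular, in both cases (1) and (2)), then, for each $j\in\mathbb N$, as $t\to\infty$, $$\mathbb E K_j(t)\sim\rho(t)\quad\text{and}\quad\operatorname{Var}K_j(t)\sim\Big(\log2-\sum_{k=1}^{j-1}\frac{(2k-1)!}{(k!)^22^{2k}}\Big)\ell(t).$$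
   Context: Let $(p_k)_{k\in\mathbb N}$ be a discrete probability distribution with $p_k>0$ for infinitely many $k$. Balls are allocated independently over boxes $1,2,\dots$, each ball hitting box $k$ with probability $p_k$. In the Poissonized version of Karlin's occupancy scheme the $n$th ball is thrown at time $S_n$, where $(S_n)_{n\in\mathbb N}$ is a random walk with independent exponential(1) increments, independent of the box indices; thus the number of balls thrown up to time $t$ is a unit-rate Poisson process. $K_j(t)$ denotes the number of boxes containing at least $j$ balls at time $t\ge0$. Equivalently, $K_j(t)=\sum_{k\ge1}\mathbf 1_{\{\pi_k(t)\ge j\}}$, where $\pi_k(t)$ is the number of balls in box $k$ at time $t$; the processes $(\pi_k(t))_{t\ge0}$, $k\in\mathbb N$, are independent Poisson processes with intensities $p_k$. The counting function is $\rho(t):=\#\{k\in\mathbb N:1/p_k\le t\}$, $t>0$. Write $\rho\in\Pi_\ell$ (de Haan's class $\Pi$ with auxiliary function $\ell$, a positive measurable function) if, for all $\lambda>0$, $\lim_{t\to\infty}(\rho(\lambda t)-\rho(t))/\ell(t)=\log\lambda$. A positive measurable function $l$ on a neighborhood of $\infty$ is slowly varying at $\infty$ if $l(\lambda t)/l(t)\to1$ as $t\to\infty$ for all $\lambda>0$. $x(t)\sim y(t)$ means $x(t)/y(t)\to1$. *)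

(* Defs.v *)
From HB Require Import structures.
From mathcomp Require Import all_boot all_order all_algebra.
From mathcomp Require Export finmap.
From mathcomp Require Import all_classical all_reals all_analysis.
Set Implicit Arguments.
Unset Strict Implicit.
Unset Printing Implicit Defensive.
Import Order.TTheory GRing.Theory Num.Theory.
Import numFieldNormedType.Exports.
Local Open Scope classical_set_scope.
Local Open Scope ring_scope.

Section asymptotics.
Context {R : realType}.
Implicit Types (f g l ell : R -> R).

Definition asymp_equiv f g : Prop := f t / g t @[t --> +oo] --> (1 : R).

Definition eventually_positive_measurable f : Prop :=
  exists A : R,
    measurable_fun `]A, +oo[ f /\ (forall t, A < t -> 0 < f t).

Definition slowly_varying l : Prop :=
  eventually_positive_measurable l /\
  forall lam : R, 0 < lam -> l (lam * t) / l t @[t --> +oo] --> (1 : R).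

Definition de_Haan_Pi ell f : Prop :=
  eventually_positive_measurable ell /\
  forall lam : R, 0 < lam ->
    (f (lam * t) - f t) / ell t @[t --> +oo] --> ln lam.

Definition log_power_growth ell (beta : R) l : Prop :=
  [/\ 0 < beta, slowly_varying l &
      asymp_equiv ell (fun t => ln t `^ beta * l (ln t))].

Definition exp_log_growth ell (sigma lam : R) : Prop :=
  [/\ 0 < sigma, 0 < lam < 1 &
      asymp_equiv ell (fun t => expR (sigma * ln t `^ lam))].

Definition variance_constant (j : nat) : R :=
  ln 2 - \sum_(1 <= k < j)
           ((2 * k - 1)`!)%:R / ((k`!)%:R ^+ 2 * 2 ^+ (2 * k)).

End asymptotics.

(* Mutual independence of a family of classes of events: the product rule for
   every finite subfamily. *)
Definition mutually_independent d (T : measurableType d) (R : realType)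
    (P : probability T R) (I : choiceType) (F : I -> set_system T) : Prop :=
  forall (J : {fset I}) (A : I -> set T),
    (forall i, i \in J -> F i (A i)) ->
    P (\bigcap_(i in [set` J]) A i) = (\prod_(i <- J) P (A i))%E.

Section Karlin_scheme.
Context {R : realType}.

(* Boxes are numbered from 0 instead of 1. *)
Definition infinite_distribution (p : nat -> R) : Prop :=
  [/\ forall k, 0 <= p k,
      (\sum_(0 <= k <oo) (p k)%:E = 1)%E &
      infinite_set [set k | 0 < p k]].

(* The condition 0 < p k encodes 1 / p k = +oo for p k = 0, whereas 0^-1 = 0 in
   MathComp.  The counted set is finite when p is a distribution, so that fine
   only casts its cardinality to R. *)
Definition counting_function (p : nat -> R) (t : R) : R :=
  fine (counting [set k | 0 < p k /\ (p k)^-1 <= t]).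

Context d (T : measurableType d) (P : probability T R).
Implicit Types (xi : nat -> {RV P >-> R}) (box : nat -> {RV P >-> nat}).

Definition scheme_sigma_algebras xi box (i : nat + nat) : set_system T :=
  match i with
  | inl n => preimage_set_system setT (xi n) measurable
  | inr n => preimage_set_system setT (box n) measurable
  end.

(* Balls are numbered from 0: ball n is thrown after the waiting times
   xi 0, ..., xi n and falls into box number (box n). *)
Record poissonized_Karlin_scheme (p : nat -> R) xi box : Prop := {
  waiting_time_law : forall n (A : set R), measurable A ->
    distribution P (xi n) A = exponential_prob 1 A;
  box_law : forall n k, distribution P (box n) [set k] = (p k)%:E;
  scheme_independent : mutually_independent P (scheme_sigma_algebras xi box)
}.

Definition throw_time xi (n : nat) (w : T) : R := \sum_(i < n.+1) xi i w.

(* Number of balls in box k at time t; it is +oo only on the null event that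
   the throwing times accumulate. *)
Definition balls xi box (k : nat) (t : R) (w : T) : \bar R :=
  counting [set n | throw_time xi n w <= t /\ box n w = k].

(* Almost surely, for all t >= 0, finitely many balls have been thrown up to
   time t; the set below is then finite for j >= 1 and fine only casts its
   cardinality to R. *)
Definition occupied_boxes xi box (j : nat) (t : R) (w : T) : R :=
  fine (counting [set k | ((j%:R)%:E <= balls xi box k t w)%E]).

Definition mean_occupied xi box (j : nat) (t : R) : R :=
  fine 'E_P[occupied_boxes xi box j t].

Definition var_occupied xi box (j : nat) (t : R) : R :=
  fine 'V_P[occupied_boxes xi box j t].

End Karlin_scheme.

(* Main.v *)
From HB Require Import structures.
Require Import Defs.
From mathcomp Require Import all_boot all_order all_algebra.
From mathcomp Require Import all_classical all_reals all_analysis.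
From mathcomp Require Import measurable_realfun ring lra.
Import Order.TTheory GRing.Theory Num.Theory.
Import numFieldNormedType.Exports.
Local Open Scope classical_set_scope.
Local Open Scope ring_scope.
Set Implicit Arguments.
Unset Strict Implicit.

(** In the Poissonized scheme the numbers of balls in the different boxes at
    time t are independent Poisson variables with means p k * t. Hence the
    number of boxes with at least j balls is a sum of independent indicators,
    increasing in t, and its mean and variance are sums over the boxes of two
    fixed profiles of y = p k * t.

    The independence of the boxes is not part of the definition of the scheme,
    which throws balls one after the other at the times of a random walk. It
    is obtained from a generating function with one variable z k and one time
    t k for each of finitely many boxes. The weight of the balls thrown so
    far, multiplied by the value that a Poisson process would give to the
    balls still to come, has constant mean (balls_weight_martingale): this is
    a renewal equation for the exponential waiting time (renewal_equation).
    Letting the number of balls tend to infinity gives the generating function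
    of independent Poisson variables (balls_generating), and the comparison of
    the coefficients of power series gives the laws and the independence
    (few_balls_law, few_balls_independent).

    The condition that the counting function belongs to de Haan's class says
    that the arguments p k * t are spread over (0, oo) asymptotically like ell
    t times dy / y: this is shell_density for the indicator of [a, b), whose
    integral against dy / y is ln b - ln a. The two ends of (0, oo) are
    negligible by recursions over dyadic scales (small1_density,
    big1_density), so the sum over the boxes of exp (- y) - exp (- lam y) is
    ln lam * ell t asymptotically (exp_diff_density), and that of the n-th
    Poisson weight is ell t / n (pois_density). The variance profile is built
    from Poisson weights at y and at 2 y, whose densities add up to
    variance_constant by a binomial identity (occupancy_var_density). The mean
    differs from the counting function by a quantity of order ell t, which is
    of smaller order than the counting function (poisson_mean_equiv).

    The almost sure statements come from one law of the iterated logarithm: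
    the centred count at t, divided by the square root of 2 v ln (ln t) with v
    the variance at t, has upper limit 1 almost surely. For the upper half
    (lil_upper), Chernoff's bound makes the exceedances summable along a
    geometric sequence of times; between two terms of the sequence the count
    is controlled by dyadic chaining (interval_sup), because its increments
    are again counts of independent events, with a mean of order the variance
    times the relative increment of time. For the lower half (lil_lower), all
    but a small share of the variance at time t comes from the boxes with 1 /
    M <= p k * t < M (poisson_var_window). Along the powers of M ^ 2 these
    sets of boxes are disjoint, so the large deviations that they produce,
    whose probability is bounded below by Kolmogorov's exponential inequality
    (kolmogorov_lower), occur infinitely often by the second Borel-Cantelli
    lemma.

    It remains to compare normalisations (limsup_renormalise). The variance is
    of exact order ell t. If ell t is (ln t) ^ beta up to a slowly varying
    function of ln t, then ln v is asymptotic to beta ln (ln t), because the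
    logarithm of a slowly varying function of x is o(ln x) by the uniform
    convergence theorem (slowly_varying_ln); the upper limit is therefore the
    square root of 2 / beta. If ell t is exp (sigma (ln t) ^ lam), then ln (ln
    v) is asymptotic to lam ln (ln t), which gives the square root of 2 / lam. *)

(** * Independence of sigma-algebras *)
Section Independence.
Context {R : realType} {d : measure_display} {T : measurableType d}
  (P : probability T R).
Local Open Scope ereal_scope.

Lemma integral_prob_cst (c : \bar R) : \int[P]_w c = c.
Proof. by rewrite integral_cst// [X in (_ * X)%E]probability_setT mule1. Qed.

Lemma bounded_convergence (f_ : nat -> T -> R) (f : T -> R) :
  (forall n, measurable_fun setT (f_ n)) -> measurable_fun setT f ->
  (forall n w, (0 <= f_ n w <= 1)%R) ->
  (forall w, f_ n w @[n --> \oo] --> f w) ->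
  \int[P]_w (f_ n w)%:E @[n --> \oo] --> \int[P]_w (f w)%:E.
Proof.
move=> mf_ mf f01 f_f.
have i1 : P.-integrable setT (cst 1 : T -> \bar R).
  apply/integrableP; split => //.
  rewrite (eq_integral (fun=> 1)); last by move=> w _ /=; rewrite normr1.
  by rewrite integral_prob_cst ltry.
have [] // := @dominated_convergence _ _ _ P setT measurableT
  (fun n w => (f_ n w)%:E) (fun w => (f w)%:E) (cst 1).
- by move=> n; exact/measurable_EFinP.
- exact/measurable_EFinP.
- apply: aeW => w _; apply: cvg_EFin; first exact: nearW.
  exact: f_f.
- apply: aeW => w n _; rewrite lee_fin; have /andP[f0 f1] := f01 n w.
  by rewrite ger0_norm.
Qed.

(** Both sides are finite measures in A that agree on an intersection-stable
    class, hence on the sigma-algebra that it generates. *)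
Lemma sigma_independent1 (G : set_system T) (B : set T) :
  G `<=` measurable -> setI_closed G -> G setT -> measurable B ->
  (forall A, G A -> P (A `&` B) = P A * P B) ->
  forall A, <<s G >> A -> P (A `&` B) = P A * P B.
Proof.
move=> Gm GI GT mB GB A sA.
have PB0 : (0 <= fine (P B))%R by apply: fine_ge0.
pose m1 := mrestr P mB.
pose m2 := mscale (NngNum PB0) P.
have m2E C : m2 C = P C * P B.
  by rewrite /m2 /mscale/= fineK ?fin_num_measure// muleC.
rewrite -m2E -[LHS]/(m1 A); apply: (@g_sigma_algebra_measure_unique _ _ _ G Gm (fun=> setT) _ _ m1 m2) => //.
- by rewrite bigcup_const//; exists 0%N.
- by move=> C GC; exact: (etrans (GB C GC) (esym (m2E C))).
- by move=> k /=; rewrite /mrestr setTI ltey_eq fin_num_measure.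
Qed.

Lemma sigma_independent (G1 G2 : set_system T) :
  G1 `<=` measurable -> setI_closed G1 -> G1 setT ->
  G2 `<=` measurable -> setI_closed G2 -> G2 setT ->
  (forall A B, G1 A -> G2 B -> P (A `&` B) = P A * P B) ->
  forall A B, <<s G1 >> A -> <<s G2 >> B -> P (A `&` B) = P A * P B.
Proof.
move=> mG1 IG1 TG1 mG2 IG2 TG2 G12 A B sA sB.
have mB : measurable B by apply: (smallest_sub (@sigma_algebra_measurable _ T) mG2).
apply: (@sigma_independent1 G1) => // {A sA} A G1A.
rewrite setIC muleC; apply: (@sigma_independent1 G2) => //; first exact: mG1.
by move=> C G2C; rewrite setIC muleC; exact: G12.
Qed.

(** The joint law of X and Y is the product of their laws, so Fubini-Tonelli
    turns the expectation into an iterated one, in which the second variable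
    is evaluated at an independent sample point. *)
Lemma indep_fubini {d1 d2} {T1 : measurableType d1} {T2 : measurableType d2}
    (X : T -> T1) (Y : T -> T2) (f : T1 * T2 -> \bar R) :
  measurable_fun setT X -> measurable_fun setT Y ->
  (forall A B, measurable A -> measurable B ->
     P (X @^-1` A `&` Y @^-1` B) = P (X @^-1` A) * P (Y @^-1` B)) ->
  measurable_fun [set: (T1 * T2)%type] f -> (forall z, 0 <= f z) ->
  \int[P]_w f (X w, Y w) = \int[P]_w \int[P]_w' f (X w, Y w').
Proof.
move=> mX mY XY mf f0.
have mXY : measurable_fun setT (fun w => (X w, Y w)) by exact: measurable_fun_pair.
pose X' : {RV P >-> T1} := mfun_Sub (mem_set mX).
pose Y' : {RV P >-> T2} := mfun_Sub (mem_set mY).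
pose Z' : {RV P >-> (T1 * T2)%type} := mfun_Sub (mem_set mXY).
transitivity (\int[distribution P Z']_z f z).
  by rewrite ge0_integral_distribution.
transitivity (\int[(distribution P X' \x distribution P Y')%E]_z f z).
  apply: eq_measure_integral => A mA _; symmetry.
  by apply: product_measure_unique => // B C mB mC; exact: XY.
rewrite fubini_tonelli1//.
rewrite ge0_integral_distribution//; last first.
- by move=> x; apply: integral_ge0.
- exact: measurable_fun_fubini_tonelli_F.
apply: eq_integral => w _ /=; rewrite /fubini_F ge0_integral_distribution//.
exact: measurableT_comp.
Qed.

End Independence.

Definition measurable_wrt {d d'} {T : measurableType d} {U : measurableType d'}
    (G : set_system T) (X : T -> U) : Prop :=
  @measurable_fun _ _ (g_sigma_algebraType G) U setT X.

Section Blocks.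
Context {R : realType} {d : measure_display} {T : measurableType d}
  (P : probability T R) {I : choiceType} (F : I -> set_system T).
Local Open Scope ereal_scope.

(** Finite intersections of events from the classes indexed by S. They form an
    intersection-stable generator of what the coordinates in S determine. *)
Definition block (S : set I) : set_system T :=
  [set A | exists (J : {fset I}) (E : I -> set T),
     [/\ [set` J] `<=` S, forall i, i \in J -> F i (E i) &
         A = \bigcap_(i in [set` J]) E i]].

Hypothesis F_measurable : forall i, F i `<=` measurable.
Hypothesis F_setT : forall i, F i setT.
Hypothesis F_setI : forall i, setI_closed (F i).
Hypothesis F_indep : mutually_independent P F.

Lemma block1 (S : set I) i E : S i -> F i E -> block S E.
Proof.
move=> Si FE; exists [fset i]%fset, (fun=> E); split.
- by move=> k /=; rewrite inE => /eqP ->.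
- by move=> k; rewrite inE => /eqP ->.
- by rewrite set_fset1 bigcap_set1.
Qed.

Lemma block_setT (S : set I) : block S setT.
Proof.
exists fset0, (fun=> setT); split => //.
by rewrite set_fset0 bigcap_set0.
Qed.

(** Padding with the full event allows two such intersections to be written
    over one index set. *)
Lemma block_total (S : set I) A : block S A ->
  exists (J : {fset I}) (E : I -> set T),
    [/\ [set` J] `<=` S, forall i, F i (E i), forall i, i \notin J -> E i = setT &
         A = \bigcap_(i in [set` J]) E i].
Proof.
move=> [J [E [JS FE ->]]]; exists J, (fun i => if i \in J then E i else setT).
split => //.
- by move=> i; case: ifPn => // iJ; exact: FE.
- by move=> i /negbTE ->.
- by apply: eq_bigcapr => i /= ->.
Qed.

Lemma bigcap_widen (J J' : {fset I}) (E : I -> set T) : (J `<=` J')%fset ->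
  (forall i, i \notin J -> E i = setT) ->
  \bigcap_(i in [set` J]) E i = \bigcap_(i in [set` J']) E i.
Proof.
move=> JJ' EJ; apply/seteqP; split => w wE i /= iJ.
  have [iJ1|iJ1] := boolP (i \in J); first exact: wE.
  by rewrite EJ.
by apply: wE => /=; exact: (fsubsetP JJ').
Qed.

Lemma block_setI (S : set I) : setI_closed (block S).
Proof.
move=> _ _ /block_total[J [E [JS FE EJ ->]]] /block_total[J' [E' [JS' FE' EJ' ->]]].
exists (J `|` J')%fset, (fun i => E i `&` E' i); split.
- by move=> i /=; rewrite inE => /orP[/JS|/JS'].
- by move=> i _; exact: F_setI.
- rewrite bigcapI; congr (_ `&` _); apply: bigcap_widen => //.
    exact: fsubsetUl.
  exact: fsubsetUr.
Qed.

Lemma block_measurable (S : set I) : block S `<=` measurable.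
Proof.
move=> _ [J [E [JS FE ->]]]; apply: fin_bigcap_measurable; first exact: finite_fset.
by move=> i /= iJ; apply: (F_measurable (i := i)); exact: FE.
Qed.

(** Over the union of the two index sets the product rule of mutual
    independence splits into the two partial products. *)
Lemma block_independent (S S' : set I) : S `&` S' = set0 ->
  forall A B, block S A -> block S' B -> P (A `&` B) = P A * P B.
Proof.
move=> SS' _ _ /block_total[J [E [JS FE EJ ->]]] /block_total[J' [E' [JS' FE' EJ' ->]]].
have JJ' i : i \in J -> i \in J' -> False.
  by move=> iJ iJ'; rewrite -[False]/(set0 i) -SS'; split; [exact: JS|exact: JS'].
have -> : \bigcap_(i in [set` J]) E i `&` \bigcap_(i in [set` J']) E' i =
    \bigcap_(i in [set` (J `|` J')%fset]) (E i `&` E' i).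
  by rewrite bigcapI; congr (_ `&` _); apply: bigcap_widen => //;
    [exact: fsubsetUl|exact: fsubsetUr].
rewrite !F_indep//; last by move=> i _; exact: F_setI.
rewrite (perm_big (J ++ J'))/=; last first.
  apply: uniq_perm; first exact: fset_uniq.
    rewrite cat_uniq !fset_uniq andbT/=; apply/hasPn => i iJ'.
    by apply/negP => iJ; exact: JJ' iJ iJ'.
  by move=> i; rewrite mem_cat inE.
rewrite big_cat/=.
congr (_ * _); rewrite big_seq [RHS]big_seq; apply: eq_bigr => i iJ.
  by rewrite EJ' ?setIT//; apply/negP => /(JJ' _ iJ).
by rewrite EJ ?setTI//; apply/negP => /JJ'/(_ iJ).
Qed.

Lemma sblock_measurable (S : set I) A : <<s block S >> A -> measurable A.
Proof.
by move=> sA; apply: (smallest_sub (@sigma_algebra_measurable _ T) (@block_measurable S)).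
Qed.

Lemma sblockS (S S' : set I) : S `<=` S' -> <<s block S >> `<=` <<s block S' >>.
Proof.
move=> SS'; apply: sub_smallest2r; first exact: smallest_sigma_algebra.
by move=> A [J [E [JS FE ->]]]; exists J, E; split => // i /JS/SS'.
Qed.

Lemma measurable_wrt_block d' (U : measurableType d') (S : set I) (X : T -> U) :
  measurable_wrt (block S) X -> measurable_fun setT X.
Proof.
by move=> mX _ Y mY; apply: (@sblock_measurable S); exact: mX.
Qed.

Lemma measurable_wrtW d' (U : measurableType d') (S S' : set I) (X : T -> U) :
  S `<=` S' -> measurable_wrt (block S) X -> measurable_wrt (block S') X.
Proof.
by move=> SS' mX _ Y mY; apply: (sblockS SS'); exact: mX.
Qed.

Lemma sblock_independent (S S' : set I) A B : S `&` S' = set0 ->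
  <<s block S >> A -> <<s block S' >> B -> P (A `&` B) = P A * P B.
Proof.
move=> SS'; apply: sigma_independent.
- exact: block_measurable.
- exact: block_setI.
- exact: block_setT.
- exact: block_measurable.
- exact: block_setI.
- exact: block_setT.
- exact: block_independent.
Qed.

Lemma block_fubini d1 d2 (T1 : measurableType d1) (T2 : measurableType d2)
    (S S' : set I) (X : T -> T1) (Y : T -> T2) (f : T1 * T2 -> \bar R) :
  S `&` S' = set0 ->
  measurable_wrt (block S) X -> measurable_wrt (block S') Y ->
  measurable_fun setT f -> (forall z, 0 <= f z) ->
  \int[P]_w f (X w, Y w) = \int[P]_w \int[P]_w' f (X w, Y w').
Proof.
move=> SS' mX mY mf f0; apply: indep_fubini => //.
- exact: measurable_wrt_block mX.
- exact: measurable_wrt_block mY.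
- move=> A B mA mB; apply: sblock_independent SS' _ _.
    by rewrite -[X in <<s _ >> X]setTI; exact: mX.
  by rewrite -[X in <<s _ >> X]setTI; exact: mY.
Qed.

Lemma block_integralM (S S' : set I) (f g : T -> \bar R) : S `&` S' = set0 ->
  measurable_wrt (block S) f -> measurable_wrt (block S') g ->
  (forall w, 0 <= f w) -> (forall w, 0 <= g w) ->
  \int[P]_w (f w * g w) = \int[P]_w f w * \int[P]_w g w.
Proof.
move=> SS' mf mg f0 g0.
have -> : \int[P]_w (f w * g w) = \int[P]_w (maxe (f w) 0 * maxe (g w) 0).
  by apply: eq_integral => w _; rewrite !max_l.
rewrite (@block_fubini _ _ _ _ S S' f g (fun z => maxe z.1 0 * maxe z.2 0))//; first last.
- by move=> z; rewrite mule_ge0// le_max lexx orbT.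
- apply: emeasurable_funM; apply: measurable_maxe => //.
under eq_integral => w _.
  under eq_integral => w' _ do rewrite !max_l//=.
  rewrite ge0_integralZl//; last exact: measurable_wrt_block mg.
  over.
rewrite ge0_integralZr//; first exact: measurable_wrt_block mf.
exact: integral_ge0.
Qed.

End Blocks.

(** * The exponential law *)
Section exponential_law.
Context {R : realType} {d : measure_display} {T : measurableType d}
  (P : probability T R).
Local Notation mu := (@lebesgue_measure R).
Local Open Scope ereal_scope.

(** The law of X agrees with a set function given by a density, so that
    density is identified with the Radon-Nikodym derivative. *)
Lemma integral_exponential_law (X : {RV P >-> R}) (f : R -> \bar R) :
  (forall A, measurable A -> distribution P X A = exponential_prob 1 A) ->
  measurable_fun setT f -> (forall x, 0 <= f x) ->
  \int[P]_w f (X w) = \int[mu]_(x in `[0%R, +oo[) (f x * (expR (- x))%:E).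
Proof.
move=> lawX mf f0.
have mX : @measurable_fun _ _ T (measurableTypeR R) setT X.
  by have : measurable_fun setT X by [].
pose X' : {RV P >-> measurableTypeR R} :=
  @mfun_Sub _ _ T (measurableTypeR R) X (mem_set mX).
pose nu : {finite_measure set (measurableTypeR R) -> \bar R} := distribution P X'.
transitivity (\int[mu]_x (f x * (exponential_pdf 1 x)%:E)); last first.
  rewrite [RHS]integral_mkcond; apply: eq_integral => x _.
  rewrite /exponential_pdf !patchE; case: ifPn => _ /=; last by rewrite mule0.
  by rewrite mul1r mulN1r.
have dom : nu `<< mu.
  apply/null_content_dominatesP => A mA muA0; rewrite [LHS]lawX//.
  apply: null_set_integral => //; apply: measurable_funTS; apply/measurable_EFinP.
  exact: measurable_exponential_pdf.
transitivity (\int[nu]_x f x).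
  by rewrite ge0_integral_distribution.
rewrite -(@Radon_Nikodym_SigmaFinite.change_of_variables _ _ _ nu mu dom f)//.
apply: ae_eq_integral => //.
- apply: emeasurable_funM => //; apply: (measurable_int mu).
  exact: Radon_Nikodym_SigmaFinite.f_integrable.
- apply: emeasurable_funM => //; apply/measurable_EFinP.
  exact: measurable_exponential_pdf.
- apply: ae_eqe_mul2l => /=; apply: integral_ae_eq => //.
  + exact: Radon_Nikodym_SigmaFinite.f_integrable.
  + by apply/measurable_EFinP; exact: measurable_exponential_pdf.
  + by move=> E _ mE; rewrite -Radon_Nikodym_SigmaFinite.f_integral//; exact: lawX.
Qed.

Lemma lebesgue_measure_shift (c : R) (A : set R) : measurable A ->
  mu [set x | A (c + x)%R] = mu A.
Proof.
move=> mA.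
have mc : @measurable_fun _ _ (measurableTypeR R) (measurableTypeR R) setT (fun x => c + x)%R.
  by have : measurable_fun [set: R] (fun x => c + x)%R by exact: measurable_funD.
pose f : {mfun measurableTypeR R >-> measurableTypeR R} :=
  @mfun_Sub _ _ (measurableTypeR R) (measurableTypeR R) _ (mem_set mc).
rewrite -[LHS]/(pushforward mu f A).
apply/esym/lebesgue_measure_unique => //= _ [[a b]] _ <-.
rewrite /pushforward /=.
have -> : (fun x => c + x)%R @^-1` [set` `]a, b]%R] =
    [set` `](a - c)%R, (b - c)%R]%R].
  by apply/seteqP; split => x /=; rewrite !in_itv/= ltrBlDl lerBrDl.
by rewrite !lebesgue_measure_itv/= !lte_fin ltrD2r; case: ifP => // _;
  rewrite -!EFinB; congr (_%:E); ring.
Qed.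

Lemma integral_shift (c : R) (f : R -> \bar R) :
  measurable_fun setT f -> (forall x, 0 <= f x) ->
  \int[mu]_x f (c + x)%R = \int[mu]_x f x.
Proof.
move=> mf f0.
have mc : @measurable_fun _ _ (measurableTypeR R) (measurableTypeR R) setT (fun x => c + x)%R.
  by have : measurable_fun [set: R] (fun x => c + x)%R by exact: measurable_funD.
pose h : {mfun measurableTypeR R >-> measurableTypeR R} :=
  @mfun_Sub _ _ (measurableTypeR R) (measurableTypeR R) _ (mem_set mc).
transitivity (\int[pushforward mu h]_x f x).
  by rewrite ge0_integral_pushforward.
by apply: eq_measure_integral => A mA _; exact: lebesgue_measure_shift.
Qed.

End exponential_law.

(** * A renewal equation *)
Section renewal.
Context {R : realType}.
Local Notation mu := (@lebesgue_measure R).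
Variables (J : seq nat) (a t : nat -> R).
Hypothesis a_ge0 : forall k, 0 <= a k.
Hypothesis a_le1 : \sum_(k <- J) a k <= 1.

(** Mean weight of a ball thrown at time y: with probability p k it falls into
    box k and, if y <= t k, its weight is z k instead of 1. Here a k stands
    for p k * (1 - z k). *)
Definition ray_factor (y : R) : R := 1 - \sum_(k <- J) a k * (y <= t k)%R%:R.
(** Mean of the product of the weights of all balls thrown after time y, if
    these form a Poisson process. *)
Definition ray_laplace (y : R) : R :=
  expR (- \sum_(k <- J) a k * Num.max (t k - y) 0).

Lemma ray_factor_ge0 y : 0 <= ray_factor y.
Proof.
rewrite subr_ge0; apply: le_trans a_le1; apply: ler_sum => k _.
by rewrite ler_piMr// lern1 leq_b1.
Qed.

Lemma ray_laplace_le1 y : ray_laplace y <= 1.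
Proof.
rewrite /ray_laplace -expR0 ler_expR oppr_le0; apply: sumr_ge0 => k _.
by rewrite mulr_ge0// le_max lexx orbT.
Qed.

Lemma measurable_ray (c : R) : measurable_fun setT (fun y : R => (y <= c)%R%:R : R).
Proof.
rewrite (_ : (fun _ => _) = \1_(`]-oo, c]%classic)); first exact: measurable_indic.
by apply/funext => y; rewrite indicE mem_setE in_itv.
Qed.

Lemma measurable_ray_factor : measurable_fun setT ray_factor.
Proof.
apply: measurable_funB => //; apply: measurable_sum => k.
by apply: measurable_funM => //; exact: measurable_ray.
Qed.

Lemma measurable_ray_laplace : measurable_fun setT ray_laplace.
Proof.
apply: measurableT_comp => //; apply: measurableT_comp => //.
apply: measurable_sum => k; apply: measurable_funM => //.
apply: measurable_maxr => //; exact: measurable_funB.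
Qed.

Let f (y : R) : \bar R := (ray_factor y * ray_laplace y * expR (- y))%:E.

Let mfr : measurable_fun setT (fun y : R => ray_factor y * ray_laplace y * expR (- y)).
Proof.
apply: measurable_funM.
  by apply: measurable_funM; [exact: measurable_ray_factor|exact: measurable_ray_laplace].
apply: measurableT_comp => //; exact: measurableT_comp.
Qed.

Let mf : measurable_fun setT f. Proof. exact/measurable_EFinP. Qed.

Let f0 y : (0 <= f y)%E.
Proof. by rewrite lee_fin !mulr_ge0 ?ray_factor_ge0 ?expR_ge0. Qed.

Let gam s := \sum_(k <- J | s < t k) a k.
Let A s := \sum_(k <- J | s < t k) a k * t k.

Let factorE s y : s < y -> (forall k, k \in J -> s < t k -> y <= t k) ->
  ray_factor y = 1 - gam s.
Proof.
move=> sy yt; rewrite /ray_factor /gam; congr (1 - _).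
rewrite big_seq [RHS]big_seq_cond big_mkcondr; apply: eq_bigr => k kJ.
have [skt|] := ltP s (t k); first by rewrite yt// mulr1.
by move=> tks; rewrite leNgt (le_lt_trans tks sy) mulr0.
Qed.

Let laplaceE s y : s <= y -> (forall k, k \in J -> s < t k -> y <= t k) ->
  ray_laplace y = expR (gam s * y - A s).
Proof.
move=> sy yt; rewrite /ray_laplace /gam /A; congr expR.
rewrite mulr_suml -sumrB -sumrN big_seq [RHS]big_seq_cond big_mkcondr.
apply: eq_bigr => k kJ; have [skt|tks] := ltP s (t k).
  by rewrite max_l ?subr_ge0 ?yt//; ring.
by rewrite max_r ?mulr0 ?oppr0// subr_le0 (le_trans tks).
Qed.

Let der (c e x : R) : is_derive x 1 (fun y : R => - expR (c * y - e))
  (- (c * expR (c * x - e))).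
Proof.
by apply: is_derive_eq; rewrite /GRing.scale/=; ring.
Qed.

Let derC (c e : R) : continuous (fun y : R => - expR (c * y - e)).
Proof.
by move=> x; apply: differentiable_continuous; apply/derivable1_diffP; have [] := der c e x.
Qed.

(** Between consecutive values of t the factor is constant and the logarithm
    of ray_laplace is affine, so that the integrand is an exact derivative. *)
Let FTC s u : s < u -> (forall k, k \in J -> s < t k -> u <= t k) ->
  (\int[mu]_(y in `[s, u]) f y =
   (expR (- s) * ray_laplace s)%:E - (expR (- u) * ray_laplace u)%:E)%E.
Proof.
move=> su ut.
have key y : s <= y -> y <= u ->
    expR (- y) * ray_laplace y = expR ((gam s - 1) * y - A s).
  move=> sy yu; rewrite (@laplaceE s)//; first by rewrite -expRD; congr expR; ring.
  by move=> k kJ /(ut _ kJ); exact: le_trans.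
have key2 : {in `]s, u[, (fun y => ray_factor y * ray_laplace y * expR (- y)) =1
    (fun y => - ((gam s - 1) * expR ((gam s - 1) * y - A s)))}.
  move=> y; rewrite in_itv/= => /andP[sy yu].
  rewrite -mulrA [X in _ * X]mulrC key ?ltW// (@factorE s)//; first by ring.
  by move=> k kJ /(ut _ kJ); apply: le_trans; exact: ltW.
have cont : continuous (fun y : R => - ((gam s - 1) * expR ((gam s - 1) * y - A s))).
  move=> y; apply: differentiable_continuous; apply/derivable1_diffP.
  exact: ex_derive.
transitivity (\int[mu]_(y in `[s, u])
    (- ((gam s - 1) * expR ((gam s - 1) * y - A s)))%:E)%E.
  apply: eq_integral_itv_bounded => //.
    exact: measurable_funTS.
  by apply: measurable_funTS; exact: continuous_measurable_fun.
have -> : (expR (- s) * ray_laplace s)%:E = (- (- expR ((gam s - 1) * s - A s))%:E)%E.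
  by rewrite key// ?ltW// EFinN oppeK.
have -> : (- (expR (- u) * ray_laplace u)%:E)%E = (- expR ((gam s - 1) * u - A s))%:E.
  by rewrite key// ?ltW.
rewrite addeC; apply: (@continuous_FTC2 _ _ (fun y => - expR ((gam s - 1) * y - A s))) => //.
- exact: continuous_subspaceT.
- split.
  + by move=> y _; have [] := der (gam s - 1) (A s) y.
  + apply: cvg_at_right_filter; exact: derC.
  + apply: cvg_at_left_filter; exact: derC.
- by move=> y _; rewrite derive1E; have [] := der (gam s - 1) (A s) y.
Qed.

(** Induction on the number of values of t above s: up to the smallest of them
    the integral is explicit, and beyond the last one the integrand is
    exp (- y). *)
Lemma renewal_tail s :
  (\int[mu]_(y in `[s, +oo[) (ray_factor y * ray_laplace y * expR (- y))%:E =
   (expR (- s) * ray_laplace s)%:E)%E.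
Proof.
rewrite -/(f _); move: {2}(count _ _) (leqnn (count (fun k => s < t k) J)) => n.
elim: n s => [|n IH] s.
  rewrite leqn0 -[_ == 0%N]negbK -lt0n -has_count => /hasPn noJ.
  have ts k : k \in J -> t k <= s by move/noJ; rewrite -leNgt.
  have key y : s < y -> ray_factor y * ray_laplace y * expR (- y) = expR (- y).
    move=> sy; rewrite /ray_factor /ray_laplace !big_seq !big1 ?oppr0 ?expR0 ?subr0 ?addr0 ?mul1r//.
      move=> k /ts tks; rewrite max_r ?mulr0// subr_le0 (le_trans tks)// ltW//.
    by move=> k /ts tks; rewrite leNgt (le_lt_trans tks sy) mulr0.
  have -> : ray_laplace s = 1.
    rewrite /ray_laplace big_seq big1 ?oppr0 ?expR0// => k /ts tks.
    by rewrite max_r ?mulr0// subr_le0.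
  rewrite mulr1 -integral_itv_obnd_cbnd; last exact: measurable_funTS.
  transitivity (\int[mu]_(y in `]s, +oo[) (expR (- y))%:E)%E.
    by apply: eq_integral => y; rewrite inE/= in_itv/= andbT /f => /key ->.
  have mexp : measurable_fun setT (fun y : R => (expR (- y))%:E).
    by apply/measurable_EFinP; apply: measurableT_comp => //; exact: measurableT_comp.
  rewrite integral_itv_obnd_cbnd; last exact: measurable_funTS.
  have cexp : continuous (fun y : R => expR (- y)).
    by move=> y; apply: continuous_comp; [exact: continuousN|exact: continuous_expR].
  have der1 (y : R) : is_derive y 1 (fun y : R => - expR (- y)) (expR (- y)).
    have := der (-1) 0 y.
    rewrite (_ : (fun y : R => - expR (-1 * y - 0)) = (fun y => - expR (- y))).
      by rewrite subr0 !mulN1r opprK.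
    by apply/funext => z; rewrite subr0 mulN1r.
  rewrite (@ge0_continuous_FTC2y _ (fun y => expR (- y)) (fun y => - expR (- y)) s 0)//.
  - by rewrite add0e EFinN oppeK.
  - exact: continuous_subspaceT.
  - by rewrite -oppr0; apply: cvgN; exact: cvgr_expR.
  - by apply: cvg_at_right_filter; apply: cvgN; exact: cexp.
  - by move=> y _; rewrite derive1E; have [] := der1 y.
have [] := boolP (has (fun k => s < t k) J); last first.
  by rewrite has_count -leqNgt leqn0 => /eqP c0 _; apply: IH; rewrite c0.
move=> hasJ cJ.
(* The smallest value of t above s, where the integral is cut. *)
have [k0 [k0J sk0 k0min]] : exists k0, [/\ k0 \in J, s < t k0 &
    forall k, k \in J -> s < t k -> t k0 <= t k].
  elim: {cJ} (J) hasJ => //= k J' IHJ.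
  have [hJ'|nJ'] := boolP (has (fun k => s < t k) J').
    have [k1 [k1J sk1 k1min]] := IHJ hJ' => _.
    have [skt|tks] := boolP ((s < t k) && (t k < t k1)).
      move/andP : skt => [st tk1]; exists k; split => //; first by rewrite mem_head.
      move=> k'; rewrite inE => /predU1P[->//|k'J' sk'].
      by apply: le_trans (k1min _ k'J' sk'); exact: ltW.
    exists k1; split => //; first by rewrite inE k1J orbT.
    move=> k'; rewrite inE => /predU1P[->|k'J' sk']; last exact: k1min.
    by move: tks; rewrite negb_and => /orP[/negbTE->//|]; rewrite -leNgt.
  rewrite orbF => skt; exists k; split => //; first by rewrite mem_head.
  move=> k'; rewrite inE => /predU1P[->//|k'J' sk'].
  by move/hasPn : nJ' => /(_ _ k'J'); rewrite sk'.
have sE : `[s, +oo[%classic = `[s, t k0] `|` `]t k0, +oo[.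
  by rewrite -itv_bndbnd_setU// bnd_simp// ltW.
rewrite sE ge0_integral_setU//=; first last.
- apply/disj_setPS => y [] /=; rewrite !in_itv/= andbT => /andP[_ yt].
  by rewrite ltNge yt.
- by move=> x _; exact: f0.
- exact: measurable_funTS.
rewrite integral_itv_obnd_cbnd; last exact: measurable_funTS.
rewrite IH; last first.
  rewrite -ltnS; apply: leq_trans cJ.
  rewrite -!sum1_count !big_mkcond/=.
  rewrite (big_rem k0)//= [ltnRHS](big_rem k0)//= ltxx sk0 add0n add1n ltnS.
  rewrite [leqRHS]big_mkcond/=; apply: leq_sum => k _; have [tk|//] := ltP (t k0) (t k).
  by rewrite (lt_trans sk0 tk).
by rewrite FTC// -EFinB -EFinD subrK.
Qed.

(** The next ball comes after an exponential waiting time: the mean over this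
    time of its weight, times the value attached to the balls after it, is the
    value attached to all balls after s. In the variable y = s + x this is
    renewal_tail. *)
Lemma renewal_equation d (T : measurableType d) (P : probability T R)
    (X : {RV P >-> R}) s :
  (forall A, measurable A -> distribution P X A = exponential_prob 1 A) ->
  (\int[P]_w (ray_factor (s + X w) * ray_laplace (s + X w))%:E =
   (ray_laplace s)%:E)%E.
Proof.
move=> lawX.
have mphi : measurable_fun setT (fun y : R => ray_factor y * ray_laplace y).
  by apply: measurable_funM; [exact: measurable_ray_factor|exact: measurable_ray_laplace].
rewrite (integral_exponential_law (f := fun x =>
  (ray_factor (s + x) * ray_laplace (s + x))%:E) lawX); first last.
- by move=> x; rewrite lee_fin mulr_ge0 ?ray_factor_ge0 ?expR_ge0.
- apply/measurable_EFinP; apply: (measurableT_comp mphi).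
  exact: measurable_funD.
pose g (y : R) : \bar R := ((expR s)%:E * ((fun y => (ray_factor y * ray_laplace y *
   expR (- y))%:E) \_ `[s, +oo[) y)%E.
transitivity (\int[mu]_x g (s + x)%R)%E.
  rewrite integral_mkcond; apply: eq_integral => x _; rewrite /g !patchE.
  rewrite !mem_setE !in_itv/= !andbT lerDl; case: ifP => _; last by rewrite mule0.
  rewrite -!EFinM; congr (_%:E).
  by rewrite [in RHS]mulrCA -expRD; congr (_ * expR _); ring.
have mg0 : measurable_fun setT ((fun y => (ray_factor y * ray_laplace y *
   expR (- y))%:E) \_ `[s, +oo[).
  by apply/(measurable_restrictT _ _).1 => //; apply: measurable_funTS.
rewrite integral_shift//; last 2 first.
- exact: measurable_funeM.
- move=> x; rewrite mule_ge0// ?lee_fin ?expR_ge0//.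
  by apply: erestrict_ge0 => y _; exact: f0.
rewrite ge0_integralZl//; last by move=> x _; apply: erestrict_ge0 => y _; exact: f0.
rewrite -integral_mkcond renewal_tail -EFinM mulrA -expRD subrr expR0 mul1r//.
Qed.

End renewal.

Lemma exponential_law_laplace {R : realType} d (T : measurableType d)
    (P : probability T R) (X : {RV P >-> R}) :
  (forall A, measurable A -> distribution P X A = exponential_prob 1 A) ->
  (\int[P]_w (expR (- X w))%:E = (2^-1)%:E)%E.
Proof.
move=> lawX.
have mexp : measurable_fun setT (fun y : R => (expR (- y))%:E).
  by apply/measurable_EFinP; apply: measurableT_comp => //; exact: measurableT_comp.
rewrite (integral_exponential_law (f := fun x => (expR (- x))%:E) lawX)//.
rewrite integral_mkcond.
(* exp (- x) times the density of rate 1 is half the density of rate 2. *)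
transitivity (\int[@lebesgue_measure R]_x ((2^-1)%:E * (exponential_pdf 2 x)%:E))%E.
  apply: eq_integral => x _; rewrite /exponential_pdf !patchE; case: ifP => _; last first.
    by rewrite mule0.
  rewrite -!EFinM mulrA mulVf// mul1r -expRD; congr ((expR _)%:E); ring.
rewrite ge0_integralZl//.
- by rewrite integral_exponential_pdf// mule1.
- by apply/measurable_EFinP; exact: measurable_exponential_pdf.
- by move=> x _; rewrite lee_fin exponential_pdf_ge0.
Qed.

(** * Laplace functional of the thrown balls *)
Section laplace_functional.
Context {R : realType} {d : measure_display} {T : measurableType d}
  (P : probability T R) (p : nat -> R)
  (xi : nat -> {RV P >-> R}) (box : nat -> {RV P >-> nat}).
Hypothesis p_ge0 : forall k, 0 <= p k.
Hypothesis scheme : poissonized_Karlin_scheme p xi box.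

Let F := scheme_sigma_algebras xi box.

Lemma scheme_measurable i : F i `<=` measurable.
Proof.
case: i => n _ [B mB <-]; rewrite setTI; exact: measurable_funPTI.
Qed.

Lemma scheme_setT i : F i setT.
Proof. by case: i => n; exists setT => //; rewrite preimage_setT setTI. Qed.

Lemma scheme_setI i : setI_closed (F i).
Proof.
by case: i => n _ _ [A mA <-] [B mB <-]; exists (A `&` B);
  rewrite ?preimage_setI ?setTI//; exact: measurableI.
Qed.

Let F_indep : mutually_independent P F := scheme_independent scheme.

Definition before (n : nat) : set (nat + nat) :=
  [set i | match i with inl m => (m < n)%N | inr m => (m < n)%N end].

Lemma xi_measurable_wrt S n : S (inl n) -> measurable_wrt (block F S) (xi n).
Proof.
move=> Sn _ B mB; apply: sub_sigma_algebra; apply: (block1 (F := F) Sn).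
by exists B.
Qed.

Lemma box_measurable_wrt S n : S (inr n) -> measurable_wrt (block F S) (box n).
Proof.
move=> Sn _ B mB; apply: sub_sigma_algebra; apply: (block1 (F := F) Sn).
by exists B.
Qed.

Definition clock (n : nat) (w : T) : R := \sum_(i < n) xi i w.

Lemma clockS n w : clock n.+1 w = clock n w + xi n w.
Proof. by rewrite /clock big_ord_recr. Qed.

Lemma clock_measurable_wrt S n : (forall i, (i < n)%N -> S (inl i)) ->
  measurable_wrt (block F S) (clock n).
Proof.
elim: n => [|n IH] Sn.
  rewrite (_ : clock 0 = cst 0); first exact: measurable_cst.
  by apply/funext => w; rewrite /clock big_ord0.
rewrite (_ : clock n.+1 = clock n \+ xi n); last by apply/funext => w; rewrite clockS.
apply: measurable_funD; first by apply: IH => i ni; apply: Sn; exact: ltnW.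
by apply: xi_measurable_wrt; exact: Sn.
Qed.

Variables (J : seq nat) (t z : nat -> R).
Hypothesis J_uniq : uniq J.
Hypothesis z01 : forall k, 0 <= z k <= 1.

(** The argument is a throwing time with a box. The weight is z b for a ball
    that reaches box b in J by time t b, and 1 otherwise; it is written as a
    sum so that it can be integrated box by box. *)
Definition ball_weight (sb : R * nat) : R :=
  1 - \sum_(k <- J) (1 - z k) * (sb.1 <= t k)%R%:R * (sb.2 == k)%:R.

Definition balls_weight n w : R :=
  \prod_(i < n) ball_weight (clock i.+1 w, box i w).

Let a k := p k * (1 - z k).

Lemma ball_weightE s b : ball_weight (s, b) =
  if (b \in J) && (s <= t b) then z b else 1.
Proof.
rewrite /ball_weight/=; have [bJ|bJ] /= := boolP (b \in J).
  rewrite (bigD1_seq b)//= eqxx mulr1 big1 ?addr0 => [|k kb].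
    by case: ifP => _; rewrite ?mulr1 ?mulr0; ring.
  by rewrite eq_sym (negbTE kb) mulr0.
rewrite big_seq big1 ?subr0// => k kJ.
by rewrite (_ : b == k = false) ?mulr0//; apply: contraNF bJ => /eqP ->.
Qed.

Lemma ball_weight_ge0 sb : 0 <= ball_weight sb.
Proof. by case: sb => s b; rewrite ball_weightE; case: ifP => // _; have /andP[] := z01 b. Qed.

Lemma ball_weight_le1 sb : ball_weight sb <= 1.
Proof. by case: sb => s b; rewrite ball_weightE; case: ifP => // _; have /andP[] := z01 b. Qed.

Lemma measurable_ball_weight : measurable_fun setT ball_weight.
Proof.
apply: measurable_funB => //; apply: measurable_sum => k.
apply: measurable_funM.
  apply: measurable_funM => //.
  exact: (measurableT_comp (measurable_ray (t k)) measurable_fst).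
exact: (measurableT_comp (f := fun b : nat => (b == k)%:R : R) _ measurable_snd).
Qed.

Lemma balls_weight_ge0 n w : 0 <= balls_weight n w.
Proof. by apply: prodr_ge0 => i _; exact: ball_weight_ge0. Qed.

Lemma balls_weight_le1 n w : balls_weight n w <= 1.
Proof.
by apply: prodr_ile1 => i _; rewrite ball_weight_ge0 ball_weight_le1.
Qed.

Lemma balls_weightS n w : balls_weight n.+1 w =
  balls_weight n w * ball_weight (clock n w + xi n w, box n w).
Proof. by rewrite /balls_weight big_ord_recr/= clockS. Qed.

Lemma balls_weight_measurable_wrt n S : before n `<=` S ->
  measurable_wrt (block F S) (balls_weight n).
Proof.
elim: n => [|n IH] Sn.
  rewrite (_ : balls_weight 0 = cst 1); first exact: measurable_cst.
  by apply/funext => w; rewrite /balls_weight big_ord0.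
rewrite (_ : balls_weight n.+1 =
    balls_weight n \* (ball_weight \o (fun w => (clock n.+1 w, box n w)))); last first.
  by apply/funext => w; rewrite /balls_weight big_ord_recr.
apply: measurable_funM.
  by apply: IH; apply: subset_trans Sn => -[] m; exact: ltnW.
apply: (measurableT_comp measurable_ball_weight).
apply: measurable_fun_pair.
  by apply: clock_measurable_wrt => i ni; exact: Sn.
by apply: box_measurable_wrt; apply: Sn => /=.
Qed.

Lemma sum_box_law_le1 : \sum_(k <- J) p k <= 1.
Proof.
rewrite -lee_fin -sumEFin.
have -> : (\sum_(k <- J) (p k)%:E = \int[P]_w \sum_(k <- J) (\1_(box 0 @^-1` [set k]) w)%:E)%E.
  rewrite ge0_integral_sum//.
    apply: eq_bigr => k _; rewrite integral_indic ?setIT//; last exact: measurable_funPTI.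
    exact: esym (box_law scheme 0 k).
  by move=> k; apply/measurable_EFinP; apply: measurable_indic; exact: measurable_funPTI.
rewrite -[leRHS](integral_prob_cst P).
apply: ge0_le_integral => //.
- by move=> w _; apply: sume_ge0 => k _; rewrite lee_fin.
- apply: emeasurable_sum => k; apply/measurable_EFinP.
  by apply: measurable_indic; exact: measurable_funPTI.
- move=> w _; rewrite sumEFin lee_fin.
  have [bJ|bJ] := boolP (box 0 w \in J).
    rewrite (bigD1_seq (box 0 w))//= indicE mem_set// big1 ?addr0// => k kb.
    by rewrite indicE memNset// => /= /eqP; rewrite eq_sym (negbTE kb).
  rewrite big_seq big1// => k kJ; rewrite indicE memNset// => /= bk.
  by move: bJ; rewrite bk kJ.
Qed.

Let a_ge0 k : 0 <= a k.
Proof. by have /andP[_ z1] := z01 k; rewrite mulr_ge0// subr_ge0. Qed.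

Let a_le1 : \sum_(k <- J) a k <= 1.
Proof.
apply: le_trans sum_box_law_le1; apply: ler_sum => k _.
by have /andP[z0 _] := z01 k; rewrite ler_piMr// gerBl.
Qed.

Lemma integral_ball_weight n s :
  (\int[P]_w (ball_weight (s, box n w))%:E = (ray_factor J a t s)%:E)%E.
Proof.
pose g w := \sum_(k <- J) (1 - z k) * (s <= t k)%R%:R * \1_(box n @^-1` [set k]) w.
have g_ge0 w : 0 <= g w.
  by apply: sumr_ge0 => k _; rewrite !mulr_ge0// subr_ge0; have /andP[] := z01 k.
have mg : measurable_fun setT g.
  apply: measurable_sum => k; apply: measurable_funM => //.
  by apply: measurable_indic; exact: measurable_funPTI.
have bwE w : ball_weight (s, box n w) = 1 - g w.
  rewrite /ball_weight /g /=; congr (1 - _); apply: eq_bigr => k _.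
  congr (_ * _); rewrite indicE; congr ((nat_of_bool _)%:R).
  by apply/idP/idP => [/eqP bk|]; [exact: mem_set|move=> /set_mem/= ->].
have mh : measurable_fun setT (fun w => ball_weight (s, box n w)).
  rewrite (_ : (fun _ => _) = fun w => 1 - g w); last exact/funext.
  exact: measurable_funB.
have Ig : (\int[P]_w (g w)%:E = (\sum_(k <- J) a k * (s <= t k)%R%:R)%:E)%E.
  rewrite /g; under eq_integral do rewrite -sumEFin.
  rewrite ge0_integral_sum//; last 2 first.
  - move=> k; apply/measurable_EFinP; apply: measurable_funM => //.
    by apply: measurable_indic; exact: measurable_funPTI.
  - by move=> k w _; rewrite lee_fin !mulr_ge0// subr_ge0; have /andP[] := z01 k.
  rewrite -sumEFin; apply: eq_bigr => k _.
  under eq_integral do rewrite EFinM.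
  rewrite ge0_integralZl//; last 2 first.
  - by apply/measurable_EFinP; apply: measurable_indic; exact: measurable_funPTI.
  - by rewrite lee_fin !mulr_ge0// subr_ge0; have /andP[] := z01 k.
  rewrite integral_indic ?setIT//; last exact: measurable_funPTI.
  rewrite -[X in (_ * X)%E]/(distribution P (box n) [set k]) (box_law scheme).
  by rewrite -EFinM; congr (_%:E); rewrite /a; ring.
have : (\int[P]_w (ball_weight (s, box n w))%:E + \int[P]_w (g w)%:E = 1)%E.
  rewrite -ge0_integralD//.
  - under eq_integral do rewrite bwE -EFinD subrK.
    by rewrite integral_prob_cst.
  - by move=> w _; rewrite lee_fin ball_weight_ge0.
  - exact/measurable_EFinP.
  - by move=> w _; rewrite lee_fin.
  - exact/measurable_EFinP.
rewrite Ig /ray_factor EFinB => <-.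
by rewrite -addeA subee// adde0.
Qed.

(** Ball n is independent of the earlier ones. Averaging over its box gives
    ray_factor at its throwing time; averaging then over its waiting time
    gives ray_laplace at the previous throwing time, by the renewal
    equation. *)
Lemma balls_weight_martingale n :
  (\int[P]_w (balls_weight n.+1 w * ray_laplace J a t (clock n.+1 w))%:E =
   \int[P]_w (balls_weight n w * ray_laplace J a t (clock n w))%:E)%E.
Proof.
pose f1 (x : (R * R) * nat) : \bar R := (Num.max x.1.1 0 * ball_weight (x.1.2, x.2) *
   ray_laplace J a t x.1.2)%:E.
pose f2 (x : (R * R) * R) : \bar R := (Num.max x.1.1 0 *
   (ray_factor J a t (x.1.2 + x.2) * ray_laplace J a t (x.1.2 + x.2)))%:E.
have f1_ge0 x : (0 <= f1 x)%E.
  by rewrite lee_fin !mulr_ge0 ?expR_ge0 ?ball_weight_ge0// le_max lexx orbT.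
have f2_ge0 x : (0 <= f2 x)%E.
  by rewrite lee_fin !mulr_ge0 ?expR_ge0 ?ray_factor_ge0// le_max lexx orbT.
have m1 : measurable_fun setT f1.
  apply/measurable_EFinP; apply: measurable_funM; first apply: measurable_funM.
  - by apply: measurable_maxr => //; apply: measurableT_comp.
  - apply: (measurableT_comp measurable_ball_weight).
    by apply: measurable_fun_pair => //; exact: measurableT_comp.
  - apply: (measurableT_comp (measurable_ray_laplace J a t)).
    exact: measurableT_comp.
have msum : measurable_fun setT (fun x : (R * R) * R => x.1.2 + x.2).
  by apply: measurable_funD => //; exact: measurableT_comp.
have m2 : measurable_fun setT f2.
  apply/measurable_EFinP; apply: measurable_funM; last apply: measurable_funM.
  - by apply: measurable_maxr => //; apply: measurableT_comp.
  - exact: (measurableT_comp (measurable_ray_factor J a t)).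
  - exact: (measurableT_comp (measurable_ray_laplace J a t)).
(* First the box of ball n is averaged, given its throwing time; then the
   waiting time, given the earlier balls. *)
pose S1 : set (nat + nat) := before n `|` [set inl n].
transitivity (\int[P]_w f1 ((balls_weight n w, clock n.+1 w), box n w))%E.
  apply: eq_integral => w _; rewrite /f1 max_l ?balls_weight_ge0//=.
  by rewrite balls_weightS clockS.
rewrite (@block_fubini _ _ _ P _ F scheme_measurable scheme_setT scheme_setI F_indep
  _ _ _ _ S1 [set inr n] (fun w => (balls_weight n w, clock n.+1 w)) (box n) f1)//; first last.
- exact: box_measurable_wrt.
- apply: measurable_fun_pair.
    by apply: balls_weight_measurable_wrt; exact: subsetUl.
  apply: clock_measurable_wrt => i; rewrite ltnS leq_eqVlt => /predU1P[->|ni].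
    by right.
  by left.
- apply/seteqP; split => // i [] /[swap] -> [|//] /=; by rewrite ltnn.
transitivity (\int[P]_w f2 ((balls_weight n w, clock n w), xi n w))%E.
  apply: eq_integral => w _; rewrite /f1 /f2/=.
  under eq_integral => w' _ do rewrite mulrAC EFinM.
  rewrite ge0_integralZl//; last 3 first.
  - apply/measurable_EFinP; apply: (measurableT_comp measurable_ball_weight).
    exact: measurable_fun_pair.
  - by move=> w' _; rewrite lee_fin ball_weight_ge0.
  - by rewrite lee_fin mulr_ge0 ?expR_ge0// le_max lexx orbT.
  by rewrite integral_ball_weight -EFinM clockS; congr (_%:E); ring.
rewrite (@block_fubini _ _ _ P _ F scheme_measurable scheme_setT scheme_setI F_indep
  _ _ _ _ (before n) [set inl n] (fun w => (balls_weight n w, clock n w)) (xi n) f2)//; first last.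
- exact: xi_measurable_wrt.
- apply: measurable_fun_pair; first exact: balls_weight_measurable_wrt.
  exact: clock_measurable_wrt.
- by apply/seteqP; split => // i [] /[swap] -> /=; rewrite ltnn.
apply: eq_integral => w _; rewrite /f2/=.
under eq_integral => w' _ do rewrite EFinM.
rewrite ge0_integralZl//; last 3 first.
- have mc : measurable_fun setT (fun w' => clock n w + xi n w') by exact: measurable_funD.
  apply/measurable_EFinP; apply: measurable_funM.
    exact: (measurableT_comp (measurable_ray_factor J a t)).
  exact: (measurableT_comp (measurable_ray_laplace J a t)).
- by move=> w' _; rewrite lee_fin mulr_ge0 ?ray_factor_ge0 ?expR_ge0.
- by rewrite lee_fin le_max lexx orbT.
rewrite renewal_equation//; last by move=> A; exact: (waiting_time_law scheme).
by rewrite -EFinM max_l// balls_weight_ge0.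
Qed.

Lemma balls_weight_laplace n :
  (\int[P]_w (balls_weight n w * ray_laplace J a t (clock n w))%:E =
   (ray_laplace J a t 0)%:E)%E.
Proof.
elim: n => [|n IH]; last by rewrite balls_weight_martingale.
transitivity (\int[P]_w (ray_laplace J a t 0)%:E)%E; last exact: integral_prob_cst.
by apply: eq_integral => w _; rewrite /balls_weight /clock !big_ord0 mul1r.
Qed.

Lemma clock_laplace n : (\int[P]_w (expR (- clock n w))%:E = (2^-1 ^+ n)%:E)%E.
Proof.
have mexp : measurable_fun setT (fun y : R => (expR (- y))%:E).
  by apply/measurable_EFinP; apply: measurableT_comp => //; exact: measurableT_comp.
elim: n => [|n IH].
  rewrite expr0; transitivity (\int[P]_w 1)%E; last exact: integral_prob_cst.
  by apply: eq_integral => w _; rewrite /clock big_ord0 oppr0 expR0.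
transitivity (\int[P]_w ((expR (- clock n w))%:E * (expR (- xi n w))%:E))%E.
  by apply: eq_integral => w _; rewrite clockS -EFinM -expRD opprD.
rewrite (@block_integralM _ _ _ P _ F scheme_measurable scheme_setT scheme_setI F_indep
   (before n) [set inl n]); first last.
- by move=> w; rewrite lee_fin expR_ge0.
- by move=> w; rewrite lee_fin expR_ge0.
- by apply: (measurableT_comp mexp); exact: xi_measurable_wrt.
- by apply: (measurableT_comp mexp); apply: clock_measurable_wrt.
- by apply/seteqP; split => // i [] /[swap] -> /=; rewrite ltnn.
rewrite IH exponential_law_laplace; last by move=> A; exact: (waiting_time_law scheme).
by rewrite -EFinM -exprSr.
Qed.

Lemma clock_measurable n : measurable_fun setT (clock n).
Proof.
apply: (measurable_wrt_block (F := F) scheme_measurable (S := before n)).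
exact: clock_measurable_wrt.
Qed.

Lemma balls_weight_measurable n : measurable_fun setT (balls_weight n).
Proof.
apply: (measurable_wrt_block (F := F) scheme_measurable (S := before n)).
exact: balls_weight_measurable_wrt.
Qed.

Let horizon := \sum_(k <- J) Num.max (t k) 0.

(** Past the horizon ray_laplace is 1; before it the right-hand side is at
    least 1. *)
Let laplace_horizon y : 1 - ray_laplace J a t y <= expR (horizon - y).
Proof.
have [yh|hy] := leP y horizon.
  by apply: (@le_trans _ _ 1); rewrite ?gerBl ?expR_ge0// -expR0 ler_expR subr_ge0.
rewrite /ray_laplace big_seq big1 ?oppr0 ?expR0 ?subrr ?expR_ge0// => k kJ.
rewrite max_r ?mulr0// subr_le0; apply: le_trans (ltW hy).
rewrite /horizon (bigD1_seq k)//=.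
apply: (@le_trans _ _ (Num.max (t k) 0)); first by rewrite le_max lexx.
by rewrite lerDl; apply: sumr_ge0 => i _; rewrite le_max lexx orbT.
Qed.

(** The mean of balls_weight times ray_laplace does not depend on n, and this
    product differs from balls_weight by at most exp (horizon - clock), whose
    mean tends to 0. *)
Lemma balls_weight_cvg :
  (\int[P]_w (balls_weight n w)%:E)%E @[n --> \oo] --> (ray_laplace J a t 0)%:E.
Proof.
have mexp : measurable_fun setT (fun y : R => (expR (- y))%:E).
  by apply/measurable_EFinP; apply: measurableT_comp => //; exact: measurableT_comp.
have lo n : ((ray_laplace J a t 0)%:E <= \int[P]_w (balls_weight n w)%:E)%E.
  rewrite -(balls_weight_laplace n); apply: ge0_le_integral => //.
  - by move=> w _; rewrite lee_fin mulr_ge0 ?expR_ge0 ?balls_weight_ge0.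
  - apply/measurable_EFinP; apply: measurable_funM; first exact: balls_weight_measurable.
    by apply: (measurableT_comp (measurable_ray_laplace J a t)); exact: clock_measurable.
  - exact/measurable_EFinP/balls_weight_measurable.
  - move=> w _; rewrite lee_fin ler_piMr ?balls_weight_ge0//.
    exact: ray_laplace_le1.
have hi n : (\int[P]_w (balls_weight n w)%:E <=
    (ray_laplace J a t 0 + expR horizon * 2^-1 ^+ n)%:E)%E.
  rewrite EFinD EFinM -(balls_weight_laplace n) -clock_laplace.
  have mcl : measurable_fun setT (fun w => (expR (- clock n w))%:E).
    by apply: (measurableT_comp mexp); exact: clock_measurable.
  rewrite -ge0_integralZl//.
  have mQL : measurable_fun setT
      (fun w => (balls_weight n w * ray_laplace J a t (clock n w))%:E).
    apply/measurable_EFinP; apply: measurable_funM; first exact: balls_weight_measurable.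
    by apply: (measurableT_comp (measurable_ray_laplace J a t)); exact: clock_measurable.
  have QL_ge0 w : (0 <= (balls_weight n w * ray_laplace J a t (clock n w))%:E)%E.
    by rewrite lee_fin mulr_ge0 ?expR_ge0 ?balls_weight_ge0.
  have mE : measurable_fun setT (fun w => ((expR horizon)%:E * (expR (- clock n w))%:E)%E).
    exact: measurable_funeM.
  rewrite -ge0_integralD//.
  apply: ge0_le_integral => //.
  - by move=> w _; rewrite lee_fin balls_weight_ge0.
  - exact/measurable_EFinP/balls_weight_measurable.
  - apply: emeasurable_funD.
      apply/measurable_EFinP; apply: measurable_funM; first exact: balls_weight_measurable.
      by apply: (measurableT_comp (measurable_ray_laplace J a t)); exact: clock_measurable.
    by apply: measurable_funeM; apply: (measurableT_comp mexp); exact: clock_measurable.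
  - move=> w _; rewrite -EFinM -EFinD lee_fin -expRD -lerBlDl.
    rewrite -[X in X - _]mulr1 -mulrBr.
    apply: le_trans (laplace_horizon _).
    rewrite ler_piMl ?balls_weight_le1// subr_ge0; exact: ray_laplace_le1.
apply: (@squeeze_cvge _ _ _ _ (cst (ray_laplace J a t 0)%:E) _
  (fun n => (ray_laplace J a t 0 + expR horizon * 2^-1 ^+ n)%:E)).
- by apply: nearW => n; rewrite lo hi.
- exact: cvg_cst.
- apply: cvg_EFin; first exact: nearW.
  rewrite -[X in _ --> X]addr0; apply: cvgD; first exact: cvg_cst.
  rewrite -[X in _ --> X](mulr0 (expR horizon)); apply: cvgM; first exact: cvg_cst.
  apply: cvg_expr; rewrite ger0_norm// invf_lt1// ltr1n//.
Qed.

End laplace_functional.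

(** * Extraction of Poisson probabilities *)
Section poisson_weights.
Context {R : realType}.

Definition pois (i : nat) (x : R) : R := x ^+ i * expR (- x) / i`!%:R.

Definition pois_below (j : nat) (x : R) : R := \sum_(i < j) pois i x.

Lemma pois_ge0 i x : 0 <= x -> 0 <= pois i x.
Proof. by move=> x0; rewrite !mulr_ge0 ?exprn_ge0 ?expR_ge0// invr_ge0. Qed.

Lemma pois_below_le1 j x : 0 <= x -> pois_below j x <= 1.
Proof.
move=> x0; rewrite /pois_below; under eq_bigr do rewrite /pois mulrAC.
rewrite -mulr_suml expRN ler_pdivrMr ?expR_gt0// mul1r.
have := nondecreasing_cvgn_le (nondecreasing_series (fun n _ _ => exp_coeff_ge0 n x0))
  (is_cvg_series_exp_coeff x) j.
by rewrite /series/= big_mkord.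
Qed.

Lemma pois_below_ge0 j x : 0 <= x -> 0 <= pois_below j x.
Proof. by move=> x0; apply: sumr_ge0 => i _; exact: pois_ge0. Qed.

Lemma pois_le1 i x : 0 <= x -> pois i x <= 1.
Proof.
move=> x0; apply: le_trans (pois_below_le1 i.+1 x0).
rewrite /pois_below big_ord_recr/= lerDr; exact: pois_below_ge0.
Qed.

Lemma pois_generating (a z : R) :
  series (fun i => pois i a * z ^+ i) @ \oo --> expR (- (a * (1 - z))).
Proof.
have -> : expR (- (a * (1 - z))) = expR (- a) * expR (a * z).
  by rewrite -expRD; congr expR; ring.
rewrite (_ : series _ = (fun n => expR (- a) * series (exp_coeff (a * z)) n)).
  by apply: cvgM; [exact: cvg_cst|exact: is_cvg_series_exp_coeff].
apply/funext => n; rewrite /series/= mulr_sumr; apply: eq_bigr => i _.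
by rewrite /pois /exp_coeff/= exprMn; ring.
Qed.

(** If the coefficients below m agree, the difference of the series divided by
    z ^ m tends, as z decreases to 0, to the difference of the coefficients at
    m. *)
Lemma power_series_coef (u v : nat -> R) (B : R) (l : R -> R) :
  (forall i, `|u i| <= B) -> (forall i, `|v i| <= B) ->
  (forall z : R, 0 < z < 1 -> series (fun i => u i * z ^+ i) @ \oo --> l z) ->
  (forall z : R, 0 < z < 1 -> series (fun i => v i * z ^+ i) @ \oo --> l z) ->
  u = v.
Proof.
move=> uB vB ul vl; pose D i := u i - v i; pose C := B + B.
have DC i : `|D i| <= C by apply: le_trans (ler_normB _ _) _; exact: lerD.
have D0 z : 0 < z < 1 -> series (fun i => D i * z ^+ i) @ \oo --> (0 : R).
  move=> z01; rewrite -[X in _ --> X](subrr (l z)).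
  rewrite (_ : series _ = series (fun i => u i * z ^+ i) \- series (fun i => v i * z ^+ i)).
    by apply: cvgB; [exact: ul|exact: vl].
  by apply/funext => n; rewrite /series/= -sumrB; apply: eq_bigr => i _; rewrite /D mulrBl.
have geo (z : R) n m : 0 < z < 1 -> \sum_(m <= i < n) z ^+ i <= z ^+ m / (1 - z).
  move=> /andP[z0 z1]; rewrite ler_pdivlMr ?subr_gt0//.
  have [nm|mn] := leqP n m.
    by rewrite big_geq// mul0r exprn_ge0// ltW.
  have -> : (\sum_(m <= i < n) z ^+ i) * (1 - z) = z ^+ m - z ^+ n.
    rewrite -(subnKC (ltnW mn)); elim: (n - m)%N => [|k IH].
      by rewrite addn0 big_geq// mul0r subrr.
    by rewrite addnS big_nat_recr ?leq_addr//= mulrDl IH exprS; ring.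
  by rewrite gerBl exprn_ge0// ltW.
apply/funext => m; apply/eqP; rewrite -subr_eq0 -normr_eq0 -[X in `|X|]/(D m).
elim/ltn_ind: m => m IH.
have Dz z : 0 < z < 1 -> `|D m| <= C * (z / (1 - z)).
  move=> z01; have /andP[z0 z1] := z01.
  rewrite -(ler_pM2r (exprn_gt0 m z0)).
  have Dn n : `|D m * z ^+ m - series (fun i => D i * z ^+ i) (m.+1 + n)| <=
      C * (z / (1 - z)) * z ^+ m.
    have -> : series (fun i => D i * z ^+ i) (m.+1 + n) =
        D m * z ^+ m + \sum_(m.+1 <= i < m.+1 + n) D i * z ^+ i.
      rewrite /series/= (@big_cat_nat _ _ _ m.+1)//= ?leq_addr//.
      rewrite big_nat_recr//= big_nat big1 ?add0r// => i /andP[_ /IH].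
      by rewrite normr_eq0 => /eqP ->; rewrite mul0r.
    rewrite opprD addrA subrr add0r normrN.
    apply: le_trans (ler_norm_sum _ _ _) _.
    apply: (@le_trans _ _ (\sum_(m.+1 <= i < m.+1 + n) C * z ^+ i)).
      apply: ler_sum => i _; rewrite normrM (ger0_norm (exprn_ge0 i (ltW z0))).
      by apply: ler_wpM2r => //; apply: exprn_ge0; exact: ltW.
    rewrite -mulr_sumr -!mulrA ler_wpM2l//; first exact: le_trans (DC 0%N).
    apply: le_trans (geo _ _ _ z01) _; rewrite exprS le_eqVlt; apply/orP; left.
    by apply/eqP; ring.
  have : `|D m * z ^+ m - series (fun i => D i * z ^+ i) n| @[n --> \oo] -->
      `|D m * z ^+ m - 0|.
    by apply: cvg_norm; apply: cvgB; [exact: cvg_cst|exact: D0].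
  rewrite subr0 normrM (ger0_norm (exprn_ge0 m (ltW z0))) => cv.
  apply: (cvgr_to_le cv).
  exists m.+1 => // n /= mn; rewrite -(subnKC mn); exact: Dn.
rewrite eq_le normr_ge0 andbT.
have C0 : 0 <= C by exact: le_trans (DC 0%N).
apply/ler_addgt0Pl => e e0; rewrite addr0.
pose f := e / (C + 1).
have f0 : 0 < f by rewrite divr_gt0// ltr_wpDl.
have := Dz (f / (1 + f)).
(* This z = f / (1 + f) solves z / (1 - z) = f. *)
have -> : f / (1 + f) / (1 - f / (1 + f)) = f by field; rewrite lt0r_neq0//=; lra.
move=> H; apply: le_trans (H _) _.
  rewrite divr_gt0//=; last lra.
  by rewrite ltr_pdivrMr; lra.
by rewrite /f mulrA ler_pdivrMr ?ltr_wpDl// mulrDr mulr1 mulrC lerDl ltW.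
Qed.

End poisson_weights.

Section zpow.
Context {R : realType}.

(** The argument is a number of balls; at +oo the value 0 is the limit of the
    powers of any z in [0, 1). *)
Definition zpow (z : R) (x : \bar R) : R :=
  if x is r%:E then z ^+ Num.truncn r else 0.

Lemma counting_nat_or_oo (X : set nat) :
  counting X = +oo%E :> \bar R \/ exists m : nat, counting X = m%:R%:E :> \bar R.
Proof. by rewrite /counting; case: ifP => _; [right; eexists|left]. Qed.

Lemma counting_partial_cvg (X : set nat) :
  ((\sum_(i < n) (nat_of_ord i \in X))%N%:R%:E : \bar R) @[n --> \oo] --> (counting X : \bar R).
Proof.
rewrite counting_dirac.
have -> : (fun n => (\sum_(i < n) (nat_of_ord i \in X))%N%:R%:E : \bar R) =
    (fun n => (\sum_(0 <= i < n) (\d_ i X : \bar R))%E).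
  apply/funext => n; rewrite big_mkord natr_sum -sumEFin; apply: eq_bigr => i _.
  by rewrite diracE.
exact: is_cvg_nneseries.
Qed.

Lemma zpow_cvg (z : R) (X : set nat) : 0 <= z < 1 ->
  z ^+ (\sum_(i < n) (nat_of_ord i \in X))%N @[n --> \oo] --> zpow z (counting X).
Proof.
move=> /andP[z0 z1]; have := @counting_partial_cvg X.
have [->|[m ->]] := counting_nat_or_oo X.
  move=> /cvgenyP cv /=.
  apply: (cvg_comp _ _ cv); apply: cvg_expr; rewrite ger0_norm//.
move=> /fine_cvg/= cv; rewrite /zpow natrK.
apply: cvg_near_cst; near=> n.
have : `|m%:R - (\sum_(i < n) (nat_of_ord i \in X))%N%:R| < 1 :> R.
  by near: n; have /cvgrPdist_lt/(_ _ ltr01) := cv.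
move=> mn; congr (_ ^+ _); apply/eqP.
move: mn; set q := (\sum_(_ < _) _)%N; rewrite ltr_norml => /andP[h1 h2].
by rewrite eqn_leq; apply/andP; split; rewrite -ltnS -(ltr_nat R) -natr1; lra.
Unshelve. all: by end_near. Qed.

End zpow.

Section extraction.
Context {R : realType} {d : measure_display} {T : measurableType d}
  (P : probability T R).
Variables (N : T -> \bar R) (Y : T -> R).
Hypothesis N_nat : forall w, N w = +oo%E \/ exists m : nat, N w = m%:R%:E.
Hypothesis N_measurable : measurable_fun setT N.
Hypothesis Y_measurable : measurable_fun setT Y.
Hypothesis Y01 : forall w, 0 <= Y w <= 1.

Let E i := [set w | N w = i%:R%:E].

Lemma level_measurable i : measurable (E i).
Proof.
rewrite (_ : E i = N @^-1` [set i%:R%:E]) // -[X in measurable X]setTI.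
exact: N_measurable.
Qed.

Let mYE i : measurable_fun setT (fun w => Y w * \1_(E i) w).
Proof.
by apply: measurable_funM => //; apply: measurable_indic; exact: level_measurable.
Qed.

Let YE01 i w : 0 <= Y w * \1_(E i) w <= 1.
Proof.
have /andP[y0 y1] := Y01 w.
by rewrite mulr_ge0//= mulr_ile1// indicE lern1 leq_b1.
Qed.

Let c i := fine (\int[P]_w (Y w * \1_(E i) w)%:E).

Let bounded01 (f : T -> R) : measurable_fun setT f -> (forall w, 0 <= f w <= 1) ->
  (0 <= \int[P]_w (f w)%:E <= 1)%E.
Proof.
move=> mf f01; apply/andP; split.
  by apply: integral_ge0 => w _; rewrite lee_fin; have /andP[] := f01 w.
rewrite -[leRHS](integral_prob_cst P); apply: ge0_le_integral => //.
- by move=> w _; rewrite lee_fin; have /andP[] := f01 w.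
- exact/measurable_EFinP.
- by move=> w _; rewrite lee_fin; have /andP[] := f01 w.
Qed.

Let cE i : (\int[P]_w (Y w * \1_(E i) w)%:E = (c i)%:E)%E.
Proof.
have /andP[h0 h1] := bounded01 (mYE i) (YE01 i).
by rewrite /c fineK// fin_numE gt_eqF ?lt_eqF//= ?(lt_le_trans _ h0) ?(le_lt_trans h1) ?ltNyr ?ltry.
Qed.

Lemma zpow_series w (z : R) : 0 <= z ->
  (\sum_(i <oo) (z ^+ i * \1_(E i) w)%:E = (zpow z (N w))%:E)%E.
Proof.
move=> z0; have [No|[m Nm]] := N_nat w.
  rewrite eseries0 => [|i _ _]; first by rewrite No.
  by rewrite indicE memNset ?mulr0//= /E/= No.
rewrite (nneseriesD1 (n := m))//; last first.
  by move=> k _; rewrite lee_fin mulr_ge0// exprn_ge0.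
rewrite eseries0 => [|i _ /= im].
  by rewrite adde0 Nm /= natrK indicE mem_set ?mulr1.
rewrite indicE memNset ?mulr0//= /E/= Nm => -[] /eqP.
by rewrite eqr_nat => /eqP mi; move: im; rewrite mi eqxx.
Qed.

(** As functions of z both sides of the hypothesis are power series; their
    coefficients are the integrals of Y over the events N = i and the Poisson
    weights. Since Y is arbitrary this yields the law of N and its
    independence from other variables together. *)
Lemma poisson_extraction (C a : R) : 0 <= C -> 0 <= a ->
  (forall z : R, 0 <= z < 1 ->
    (\int[P]_w (Y w * zpow z (N w))%:E = (C * expR (- (a * (1 - z))))%:E)%E) ->
  forall j, (\int[P]_w (Y w * \1_[set w | (N w < j%:R%:E)%E] w)%:E =
     (C * pois_below j a)%:E)%E.
Proof.
move=> C0 a0 Yz.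
have cC : c = fun i => C * pois i a.
  apply: (@power_series_coef _ _ _ (1 + C) (fun z => C * expR (- (a * (1 - z))))).
  - move=> i; rewrite ger0_norm; last first.
      by apply: fine_ge0; have /andP[] := bounded01 (mYE i) (YE01 i).
    apply: (@le_trans _ _ 1); last by rewrite lerDl.
    by rewrite -lee_fin -cE; have /andP[] := bounded01 (mYE i) (YE01 i).
  - move=> i; rewrite ger0_norm; last by apply: mulr_ge0 => //; exact: pois_ge0.
    by apply: (@le_trans _ _ C); rewrite ?lerDr// ler_piMr// pois_le1.
  - move=> z /andP[z0 z1].
    have := Yz z; rewrite ltW// z1 => /(_ isT).
    have -> : (\int[P]_w (Y w * zpow z (N w))%:E =
        \sum_(i <oo) (c i * z ^+ i)%:E)%E.
      transitivity (\int[P]_w \sum_(i <oo) (z ^+ i * (Y w * \1_(E i) w))%:E)%E.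
        apply: eq_integral => w _; rewrite EFinM -zpow_series ?ltW// -nneseriesZl//.
          by apply: eq_eseriesr => i _; rewrite -EFinM mulrCA.
        by move=> i _; rewrite lee_fin mulr_ge0// exprn_ge0// ltW.
      rewrite integral_nneseries//.
      - apply: eq_eseriesr => i _; under eq_integral do rewrite EFinM.
        rewrite ge0_integralZl//.
        + by rewrite cE -EFinM mulrC.
        + exact/measurable_EFinP.
        + by move=> w _; rewrite lee_fin; have /andP[] := YE01 i w.
        + by rewrite lee_fin exprn_ge0// ltW.
      - by move=> i; apply/measurable_EFinP; apply: measurable_funM.
      - move=> i w _; rewrite lee_fin mulr_ge0// ?exprn_ge0 ?(ltW z0)//.
        by have /andP[] := YE01 i w.
    move=> lim_eq.
    have : (\sum_(0 <= i < n) (c i * z ^+ i)%:E)%E @[n --> \oo] -->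
        (C * expR (- (a * (1 - z))))%:E.
      rewrite -lim_eq; apply: is_cvg_nneseries => i _ _.
      rewrite lee_fin mulr_ge0 ?exprn_ge0 ?(ltW z0)//.
      by apply: fine_ge0; have /andP[] := bounded01 (mYE i) (YE01 i).
    move=> /fine_cvg; apply: cvg_trans; apply: near_eq_cvg; apply: nearW => n /=.
    by rewrite sumEFin.
  - move=> z _; rewrite (_ : series _ = (fun n => C * series (fun i => pois i a * z ^+ i) n)).
      by apply: cvgM; [exact: cvg_cst|exact: pois_generating].
    by apply/funext => n; rewrite /series/= mulr_sumr; apply: eq_bigr => i _; rewrite mulrA.
move=> j.
have -> : (\int[P]_w (Y w * \1_[set w | (N w < j%:R%:E)%E] w)%:E =
    \int[P]_w \sum_(i < j) (Y w * \1_(E i) w)%:E)%E.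
  apply: eq_integral => w _; rewrite sumEFin -mulr_sumr; congr ((_ * _)%:E).
  have [No|[m Nm]] := N_nat w.
    rewrite indicE memNset/= ?No// big1// => i _.
    by rewrite indicE memNset// /E/= No.
  have [mj|jm] := ltnP m j.
    rewrite indicE mem_set/= ?Nm ?lte_fin ?ltr_nat//.
    rewrite (bigD1 (Ordinal mj))//= indicE mem_set /E//= big1 ?addr0// => i im.
    rewrite indicE memNset//= Nm => -[] /eqP; rewrite eqr_nat => /eqP mi.
    by case/eqP: im; apply/val_inj.
  rewrite indicE memNset/= ?Nm ?lte_fin ?ltr_nat; last by rewrite ltnNge jm.
  rewrite big1// => i _; rewrite indicE memNset// /E/= Nm => -[] /eqP.
  by rewrite eqr_nat => /eqP mi; move: (ltn_ord i); rewrite -mi ltnNge jm.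
rewrite ge0_integral_sum//; last 2 first.
- by move=> i; apply/measurable_EFinP.
- by move=> i w _; rewrite lee_fin; have /andP[] := YE01 i w.
rewrite /pois_below mulr_sumr -sumEFin; apply: eq_bigr => i _.
by rewrite cE cC.
Qed.

End extraction.

(** * Independence of the counts of the boxes *)
Section box_counts.
Context {R : realType} {d : measure_display} {T : measurableType d}
  (P : probability T R) (p : nat -> R)
  (xi : nat -> {RV P >-> R}) (box : nat -> {RV P >-> nat}).
Hypothesis p_ge0 : forall k, 0 <= p k.
Hypothesis scheme : poissonized_Karlin_scheme p xi box.

Local Notation balls := (balls xi box).

Definition hits k t w := [set m | throw_time xi m w <= t /\ box m w = k].

Lemma balls_series k t w : balls k t w =
  (\sum_(n <oo) (\1_[set w | throw_time xi n w <= t /\ box n w = k] w)%:E)%E.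
Proof.
rewrite /Defs.balls counting_dirac; apply: eq_eseriesr => n _.
by rewrite diracE indicE; congr ((nat_of_bool _)%:R%:E).
Qed.

Lemma ball_event_measurable n k t :
  measurable [set w | throw_time xi n w <= t /\ box n w = k].
Proof.
have -> : [set w | throw_time xi n w <= t /\ box n w = k] =
   (clock xi n.+1 @^-1` `]-oo, t]) `&` (box n @^-1` [set k]).
  by apply/seteqP; split => w /=; rewrite in_itv.
apply: measurableI; last exact: measurable_funPTI.
rewrite -[X in measurable X]setTI.
by apply: clock_measurable => //; exact: measurable_itv.
Qed.

Lemma balls_measurable k t : measurable_fun setT (balls k t).
Proof.
rewrite (_ : balls k t = fun w => (\sum_(n <oo)
    (\1_[set w | throw_time xi n w <= t /\ box n w = k] w)%:E)%E); last first.
  by apply/funext => w; exact: balls_series.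
apply: ge0_emeasurable_sum => [n w _ _|n _]; first by rewrite lee_fin.
by apply/measurable_EFinP; apply: measurable_indic; exact: ball_event_measurable.
Qed.

Lemma balls_nat_or_oo k t w :
  balls k t w = +oo%E \/ exists m : nat, balls k t w = m%:R%:E.
Proof. exact: counting_nat_or_oo. Qed.

Lemma zpow01 (z : R) x : 0 <= z < 1 -> 0 <= zpow z x <= 1.
Proof.
move=> /andP[z0 z1]; case: x => [r| |]/=; rewrite ?lexx ?ler01//.
by rewrite exprn_ge0// exprn_ile1// ltW.
Qed.

Lemma balls_weight_prod (J : seq nat) (t z : nat -> R) n w : uniq J ->
  balls_weight xi box J t z n w = \prod_(k <- J) z k ^+
    (\sum_(i < n) (nat_of_ord i \in hits k (t k) w))%N.
Proof.
move=> uJ; under [RHS]eq_bigr do rewrite -prodrXr.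
rewrite exchange_big/=; apply: eq_bigr => i _; rewrite ball_weightE//.
have mE k : (nat_of_ord i \in hits k (t k) w) =
    (clock xi i.+1 w <= t k) && (box i w == k).
  by apply/idP/idP => [/set_mem/= [-> ->]|/andP[h1 /eqP h2]]; rewrite ?eqxx// inE.
have [bJ|bJ] /= := boolP (box i w \in J).
  rewrite (bigD1_seq (box i w))//= mE eqxx andbT big1 ?mulr1 => [|k kb].
    by case: ifP => _; rewrite ?expr1 ?expr0.
  by rewrite mE eq_sym (negbTE kb) andbF.
rewrite big_seq big1// => k kJ; rewrite mE (_ : box i w == k = false) ?andbF//.
by apply: contraNF bJ => /eqP ->.
Qed.

Lemma zpow_measurable (z : R) k t : 0 <= z < 1 ->
  measurable_fun setT (fun w => zpow z (balls k t w)).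
Proof.
move=> z01.
apply: (measurable_fun_cvg (h := fun n w => balls_weight xi box [:: k] (fun=> t) (fun=> z) n w)).
  move=> n; apply: balls_weight_measurable.
move=> w _.
rewrite (_ : (fun n => _) = (fun n => z ^+
    (\sum_(i < n) (nat_of_ord i \in hits k t w))%N)).
  exact: zpow_cvg.
by apply/funext => n; rewrite balls_weight_prod// big_seq1.
Qed.

Lemma zpow_prod_measurable (J : seq nat) (t z : nat -> R) : (forall k, 0 <= z k < 1) ->
  measurable_fun setT (fun w => \prod_(k <- J) zpow (z k) (balls k (t k) w)).
Proof. by move=> z01; apply: measurable_prod => k _; exact: zpow_measurable. Qed.

(** The bounded limit of the weights of the first n balls. *)
Lemma balls_generating (J : seq nat) (t z : nat -> R) : uniq J ->
  (forall k, 0 <= t k) -> (forall k, 0 <= z k < 1) ->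
  (\int[P]_w (\prod_(k <- J) zpow (z k) (balls k (t k) w))%:E =
   (\prod_(k <- J) expR (- (p k * t k * (1 - z k))))%:E)%E.
Proof.
move=> uJ t0 z01.
have z01' k : 0 <= z k <= 1 by have /andP[-> /ltW ->] := z01 k.
have h1 := balls_weight_cvg p_ge0 scheme (t := t) uJ z01'.
have prod01 (f : nat -> R) : (forall k, 0 <= f k <= 1) -> 0 <= \prod_(k <- J) f k <= 1.
  move=> f01; rewrite prodr_ge0/=; last by move=> k _; have /andP[] := f01 k.
  by apply: prodr_ile1 => k _; exact: f01.
have bw01 n w : 0 <= balls_weight xi box J t z n w <= 1.
  by rewrite balls_weight_ge0//= balls_weight_le1.
have h2 := @bounded_convergence _ _ _ P (fun n => balls_weight xi box J t z n)
  (fun w => \prod_(k <- J) zpow (z k) (balls k (t k) w)).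
have {}h2 := h2 (balls_weight_measurable xi box J t z)
  (zpow_prod_measurable J t z01).
have {}h2 := h2 bw01.
have {}h2 : (\int[P]_w (balls_weight xi box J t z n w)%:E)%E @[n --> \oo] -->
    (\int[P]_w (\prod_(k <- J) zpow (z k) (balls k (t k) w))%:E)%E.
  apply: h2 => w.
  rewrite (_ : (fun n => _) = fun n => \prod_(k <- J) z k ^+
       (\sum_(i < n) (nat_of_ord i \in hits k (t k) w))%N).
    by apply: cvg_big => //; [exact: mul_continuous|move=> k _; exact: zpow_cvg].
  by apply/funext => n; rewrite /= balls_weight_prod.
have := cvg_unique _ h2 h1; move=> ->//.
rewrite /ray_laplace -sumrN expR_sum; congr (_%:E); apply: eq_bigr => k _.
by rewrite subr0 max_l//; congr expR; ring.
Qed.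

Variable j : nat.

Definition few_balls k t := [set w | (balls k t w < j%:R%:E)%E].

Lemma few_balls_measurable k t : measurable (few_balls k t).
Proof.
rewrite -[X in measurable X]setTI; apply: emeasurable_fun_infty_o => //.
exact: balls_measurable.
Qed.

(** The generating variables are traded for indicators one box at a time: the
    remaining factors play the part of Y in poisson_extraction. *)
Lemma few_balls_joint_aux (J1 J2 : seq nat) (t z : nat -> R) : uniq (J1 ++ J2) ->
  (forall k, 0 <= t k) -> (forall k, 0 <= z k < 1) ->
  (\int[P]_w ((\prod_(k <- J1) \1_(few_balls k (t k)) w) *
       \prod_(k <- J2) zpow (z k) (balls k (t k) w))%:E =
   ((\prod_(k <- J1) pois_below j (p k * t k)) *
      \prod_(k <- J2) expR (- (p k * t k * (1 - z k))))%:E)%E.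
Proof.
move=> + t0; elim: J1 J2 z => [|k0 J1 IH] J2 z.
  move=> uJ z01; rewrite !big_nil mul1r -balls_generating//.
  by apply: eq_integral => w _; rewrite big_nil mul1r.
move=> uJ z01.
pose Y w := (\prod_(k <- J1) \1_(few_balls k (t k)) w) *
       \prod_(k <- J2) zpow (z k) (balls k (t k) w).
have prod01 (J : seq nat) (f : nat -> R) :
    (forall k, 0 <= f k <= 1) -> 0 <= \prod_(k <- J) f k <= 1.
  move=> f01; rewrite prodr_ge0/=; last by move=> k _; have /andP[] := f01 k.
  by apply: prodr_ile1 => k _; exact: f01.
have Y01 w : 0 <= Y w <= 1.
  have /andP[a0 a1] : 0 <= \prod_(k <- J1) (\1_(few_balls k (t k)) w : R) <= 1.
    by apply: prod01 => k; rewrite indicE ler0n lern1 leq_b1.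
  have /andP[b0 b1] : 0 <= \prod_(k <- J2) zpow (z k) (balls k (t k) w) <= 1.
    by apply: prod01 => k; exact: zpow01.
  by rewrite mulr_ge0//= mulr_ile1.
have mY : measurable_fun setT Y.
  apply: measurable_funM; last exact: zpow_prod_measurable.
  apply: measurable_prod => k _; apply: measurable_indic; exact: few_balls_measurable.
pose C : R := (\prod_(k <- J1) pois_below j (p k * t k)) *
   \prod_(k <- J2) expR (- (p k * t k * (1 - z k))).
have C0 : 0 <= C.
  apply: mulr_ge0; apply: prodr_ge0 => k _; last exact: expR_ge0.
  by apply: pois_below_ge0; rewrite mulr_ge0.
have [k0J1 k0J2] : k0 \notin J1 /\ k0 \notin J2.
  by move: uJ => /= /andP[]; rewrite mem_cat negb_or => /andP[].
have gen zeta : 0 <= zeta < 1 -> (\int[P]_w (Y w * zpow zeta (balls k0 (t k0) w))%:E =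
     (C * expR (- (p k0 * t k0 * (1 - zeta))))%:E)%E.
  move=> zeta01.
  pose z' k := if k == k0 then zeta else z k.
  have z'01 k : 0 <= z' k < 1 by rewrite /z'; case: ifP.
  have zJ2 k : k \in J2 -> z' k = z k.
    by move=> kJ2; rewrite /z'; case: eqP => // ek; move: k0J2; rewrite -ek kJ2.
  have := IH (k0 :: J2) z'; rewrite -(perm_uniq (s1 := (k0 :: J1) ++ J2)); last first.
    by rewrite -[k0 :: J1]cat1s -catA perm_catCA.
  move=> /(_ uJ z'01).
  rewrite big_cons /z' eqxx -/z' mulrCA.
  rewrite [X in _ * X](_ : _ = C); last first.
    rewrite /C; congr (_ * _); rewrite big_seq [RHS]big_seq; apply: eq_bigr => k kJ.
    by rewrite -/(z' k) zJ2.
  rewrite mulrC => <-; apply: eq_integral => w _; congr (_%:E).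
  rewrite big_cons eqxx /Y -mulrA; congr (_ * _); rewrite mulrC; congr (_ * _).
  by rewrite big_seq [RHS]big_seq; apply: eq_bigr => k kJ; rewrite -/(z' k) zJ2.
have := @poisson_extraction _ _ _ P (balls k0 (t k0)) Y (balls_nat_or_oo k0 (t k0))
  (@balls_measurable k0 (t k0)) mY Y01 C (p k0 * t k0) C0 (mulr_ge0 (p_ge0 k0) (t0 k0)) gen j.
rewrite big_cons -mulrA mulrC -/C => <-.
apply: eq_integral => w _; congr (_%:E).
by rewrite big_cons -mulrA mulrC.
Qed.

Lemma few_balls_joint (J : seq nat) (t : nat -> R) : uniq J ->
  (forall k, 0 <= t k) ->
  P (\bigcap_(k in [set` J]) few_balls k (t k)) =
  (\prod_(k <- J) pois_below j (p k * t k))%:E.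
Proof.
move=> uJ t0.
have := @few_balls_joint_aux J [::] t (fun=> 0); rewrite cats0 => /(_ uJ t0).
rewrite lexx ltr01 big_nil mulr1 => <-//.
have mB : measurable (\bigcap_(k in [set` J]) few_balls k (t k)).
  by apply: fin_bigcap_measurable => // k _; exact: few_balls_measurable.
transitivity (\int[P]_w (\1_(\bigcap_(k in [set` J]) few_balls k (t k)) w)%:E)%E.
  by rewrite integral_indic// setIT.
apply: eq_integral => w _; congr (_%:E); rewrite big_nil mulr1 indicE.
have [h|h] := boolP (w \in _).
  rewrite big_seq big1// => k kJ; rewrite indicE mem_set//.
  by move/set_mem : h => /(_ k kJ).
have /existsPNP[k /= kJ nk] : ~ forall k, [set` J] k -> few_balls k (t k) w.
  by move=> h'; move/negP : h; apply; exact/mem_set.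
by rewrite (bigD1_seq k)//= indicE memNset// mul0r.
Qed.

(** The time is free, so that this class carries the whole history of box k at
    the level j. *)
Definition few_balls_events (k : nat) : set_system T :=
  [set E | E = setT \/ exists2 t, 0 <= t & E = few_balls k t].

Lemma few_balls_law k t : 0 <= t -> P (few_balls k t) = (pois_below j (p k * t))%:E.
Proof.
move=> t0; have := @few_balls_joint [:: k] (fun=> t) isT (fun=> t0).
by rewrite big_seq1 set_cons1 bigcap_set1.
Qed.

Lemma few_balls_independent : mutually_independent P few_balls_events.
Proof.
move=> J E FE.
have /choice[t tE] k : exists t, 0 <= t /\ (k \in J -> E k <> setT -> E k = few_balls k t).
  have [kJ|kJ] := boolP (k \in J); last by exists 0; split.
  have [ET|[t t0 Et]] := FE k kJ; first by exists 0; split.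
  by exists t; split.
pose J' := [seq k <- J | `[< E k <> setT >]].
have uJ' : uniq J' by apply: filter_uniq; exact: fset_uniq.
have -> : \bigcap_(k in [set` J]) E k = \bigcap_(k in [set` J']) few_balls k (t k).
  apply/seteqP; split => w wE k /=.
    rewrite mem_filter => /andP[/asboolP nT kJ].
    by have [_ <-//] := tE k; exact: wE.
  move=> kJ; have [->//|nT] := pselect (E k = setT).
  have [_ ->//] := tE k; apply: wE; rewrite /= mem_filter kJ andbT; exact/asboolP.
rewrite few_balls_joint// ?(fun k => proj1 (tE k))//; last by move=> k; have [] := tE k.
rewrite -prodEFin /J' big_filter [RHS](bigID (fun k => `[< E k <> setT >]))/=.
rewrite [X in (_ * X)%E]big1 ?mule1; last first.
  by move=> k /asboolPn/contrapT ->; exact: probability_setT.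
rewrite big_seq_cond [RHS]big_seq_cond; apply: eq_bigr => k /andP[kJ /asboolP nT].
by have [t0 ->//] := tE k; rewrite few_balls_law.
Qed.

End box_counts.

(** * Exponential bounds for sums of independent indicators *)
Section bernoulli_laplace.
Context {R : realType}.

Lemma expR_taylor3 (x : R) : `|x| <= 1 ->
  `|expR x - (1 + x + x ^+ 2 / 2)| <= `|x| ^+ 3 / 3.
Proof.
move=> x1.
have fact_lb k : (6 * 2 ^ k <= (3 + k)`!)%N.
  elim: k => // k IH; rewrite addnS factS expnS mulnCA.
  by apply: leq_mul => //; rewrite addSn.
have bound k : `|\sum_(3 <= i < 3 + k) x ^+ i / i`!%:R| <=
    `|x| ^+ 3 / 3 * (1 - 2^-1 ^+ k).
  elim: k => [|k IH].
    by rewrite addn0 big_geq// normr0 expr0 subrr mulr0.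
  rewrite addnS big_nat_recr ?leq_addr//=.
  apply: le_trans (ler_normD _ _) _.
  have -> : `|x| ^+ 3 / 3 * (1 - 2^-1 ^+ k.+1) =
    `|x| ^+ 3 / 3 * (1 - 2^-1 ^+ k) + `|x| ^+ 3 * (6 * 2 ^+ k)^-1.
    by rewrite (exprS _ k) invfM -exprVn; field.
  apply: lerD => //; rewrite normrM normrX normfV [X in _ / X]ger0_norm//.
  rewrite exprD -mulrA ler_wpM2l ?exprn_ge0//.
  apply: (@le_trans _ _ (1 * ((3 + k)`!%:R)^-1)).
    by rewrite ler_wpM2r ?invr_ge0// exprn_ile1.
  rewrite mul1r lef_pV2 ?posrE ?ltr0n ?fact_gt0// ?mulr_gt0 ?exprn_gt0//.
  by rewrite -natrX -natrM ler_nat.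
have cv : `|series (exp_coeff x) n - (1 + x + x ^+ 2 / 2)| @[n --> \oo] -->
   `|expR x - (1 + x + x ^+ 2 / 2)|.
  apply: cvg_norm; apply: cvgB; last exact: cvg_cst.
  exact: is_cvg_series_exp_coeff.
apply: (cvgr_to_le cv); exists 3%N => // n /= n3.
rewrite -(subnKC n3) /series/= (@big_cat_nat _ _ _ 3)//= ?leq_addr//.
rewrite 3?big_nat_recr//= big_geq// add0r /exp_coeff/= expr0 expr1 !fact0 !factS fact0.
rewrite [X in `|X|](_ : _ = \sum_(3 <= i < 3 + (n - 3)) x ^+ i / i`!%:R); last first.
  by rewrite !invr1 !mulr1 !muln1; ring.
apply: le_trans (bound _) _.
by rewrite ler_piMr ?divr_ge0 ?exprn_ge0// gerBl exprn_ge0// invr_ge0.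
Qed.

Lemma expR_quad_ub (x : R) : `|x| <= 1 ->
  expR x <= 1 + x + x ^+ 2 / 2 * (1 + `|x|).
Proof.
move=> x1; have := expR_taylor3 x1; rewrite ler_norml => /andP[_].
have -> : `|x| ^+ 3 = x ^+ 2 * `|x| by rewrite exprSr -normrX ger0_norm// sqr_ge0.
have := mulr_ge0 (sqr_ge0 x) (normr_ge0 x); lra.
Qed.

Lemma expR_quad_lb (x : R) : `|x| <= 1 ->
  1 + x + x ^+ 2 / 2 * (1 - `|x|) <= expR x.
Proof.
move=> x1; have := expR_taylor3 x1; rewrite ler_norml => /andP[+ _].
have -> : `|x| ^+ 3 = x ^+ 2 * `|x| by rewrite exprSr -normrX ger0_norm// sqr_ge0.
have := mulr_ge0 (sqr_ge0 x) (normr_ge0 x); lra.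
Qed.

(** Laplace transform at th of a centred Bernoulli variable of parameter q. *)
Definition bernoulli_laplace (q th : R) : R :=
  q * expR (th * (1 - q)) + (1 - q) * expR (- (th * q)).

Lemma bernoulli_laplace_ub (q th : R) : 0 <= q <= 1 -> `|th| <= 1 ->
  bernoulli_laplace q th <= expR (th ^+ 2 / 2 * (1 + `|th|) * (q * (1 - q))).
Proof.
move=> /andP[q0 q1] th1.
apply: le_trans (expR_ge1Dx _).
have b1 : `|th * (1 - q)| <= `|th|.
  by rewrite normrM ler_piMr// ger0_norm; lra.
have b2 : `|- (th * q)| <= `|th| by rewrite normrN normrM ler_piMr// ger0_norm; lra.
have e1 : expR (th * (1 - q)) <= 1 + th * (1 - q) + (th * (1 - q)) ^+ 2 / 2 * (1 + `|th|).
  apply: le_trans (expR_quad_ub (le_trans b1 th1)) _.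
  by rewrite lerD2l ler_wpM2l ?divr_ge0 ?sqr_ge0// lerD2l.
have e2 : expR (- (th * q)) <= 1 + - (th * q) + (- (th * q)) ^+ 2 / 2 * (1 + `|th|).
  apply: le_trans (expR_quad_ub (le_trans b2 th1)) _.
  by rewrite lerD2l ler_wpM2l ?divr_ge0 ?sqr_ge0// lerD2l.
have q1' : 0 <= 1 - q by lra.
apply: le_trans (lerD (ler_wpM2l q0 e1) (ler_wpM2l q1' e2)) _.
by rewrite le_eqVlt; apply/orP; left; apply/eqP; field.
Qed.

Lemma bernoulli_laplace_lb (q th : R) : 0 <= q <= 1 -> 0 <= th <= 1 ->
  expR (th ^+ 2 / 2 * (1 - 2 * th) * (q * (1 - q))) <= bernoulli_laplace q th.
Proof.
move=> /andP[q0 q1] /andP[th0 th1].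
have b1 : `|th * (1 - q)| <= th.
  by rewrite normrM ger0_norm// ler_piMr// ger0_norm; lra.
have b2 : `|- (th * q)| <= th by rewrite normrN normrM ger0_norm// ler_piMr// ger0_norm; lra.
have e1 : 1 + th * (1 - q) + (th * (1 - q)) ^+ 2 / 2 * (1 - th) <= expR (th * (1 - q)).
  apply: le_trans (expR_quad_lb (le_trans b1 th1)).
  by rewrite lerD2l ler_wpM2l ?divr_ge0 ?sqr_ge0// lerD2l lerN2.
have e2 : 1 + - (th * q) + (- (th * q)) ^+ 2 / 2 * (1 - th) <= expR (- (th * q)).
  apply: le_trans (expR_quad_lb (le_trans b2 th1)).
  by rewrite lerD2l ler_wpM2l ?divr_ge0 ?sqr_ge0// lerD2l lerN2.
have q1' : 0 <= 1 - q by lra.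
apply: le_trans (lerD (ler_wpM2l q0 e1) (ler_wpM2l q1' e2)).
pose u := th ^+ 2 / 2 * (1 - th) * (q * (1 - q)).
have -> : q * (1 + th * (1 - q) + (th * (1 - q)) ^+ 2 / 2 * (1 - th)) +
   (1 - q) * (1 + - (th * q) + (- (th * q)) ^+ 2 / 2 * (1 - th)) = 1 + u.
  by rewrite /u; field.
have qq : 0 <= q * (1 - q) <= 1 by apply/andP; split; nra.
have /andP[u0 uth] : 0 <= u <= th.
  have /andP[w0 w1] := qq.
  have h : 0 <= th ^+ 2 / 2 * (1 - th) <= th.
    apply/andP; split; first by rewrite mulr_ge0 ?divr_ge0 ?sqr_ge0//; lra.
    have : th ^+ 2 <= th by rewrite expr2 ler_piMr.
    have : th ^+ 2 / 2 * (1 - th) <= th ^+ 2 / 2 by rewrite ler_piMr ?divr_ge0 ?sqr_ge0//; lra.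
    have := sqr_ge0 th; lra.
  move/andP : h => [h0 h1]; rewrite /u mulr_ge0//=.
  by apply: le_trans h1; rewrite ler_piMr.
have u1 : 0 < 1 + u by lra.
(* ln (1 + u) >= u / (1 + u), where u <= th: the loss is covered by the factor
   1 - 2 th in place of 1 - th. *)
apply: (@le_trans _ _ (expR (u / (1 + u)))).
  rewrite ler_expR ler_pdivlMr//.
  have -> : th ^+ 2 / 2 * (1 - 2 * th) * (q * (1 - q)) =
    u - th * (th ^+ 2 / 2 * (q * (1 - q))) by rewrite /u; field.
  have le1 : u <= th ^+ 2 / 2 * (q * (1 - q)).
    rewrite /u mulrAC ler_piMr; [by []| |lra].
    by rewrite mulr_ge0 ?divr_ge0 ?sqr_ge0//; have /andP[] := qq.
  move: le1; set W := th ^+ 2 / 2 * (q * (1 - q)) => le1.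
  have uu : u * u <= th * W by rewrite ler_pM.
  have thWu : 0 <= th * W * u by apply: mulr_ge0 => //; apply: mulr_ge0 => //; exact: le_trans le1.
  by have -> : (u - th * W) * (1 + u) = u + u * u - th * W - th * W * u; [ring|lra].
have := expR_ge1Dx (- (u / (1 + u))).
have -> : 1 + - (u / (1 + u)) = (1 + u)^-1 by field; rewrite lt0r_neq0.
by rewrite expRN lef_pV2 ?posrE// expR_gt0.
Qed.

End bernoulli_laplace.

Section independent_events.
Context {R : realType} {d : measure_display} {T : measurableType d}
  (P : probability T R) (F : nat -> set_system T).
Hypothesis F_measurable : forall i, F i `<=` measurable.
Hypothesis F_setT : forall i, F i setT.
Hypothesis F_setI : forall i, setI_closed (F i).
Hypothesis F_indep : mutually_independent P F.

Variable D : nat -> set T.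
Hypothesis DF : forall k, <<s block F [set k] >> (D k).

Lemma event_measurable k : measurable (D k).
Proof. exact: (@sblock_measurable d T _ F F_measurable [set k]). Qed.

Definition event_prob k : R := fine (P (D k)).
Local Notation q := event_prob.

Lemma event_probE k : P (D k) = (q k)%:E.
Proof. by rewrite /q fineK// fin_num_measure//; exact: event_measurable. Qed.

Lemma event_prob01 k : 0 <= q k <= 1.
Proof.
rewrite -!lee_fin -event_probE measure_ge0/=.
by apply: probability_le1; exact: event_measurable.
Qed.

Lemma event_prob_ge0 k : 0 <= q k. Proof. by have /andP[] := event_prob01 k. Qed.

Lemma event_var_ge0 k : 0 <= q k * (1 - q k).
Proof. by have /andP[q0 q1] := event_prob01 k; rewrite mulr_ge0// subr_ge0. Qed.

Definition centred_count (N : nat) (w : T) : R := \sum_(k < N) (\1_(D k) w - q k).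
Definition count_var (N : nat) : R := \sum_(k < N) q k * (1 - q k).

Lemma count_var_ge0 N : 0 <= count_var N.
Proof. by apply: sumr_ge0 => k _; exact: event_var_ge0. Qed.

Lemma indic_measurable_wrt S k : S k ->
  measurable_wrt (block F S) (\1_(D k) : T -> R).
Proof.
move=> Sk; apply: (@measurable_wrtW _ _ _ F _ _ [set k]).
  by move=> _ ->.
by apply: measurable_indic; exact: DF.
Qed.

Lemma centred_count_measurable_wrt N S : (forall k, (k < N)%N -> S k) ->
  measurable_wrt (block F S) (centred_count N).
Proof.
move=> SN; elim: N SN => [|N IH] SN.
  rewrite (_ : centred_count 0 = cst 0); first exact: measurable_cst.
  by apply/funext => w; rewrite /centred_count big_ord0.
rewrite (_ : centred_count N.+1 = centred_count N \+ (fun w => \1_(D N) w - q N)).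
  apply: measurable_funD; first by apply: IH => k kN; apply: SN; exact: ltnW.
  by apply: measurable_funB; [apply: indic_measurable_wrt; exact: SN|exact: measurable_cst].
by apply/funext => w; rewrite /centred_count big_ord_recr.
Qed.

Lemma centred_count_measurable N : measurable_fun setT (centred_count N).
Proof.
apply: (measurable_wrt_block F_measurable (S := setT)).
exact: centred_count_measurable_wrt.
Qed.

Lemma integral_bernoulli_laplace k th :
  (\int[P]_w (expR (th * (\1_(D k) w - q k)))%:E = (bernoulli_laplace (q k) th)%:E)%E.
Proof.
have mD := event_measurable k.
transitivity (\int[P]_w ((expR (th * (1 - q k)))%:E * (\1_(D k) w)%:E +
    (expR (- (th * q k)))%:E * (\1_(~` D k) w)%:E))%E.
  apply: eq_integral => w _; rewrite -!EFinM -EFinD; congr (_%:E).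
  rewrite indicC !indicE; case: (w \in D k).
    by rewrite /= mulr0 addr0 mulr1.
  by rewrite /= mulr0n mulr1n sub0r mulr0 add0r mulr1 mulrN.
rewrite ge0_integralD//; first last.
- apply: measurable_funeM; apply/measurable_EFinP; apply: measurable_indic.
  exact: measurableC.
- by apply: measurable_funeM; apply/measurable_EFinP; apply: measurable_indic.
rewrite ge0_integralZl//; last by apply/measurable_EFinP; apply: measurable_indic.
rewrite ge0_integralZl//; last first.
  by apply/measurable_EFinP; apply: measurable_indic; exact: measurableC.
rewrite !integral_indic ?setIT//; last exact: measurableC.
have hC : (P (~` D k) = (1 - q k)%:E)%E by rewrite probability_setC// event_probE.
rewrite [X in (_ + _ * X)%E](_ : _ = (1 - q k)%:E)//.
rewrite [X in (_ * X + _)%E](_ : _ = (q k)%:E); last exact: event_probE.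
rewrite /bernoulli_laplace -!EFinM -EFinD.
by congr (_%:E); rewrite mulrC [X in _ + X]mulrC.
Qed.

Lemma centred_count_laplace N th :
  (\int[P]_w (expR (th * centred_count N w))%:E =
   (\prod_(k < N) bernoulli_laplace (q k) th)%:E)%E.
Proof.
have mexp : measurable_fun setT (fun x : R => (expR (th * x))%:E).
  by apply/measurable_EFinP; apply: measurableT_comp => //; exact: measurable_funM.
elim: N => [|N IH].
  rewrite big_ord0; transitivity (\int[P]_w 1)%E; last exact: integral_prob_cst.
  by apply: eq_integral => w _; rewrite /centred_count big_ord0 mulr0 expR0.
transitivity (\int[P]_w ((expR (th * centred_count N w))%:E *
    (expR (th * (\1_(D N) w - q N)))%:E))%E.
  apply: eq_integral => w _; rewrite -EFinM -expRD -mulrDr.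
  by rewrite /centred_count big_ord_recr.
rewrite (@block_integralM _ _ _ P _ F F_measurable F_setT F_setI F_indep
   [set k | (k < N)%N] [set N]); first last.
- by move=> w; rewrite lee_fin expR_ge0.
- by move=> w; rewrite lee_fin expR_ge0.
- apply: (measurableT_comp mexp); apply: measurable_funB; last exact: measurable_cst.
  exact: indic_measurable_wrt.
- by apply: (measurableT_comp mexp); exact: centred_count_measurable_wrt.
- by apply/seteqP; split => // k [] /= /[swap] ->; rewrite ltnn.
by rewrite IH integral_bernoulli_laplace -EFinM big_ord_recr.
Qed.

Lemma centred_count_laplace_ub N th : `|th| <= 1 ->
  (\int[P]_w (expR (th * centred_count N w))%:E <=
   (expR (th ^+ 2 / 2 * (1 + `|th|) * count_var N))%:E)%E.
Proof.
move=> th1; rewrite centred_count_laplace lee_fin /count_var mulr_sumr expR_sum.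
apply: ler_prod => k _; rewrite bernoulli_laplace_ub ?event_prob01// andbT.
by have /andP[q0 q1] := event_prob01 k; rewrite addr_ge0// mulr_ge0 ?expR_ge0 ?subr_ge0.
Qed.

Lemma centred_count_laplace_lb N th : 0 <= th <= 1 ->
  ((expR (th ^+ 2 / 2 * (1 - 2 * th) * count_var N))%:E <=
   \int[P]_w (expR (th * centred_count N w))%:E)%E.
Proof.
move=> th1; rewrite centred_count_laplace lee_fin /count_var mulr_sumr expR_sum.
apply: ler_prod => k _; rewrite expR_ge0/=.
by apply: bernoulli_laplace_lb => //; exact: event_prob01.
Qed.

Let mexpZ N th : measurable_fun setT (fun w => (expR (th * centred_count N w))%:E).
Proof.
apply/measurable_EFinP; apply: measurableT_comp => //; apply: measurable_funM => //.
exact: centred_count_measurable.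
Qed.

(** Markov's inequality for the exponential moment. The sign of th selects the
    upper or the lower tail. *)
Lemma centred_count_chernoff N th x : `|th| <= 1 ->
  (P [set w | x <= th * centred_count N w]%R <=
   (expR (- x + th ^+ 2 / 2 * (1 + `|th|) * count_var N))%:E)%E.
Proof.
move=> th1.
have mS : measurable [set w | x <= th * centred_count N w].
  rewrite (_ : [set w | _] = (fun w => th * centred_count N w) @^-1` `[x, +oo[).
    rewrite -[X in measurable X]setTI.
    have : measurable_fun setT (fun w => th * centred_count N w).
      by apply: measurable_funM => //; exact: centred_count_measurable.
    by apply => //; exact: measurable_itv.
  by apply/seteqP; split => w /=; rewrite in_itv/= andbT.
rewrite expRD EFinM; apply: le_trans (lee_wpmul2l _ (centred_count_laplace_ub N th1)).
  2: by rewrite lee_fin expR_ge0.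
rewrite -ge0_integralZl//.
rewrite -[X in (P X <= _)%E]setIT -(integral_indic P measurableT)//.
apply: ge0_le_integral => //.
- by apply/measurable_EFinP; apply: measurable_indic.
- exact: measurable_funeM.
- move=> w _; rewrite -EFinM lee_fin -expRD indicE.
  have [/set_mem/= h|_] := boolP (w \in _); last exact: expR_ge0.
  by rewrite -expR0 ler_expR addrC subr_ge0.
Qed.

(** Kolmogorov's exponential lower bound, with V the variance. The exponential
    moment at th is carried by the values of the count between (1 - eta) th V
    and (1 + eta) th V: below and above this window the exponential is
    dominated by the one at (1 - eta) th and (1 + eta) th, whose moments are
    too small. As the exponential is at most exp ((1 + eta) th ^ 2 V) on the
    window, the window cannot have a small probability. *)
Lemma kolmogorov_lower N eta th : 0 < eta <= 4^-1 -> 0 < th -> th <= eta ^+ 2 / 8 ->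
  8 <= th ^+ 2 * count_var N * eta ^+ 2 ->
  ((expR (- (th ^+ 2 * count_var N * (2^-1 + 2 * eta))))%:E <=
   P [set w | (1 - eta)%R * th * count_var N <= centred_count N w]%R)%E.
Proof.
move=> /andP[eta0 eta1] th0 theta big.
set V := count_var N.
have eta2 : eta ^+ 2 <= 16^-1.
  by rewrite (_ : 16^-1 = 4^-1 ^+ 2 :> R) ?lerXn2r ?nnegrE//; [lra|field].
have th1 : th <= 1 by lra.
pose x := (1 - eta) * th * V; pose y := (1 + eta) * th * V.
have V0 : 0 <= V := count_var_ge0 N.
set S := [set w | _].
have mS : measurable S.
  rewrite (_ : S = centred_count N @^-1` `[x, +oo[).
    rewrite -[X in measurable X]setTI.
    by apply: centred_count_measurable => //; exact: measurable_itv.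
  by apply/seteqP; split => w /=; rewrite in_itv/= andbT.
pose a := th ^+ 2 * V.
have a0 : 0 <= a by rewrite mulr_ge0 ?sqr_ge0.
have ub c : 0 <= c <= 2 -> (\int[P]_w (expR (c * th * centred_count N w))%:E <=
    (expR (c ^+ 2 / 2 * (1 + c * th) * a))%:E)%E.
  move=> /andP[c0 c2].
  have h : `|c * th| <= 1 by rewrite ger0_norm ?mulr_ge0 ?(ltW th0)//; nra.
  apply: le_trans (centred_count_laplace_ub N h) _.
  rewrite lee_fin ler_expR ger0_norm ?mulr_ge0 ?(ltW th0)// /a.
  by rewrite le_eqVlt; apply/orP; left; apply/eqP; rewrite -/V; field.
(* The three terms dominate the exponential below x, above y and in
   between. *)
have split_le w : expR (th * centred_count N w) <=
    expR (eta * th * x) * expR ((1 - eta) * th * centred_count N w) +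
    (expR (- (eta * th * y)) * expR ((1 + eta) * th * centred_count N w) +
     expR (th * y) * \1_S w).
  set Z := centred_count N w.
  have [Zx|xZ] := ltP Z x.
    apply: ler_wpDr; first by rewrite addr_ge0 ?mulr_ge0 ?expR_ge0.
    rewrite -expRD ler_expR.
    have := mulr_ge0 (mulr_ge0 (ltW eta0) (ltW th0)) (ltW (etrans (subr_gt0 _ _) Zx)).
    lra.
  apply: ler_wpDl; first by rewrite mulr_ge0 ?expR_ge0.
  have [Zy|yZ] := leP Z y.
    apply: ler_wpDl; first by rewrite mulr_ge0 ?expR_ge0.
    by rewrite indicE mem_set//= mulr1 ler_expR ler_pM2l.
  apply: ler_wpDr; first by rewrite mulr_ge0 ?expR_ge0.
  rewrite -expRD ler_expR.
  have : 0 <= eta * th * (Z - y) by rewrite !mulr_ge0 ?(ltW eta0) ?(ltW th0)// subr_ge0 ltW.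
  lra.
have main : ((expR (a / 2 * (1 - 2 * th)))%:E <=
   (expR (eta * th * x) * expR ((1 - eta) ^+ 2 / 2 * (1 + (1 - eta) * th) * a))%:E +
   ((expR (- (eta * th * y)) * expR ((1 + eta) ^+ 2 / 2 * (1 + (1 + eta) * th) * a))%:E +
    (expR (th * y))%:E * P S))%E.
  have -> : expR (a / 2 * (1 - 2 * th)) = expR (th ^+ 2 / 2 * (1 - 2 * th) * V).
    by congr expR; rewrite /a; field.
  have thI : 0 <= th <= 1 by rewrite (ltW th0) th1.
  apply: le_trans (centred_count_laplace_lb N thI) _.
  have m1 c : measurable_fun setT (fun w => (expR (c * th * centred_count N w))%:E).
    by under eq_fun do rewrite -mulrA mulrCA mulrA; exact: mexpZ.
  have mI : measurable_fun setT (fun w => (\1_S w)%:E : \bar R).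
    by apply/measurable_EFinP; apply: measurable_indic.
  pose f1 w := ((expR (eta * th * x))%:E * (expR ((1 - eta) * th * centred_count N w))%:E)%E.
  pose f2 w := ((expR (- (eta * th * y)))%:E * (expR ((1 + eta) * th * centred_count N w))%:E)%E.
  pose f3 w := ((expR (th * y))%:E * (\1_S w)%:E)%E.
  have p1 w : (0 <= f1 w)%E by rewrite /f1 -EFinM lee_fin mulr_ge0 ?expR_ge0.
  have p2 w : (0 <= f2 w)%E by rewrite /f2 -EFinM lee_fin mulr_ge0 ?expR_ge0.
  have p3 w : (0 <= f3 w)%E by rewrite /f3 -EFinM lee_fin mulr_ge0 ?expR_ge0.
  have mf1 : measurable_fun setT f1 by apply: measurable_funeM; exact: m1.
  have mf2 : measurable_fun setT f2 by apply: measurable_funeM; exact: m1.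
  have mf3 : measurable_fun setT f3 by apply: measurable_funeM.
  apply: (@le_trans _ _ (\int[P]_w (f1 w + (f2 w + f3 w)))%E).
    apply: ge0_le_integral => //.
    - by apply: emeasurable_funD => //; exact: emeasurable_funD.
    - by move=> w _; rewrite /f1 /f2 /f3 -!EFinM -!EFinD lee_fin.
  rewrite ge0_integralD//; first last.
  - exact: emeasurable_funD.
  - by move=> w _; rewrite adde_ge0.
  rewrite [X in (_ + X)%E]ge0_integralD//.
  have Zl c (g : T -> \bar R) : measurable_fun setT g -> (forall w, 0 <= g w)%E ->
      (\int[P]_w ((expR c)%:E * g w) = (expR c)%:E * \int[P]_w g w)%E.
    by move=> mg g0; rewrite ge0_integralZl// lee_fin expR_ge0.
  apply: leeD; last apply: leeD.
  - rewrite /f1 Zl ?EFinM//.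
    apply: lee_wpmul2l; first by rewrite lee_fin expR_ge0.
    by apply: ub; apply/andP; split; lra.
  - rewrite /f2 Zl ?EFinM//.
    apply: lee_wpmul2l; first by rewrite lee_fin expR_ge0.
    by apply: ub; apply/andP; split; lra.
  - by rewrite /f3 Zl// integral_indic ?setIT//.
have PS : P S = (fine (P S))%:E by rewrite fineK// fin_num_measure.
move: main; rewrite PS -EFinM -!EFinD !lee_fin -!expRD => main.
set M := expR (a / 2 * (1 - 2 * th)) in main.
have aeta : 8 <= a * eta ^+ 2 by rewrite /a.
have e2 : expR (-2) <= 4^-1 :> R.
  rewrite expRN lef_pV2 ?posrE ?expR_gt0//.
  have := expR_ge1Dx (1 : R); have -> : expR 2 = expR 1 * expR 1 :> R.
    by rewrite -expRD; congr expR; ring.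
  have := expR_ge0 (1 : R); nra.
(* Off the window the exponent loses eta ^ 2 a / 2 up to terms in th, and eta
   ^ 2 a >= 8 makes each contribution at most a quarter of the moment. *)
have t1 : expR (eta * th * x + (1 - eta) ^+ 2 / 2 * (1 + (1 - eta) * th) * a) <= M / 4.
  apply: (@le_trans _ _ (M * expR (-2))); last by rewrite ler_wpM2l ?expR_ge0.
  rewrite -expRD ler_expR.
  have -> : eta * th * x = eta * (1 - eta) * a by rewrite /x /a; ring.
  have h1 : 0 <= a * (eta ^+ 2 / 8 - th) by rewrite mulr_ge0// subr_ge0.
  have h2 : 0 <= a * th by rewrite mulr_ge0// ltW.
  have h3 : 0 <= a * th * (1 - (1 - eta) ^+ 3) by rewrite mulr_ge0//; nra.
  nra.
have t2 : expR (- (eta * th * y) + (1 + eta) ^+ 2 / 2 * (1 + (1 + eta) * th) * a) <= M / 4.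
  apply: (@le_trans _ _ (M * expR (-2))); last by rewrite ler_wpM2l ?expR_ge0.
  rewrite -expRD ler_expR.
  have -> : eta * th * y = eta * (1 + eta) * a by rewrite /y /a; ring.
  have h1 : 0 <= a * (eta ^+ 2 / 8 - th) by rewrite mulr_ge0// subr_ge0.
  have h2 : 0 <= a * th by rewrite mulr_ge0// ltW.
  have h3 : 0 <= a * th * (2 - (1 + eta) ^+ 3) by rewrite mulr_ge0//; nra.
  nra.
have half : M / 2 <= expR (th * y) * fine (P S) by lra.
have : M / 2 * expR (- (th * y)) <= fine (P S).
  rewrite expRN ler_pdivrMr ?expR_gt0// [leRHS]mulrC //.
move=> le; apply: le_trans le.
have e1 : expR (-1) <= 2^-1 :> R.
  rewrite expRN lef_pV2 ?posrE ?expR_gt0//; have := expR_ge1Dx (1 : R); lra.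
apply: (@le_trans _ _ (M * expR (-1) * expR (- (th * y)))); last first.
  by rewrite ler_wpM2r ?expR_ge0// ler_wpM2l ?expR_ge0.
rewrite -!expRD ler_expR.
have -> : th * y = (1 + eta) * a by rewrite /y /a; ring.
rewrite -/V -/a.
have h1 : 0 <= a * (eta ^+ 2 / 8 - th) by rewrite mulr_ge0// subr_ge0.
have h2 : 0 <= a * (eta - eta ^+ 2 / 4) by rewrite mulr_ge0//; nra.
lra.
Qed.

End independent_events.

(** * Infinite families of independent events *)
Section counting_events.
Context {R : realType} {d : measure_display} {T : measurableType d}
  (P : probability T R).

(** Converting to a real number is harmless off lim_sup_set D, where only
    finitely many of the events occur. *)
Definition event_count (D : nat -> set T) (w : T) : R :=
  fine (counting [set k | D k w]).

Lemma counting_series (D : nat -> set T) w :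
  counting [set k | D k w] = (\sum_(k <oo) (\1_(D k) w)%:E)%E :> \bar R.
Proof.
rewrite counting_dirac; apply: eq_eseriesr => n _.
by rewrite diracE indicE; congr ((nat_of_bool _)%:R%:E).
Qed.

Lemma event_count_measurable (D : nat -> set T) : (forall k, measurable (D k)) ->
  measurable_fun setT (event_count D).
Proof.
move=> mD; apply: (measurableT_comp (f := fine)); first exact: fine_measurable.
rewrite (_ : (fun w => _) = fun w => (\sum_(k <oo) (\1_(D k) w)%:E)%E); last first.
  by apply/funext => w; exact: counting_series.
apply: ge0_emeasurable_sum => [n w _ _|n _]; first by rewrite lee_fin.
by apply/measurable_EFinP; exact: measurable_indic.
Qed.

Lemma event_count_partial (D : nat -> set T) w : ~ lim_sup_set D w ->
  exists n, forall N, (n <= N)%N -> event_count D w = \sum_(k < N) \1_(D k) w.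
Proof.
move=> nD.
have [n Dn] : exists n, forall k, (n <= k)%N -> ~ D k w.
  apply/not_existsP => h; apply: nD => n _.
  have /existsNP[k] := h n; rewrite not_implyE => -[nk /contrapT Dk].
  by exists k.
exists n => N nN.
have := @counting_partial_cvg R [set k | D k w].
have indE k : (k \in [set k | D k w])%:R = \1_(D k) w :> R.
  by rewrite indicE; congr ((nat_of_bool _)%:R).
have cst_eq : ((\sum_(i < M) (nat_of_ord i \in [set k | D k w]))%N%:R%:E : \bar R)
    @[M --> \oo] --> (\sum_(k < N) \1_(D k) w)%:E.
  apply: cvg_near_cst; exists N => // M /= NM.
  pose f k : R := \1_(D k) w.
  have -> : (\sum_(i < M) (nat_of_ord i \in [set k | D k w]))%N%:R = \sum_(0 <= i < M) f i.
    by rewrite natr_sum big_mkord; apply: eq_bigr => i _; rewrite indE.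
  have -> : \sum_(k < N) \1_(D k) w = \sum_(0 <= i < N) f i by rewrite big_mkord.
  rewrite (@big_cat_nat _ _ _ N)//= [X in _ + X]big_nat [X in _ + X]big1 ?addr0//.
  move=> i /andP[Ni _]; rewrite /f indicE memNset//; apply: Dn; exact: leq_trans Ni.
by move=> h; rewrite /event_count (cvg_unique _ h cst_eq).
Qed.

Lemma event_count_cvg (D : nat -> set T) w : ~ lim_sup_set D w ->
  \sum_(k < N) \1_(D k) w @[N --> \oo] --> event_count D w.
Proof.
move=> /event_count_partial[n h]; apply: cvg_near_cst; exists n => // N /= nN.
by rewrite -h.
Qed.

(** Where X exceeds x strictly, all but finitely many X n exceed x; so a bound
    that is uniform in n passes to the limit. *)
Lemma tail_limit (X_ : nat -> T -> R) (X : T -> R) (Nul : set T) (x : R) (b : \bar R) :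
  (forall n, measurable_fun setT (X_ n)) -> measurable_fun setT X ->
  measurable Nul -> P Nul = 0%E ->
  (forall w, ~ Nul w -> X_ n w @[n --> \oo] --> X w) ->
  (forall n, (P [set w | (x <= X_ n w)%R] <= b)%E) ->
  (P [set w | (x < X w)%R] <= b)%E.
Proof.
move=> mX_ mX mN N0 cv hb.
have mge n : measurable [set w | x <= X_ n w].
  rewrite (_ : [set w | _] = X_ n @^-1` `[x, +oo[).
    by rewrite -[Y in measurable Y]setTI; apply: mX_ => //; exact: measurable_itv.
  by apply/seteqP; split => w /=; rewrite in_itv/= andbT.
have mgt : measurable [set w | x < X w].
  rewrite (_ : [set w | _] = X @^-1` `]x, +oo[).
    by rewrite -[Y in measurable Y]setTI; apply: mX => //; exact: measurable_itv.
  by apply/seteqP; split => w /=; rewrite in_itv/= andbT.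
pose U n := \bigcap_(m in [set m | (n <= m)%N]) [set w | x <= X_ m w].
have mU n : measurable (U n) by apply: bigcap_measurable => //; exists n => /=.
have mUU : measurable (\bigcup_n U n) by exact: bigcup_measurable.
have : P (U n) @[n --> \oo] --> P (\bigcup_n U n).
  apply: nondecreasing_cvg_mu => //.
  move=> n m nm; apply/subsetPset => w h k /= mk; apply: h => /=; exact: leq_trans mk.
move=> cvU.
have PU : (P (\bigcup_n U n) <= b)%E.
  rewrite -(cvg_lim _ cvU)//; apply: lime_le; first by apply/cvg_ex; eexists; exact: cvU.
  apply: nearW => n; apply: le_trans (hb n).
  by apply: le_measure; rewrite ?inE// => w h; apply: h => /=.
apply: le_trans PU.
apply: (@le_trans _ _ (P ((\bigcup_n U n) `|` Nul))).
  apply: le_measure; rewrite ?inE//; first exact: measurableU.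
  move=> w /= xw; have [Nw|Nw] := pselect (Nul w); [by right|left].
  have := cvgr_ge (X w) (cv w Nw) x xw.
  by move=> [n _ h]; exists n => // m /= nm; exact: h.
apply: le_trans (measureU2 _ _ _) _ => //.
by rewrite -[leRHS]adde0 leeD2l// -N0.
Qed.

End counting_events.

Section infinite_independent_events.
Context {R : realType} {d : measure_display} {T : measurableType d}
  (P : probability T R) (F : nat -> set_system T).
Hypothesis F_measurable : forall i, F i `<=` measurable.
Hypothesis F_setT : forall i, F i setT.
Hypothesis F_setI : forall i, setI_closed (F i).
Hypothesis F_indep : mutually_independent P F.

Variable D : nat -> set T.
Hypothesis DF : forall k, <<s block F [set k] >> (D k).
Local Notation q := (event_prob P D).

Variable m : R.
Hypothesis qm : series q @ \oo --> m.

Lemma lim_sup_measurable : measurable (lim_sup_set D).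
Proof.
apply: bigcap_measurable => // n _; apply: bigcup_measurable => k _.
exact: (event_measurable F_measurable DF).
Qed.

Lemma lim_sup_null : P (lim_sup_set D) = 0%E.
Proof.
apply: lim_sup_set_cvg0; first exact: (event_measurable F_measurable DF).
rewrite (_ : (\sum_(n <oo) P (D n))%E = m%:E) ?ltry//.
apply/cvg_lim => //.
rewrite (_ : (fun n => _) = EFin \o series q); last first.
  apply/funext => n; rewrite /series/= -sumEFin; apply: eq_bigr => i _.
  exact: (event_probE P F_measurable DF).
by apply: cvg_EFin => //; exact: nearW.
Qed.

(** The bound for the partial counts passes to their limit. A positive th
    gives the upper tail, a negative one the lower tail. *)
Lemma event_count_chernoff (V th x : R) :
  (forall N, count_var P D N <= V) -> `|th| <= 1 ->
  (P [set w | (x < th * (event_count D w - m))%R] <=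
   (expR (- x + th ^+ 2 / 2 * (1 + `|th|) * V))%:E)%E.
Proof.
move=> hV th1.
have mD := event_measurable F_measurable DF.
apply: (@tail_limit _ _ _ P (fun N w => th * centred_count P D N w) _ (lim_sup_set D)).
- move=> n; apply: measurable_funM => //.
  exact: (centred_count_measurable P F_measurable DF).
- apply: measurable_funM => //; apply: measurable_funB => //.
  exact: event_count_measurable.
- exact: lim_sup_measurable.
- exact: lim_sup_null.
- move=> w nw; apply: cvgM; first exact: cvg_cst.
  rewrite (_ : (fun n => _) = (fun N => \sum_(k < N) \1_(D k) w) \- series q).
    by apply: cvgB => //; exact: event_count_cvg.
  by apply/funext => n; rewrite /centred_count /series/= big_mkord -sumrB.
- move=> n; apply: le_trans (centred_count_chernoff F_measurable F_setT F_setI F_indep DF n x th1) _.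
  rewrite lee_fin ler_expR lerD2l; apply: ler_wpM2l => //.
  by rewrite mulr_ge0 ?divr_ge0 ?sqr_ge0 ?addr_ge0.
Qed.

End infinite_independent_events.

Section borel_cantelli.
Context {R : realType} {d : measure_display} {T : measurableType d}
  (P : probability T R).

Lemma borel_cantelli1 (E : nat -> set T) (u : nat -> R) :
  (forall n, measurable (E n)) -> (forall n, P (E n) <= (u n)%:E)%E ->
  cvgn (series u) ->
  {ae P, forall w, exists n, forall k, (n <= k)%N -> ~ E k w}.
Proof.
move=> mE Eu cu.
exists (lim_sup_set E); split.
- by apply: bigcap_measurable => // n _; apply: bigcup_measurable => k _.
- apply: lim_sup_set_cvg0 => //.
  apply: (@le_lt_trans _ _ (\sum_(n <oo) (u n)%:E)%E).
    apply: lee_nneseries => // n _; exact: Eu.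
  rewrite (_ : (\sum_(n <oo) (u n)%:E)%E = (limn (series u))%:E) ?ltry//.
  apply/cvg_lim => //; rewrite (_ : (fun n => _) = EFin \o series u).
    by apply: cvg_EFin => //; exact: nearW.
  by apply/funext => n; rewrite /series/= -sumEFin.
- move=> w /= h n _; have /existsNP[k] : ~ forall k, (n <= k)%N -> ~ E k w.
    by move=> h'; apply: h; exists n.
  by rewrite not_implyE => -[nk /contrapT Ek]; exists k.
Qed.

End borel_cantelli.

Section borel_cantelli_blocks.
Context {R : realType} {d : measure_display} {T : measurableType d}
  (P : probability T R) (F : nat -> set_system T).
Hypothesis F_measurable : forall i, F i `<=` measurable.
Hypothesis F_setT : forall i, F i setT.
Hypothesis F_setI : forall i, setI_closed (F i).
Hypothesis F_indep : mutually_independent P F.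

(** The events depend on disjoint blocks of coordinates, so the probability
    that none of those with index between a and M occurs is at most the
    product of the 1 - u k, hence at most exp (- sum of the u k), which tends
    to 0. *)
Lemma borel_cantelli2 (S : nat -> set nat) (E : nat -> set T) (u : nat -> R) :
  (forall n m, (n < m)%N -> S n `&` S m = set0) ->
  (forall n, <<s block F (S n) >> (E n)) ->
  (forall n, ((u n)%:E <= P (E n))%E) -> series u @ \oo --> +oo ->
  {ae P, forall w, forall n, exists2 k, (n <= k)%N & E k w}.
Proof.
move=> Sdisj SE uE udiv.
have mE n : measurable (E n) by exact: (sblock_measurable F_measurable (SE n)).
pose W a n := \big[setI/setT]_(k < n) ~` E (a + k)%N.
pose SW a n := \bigcup_(k in [set k | (k < n)%N]) S (a + k)%N.
have SWW a n : <<s block F (SW a n) >> (W a n).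
  elim: n => [|n IH]; rewrite /W; first by rewrite big_ord0; exact: (@measurableT _ (g_sigma_algebraType _)).
  rewrite big_ord_recr/=; apply: (@measurableI _ (g_sigma_algebraType _)).
    by apply: sblockS IH => i [k /= kn Ski]; exists k => //=; exact: ltnW.
  apply: (@measurableC _ (g_sigma_algebraType _)).
  by apply: sblockS (SE (a + n)%N) => i Si; exists n => //=.
have PW a n : (P (W a n) <= (expR (- \sum_(k < n) u (a + k)%N))%:E)%E.
  elim: n => [|n IH].
    by rewrite /W !big_ord0 oppr0 expR0; exact: probability_le1.
  rewrite /W big_ord_recr/= -/(W a n).
  rewrite (sblock_independent F_measurable F_setT F_setI F_indep (S := SW a n) (S' := S (a + n)%N))//.
  - rewrite big_ord_recr/= opprD expRD EFinM; apply: lee_pmul => //.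
    rewrite probability_setC//.
    apply: (@le_trans _ _ (1 - (u (a + n)%N)%:E)%E); first by rewrite leeB.
    by rewrite -EFinB lee_fin; exact: expR_ge1Dx.
  - apply/seteqP; split => // i [[k /= kn Sk] Sn].
    have := Sdisj (a + k)%N (a + n)%N; rewrite ltn_add2l => /(_ kn) S0.
    by rewrite -[False]/(set0 i) -S0.
  - by apply: (@measurableC _ (g_sigma_algebraType _)); exact: SE.
pose V a := \bigcap_(k in [set k | (a <= k)%N]) ~` E k.
have mV a : measurable (V a).
  by apply: bigcap_measurable => [|k _]; [exists a => /=|exact: measurableC].
have PV a : P (V a) = 0%E.
  apply/eqP; rewrite eq_le measure_ge0 andbT; apply/lee_addgt0Pr => e e0; rewrite add0e.
  have : \forall n \near \oo, - ln e + series u a <= series u n.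
    by move/cvgryPge : udiv; exact.
  move=> [N _ hN].
  have := hN (maxn N a) (leq_maxl _ _).
  set M := maxn N a => hM.
  apply: (@le_trans _ _ (P (W a (M - a)%N))).
    apply: le_measure; rewrite ?inE//.
      by apply: (sblock_measurable F_measurable (SWW _ _)).
    move=> w Vw; elim: (M - a)%N => [|n IH]; first by rewrite /W big_ord0.
    by rewrite /W big_ord_recr/=; split; [exact: IH|apply: Vw; exact: leq_addr].
  apply: le_trans (PW _ _) _; rewrite lee_fin -[leRHS]lnK ?posrE// ler_expR.
  have -> : \sum_(k < M - a) u (a + k)%N = series u M - series u a.
    rewrite /series/= (@big_cat_nat _ _ _ a)//= ?leq_maxr// addrC addrK.
    transitivity (\sum_(0 + a <= i < M) u i); last by rewrite add0n.
    by rewrite big_addn big_mkord; apply: eq_bigr => k _; rewrite addnC.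
  lra.
have : P.-negligible (\bigcup_a V a).
  by apply: negligible_bigcup => a; apply/negligibleP; [exact: mV|exact: PV].
apply: negligibleS => w /= /existsNP[n hn]; exists n => // k /= nk Ek.
by apply: hn; exists k.
Qed.

End borel_cantelli_blocks.

(** * Mean and variance of a count of events *)
Lemma cvg_exp_seq {R : realType} (u : nat -> R) (l : R) a :
  u @ \oo --> l -> (fun n => u n ^+ a) @ \oo --> l ^+ a.
Proof.
by move=> ul; elim: a => [|a IH]; [exact: cvg_cst|under eq_fun do rewrite exprS; rewrite exprS; exact: cvgM].
Qed.

Section event_count_moments.
Context {R : realType} {d : measure_display} {T : measurableType d}
  (P : probability T R) (F : nat -> set_system T).
Hypothesis F_measurable : forall i, F i `<=` measurable.
Hypothesis F_setT : forall i, F i setT.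
Hypothesis F_setI : forall i, setI_closed (F i).
Hypothesis F_indep : mutually_independent P F.

Variable D : nat -> set T.
Hypothesis DF : forall k, <<s block F [set k] >> (D k).
Local Notation q := (event_prob P D).

Definition partial_count N (w : T) : R := \sum_(k < N) \1_(D k) w.

Lemma partial_count_ge0 N w : 0 <= partial_count N w.
Proof. by apply: sumr_ge0. Qed.

Lemma partial_count_wrt N S : (forall k, (k < N)%N -> S k) ->
  measurable_wrt (block F S) (partial_count N).
Proof.
move=> NS; rewrite (_ : partial_count N = fun w => centred_count P D N w + \sum_(k < N) q k).
  by apply: measurable_funD; [exact: (centred_count_measurable_wrt P DF)|exact: measurable_cst].
by apply/funext => w; rewrite /centred_count sumrB subrK.
Qed.

Lemma partial_count_measurable N : measurable_fun setT (partial_count N).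
Proof.
apply: (measurable_wrt_block F_measurable (S := setT)).
exact: partial_count_wrt.
Qed.

Lemma integral_indic_event k : (\int[P]_w (\1_(D k) w)%:E = (q k)%:E)%E.
Proof.
have mD := event_measurable F_measurable DF k.
rewrite integral_indic// setIT; exact: (event_probE P F_measurable DF).
Qed.

Lemma integral_partial_count N : (\int[P]_w (partial_count N w)%:E = (\sum_(k < N) q k)%:E)%E.
Proof.
elim: N => [|N IH].
  by rewrite big_ord0 -[RHS](integral_prob_cst P 0); apply: eq_integral => w _; rewrite /partial_count big_ord0.
transitivity (\int[P]_w ((partial_count N w)%:E + (\1_(D N) w)%:E))%E.
  by apply: eq_integral => w _; rewrite -EFinD /partial_count big_ord_recr.
have mD := event_measurable F_measurable DF N.
rewrite ge0_integralD//; first last.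
- by apply/measurable_EFinP; exact: measurable_indic.
- by apply/measurable_EFinP; exact: partial_count_measurable.
- by move=> w _; rewrite lee_fin partial_count_ge0.
by rewrite IH integral_indic_event -EFinD big_ord_recr.
Qed.

Lemma integral_partial_count_sqr N :
  (\int[P]_w (partial_count N w ^+ 2)%:E = (count_var P D N + (\sum_(k < N) q k) ^+ 2)%:E)%E.
Proof.
elim: N => [|N IH].
  rewrite /count_var !big_ord0 expr0n/= addr0 -[RHS](integral_prob_cst P 0).
  by apply: eq_integral => w _; rewrite /partial_count big_ord0 expr0n.
have mD := event_measurable F_measurable DF N.
have mS := partial_count_measurable N.
have mI : measurable_fun setT (fun w => (\1_(D N) w)%:E : \bar R).
  by apply/measurable_EFinP; exact: measurable_indic.
transitivity (\int[P]_w ((partial_count N w ^+ 2)%:E +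
   (2%:E * ((partial_count N w)%:E * (\1_(D N) w)%:E) + (\1_(D N) w)%:E)))%E.
  apply: eq_integral => w _; rewrite -!EFinM -!EFinD /partial_count big_ord_recr/=.
  congr (_%:E); rewrite sqrrD -mulr_natl -addrA; congr (_ + (_ + _)).
  by rewrite indicE expr2; case: (_ \in _); rewrite ?mulr1 ?mulr0.
have m2 : measurable_fun setT (fun w => (partial_count N w)%:E * (\1_(D N) w)%:E)%E.
  by apply: emeasurable_funM => //; apply/measurable_EFinP.
rewrite ge0_integralD//; last 4 first.
- by move=> w _; rewrite lee_fin sqr_ge0.
- by apply/measurable_EFinP; exact: measurable_funX.
- by move=> w _; rewrite -!EFinM -EFinD lee_fin addr_ge0// mulr_ge0// mulr_ge0// partial_count_ge0.
- by apply: emeasurable_funD => //; exact: measurable_funeM.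
rewrite ge0_integralD//; last 2 first.
- by move=> w _; rewrite -!EFinM lee_fin mulr_ge0// mulr_ge0// partial_count_ge0.
- exact: measurable_funeM.
rewrite ge0_integralZl//; last first.
  by move=> w _; rewrite -!EFinM lee_fin mulr_ge0// partial_count_ge0.
rewrite (@block_integralM _ _ _ P _ F F_measurable F_setT F_setI F_indep
   [set k | (k < N)%N] [set N]); first last.
- by move=> w; rewrite lee_fin.
- by move=> w; rewrite lee_fin partial_count_ge0.
- apply: (measurableT_comp (f := EFin)) => //.
  exact: (indic_measurable_wrt DF).
- by apply: (measurableT_comp (f := EFin)) => //; exact: partial_count_wrt.
- by apply/seteqP; split => // k [] /= /[swap] ->; rewrite ltnn.
rewrite IH integral_partial_count integral_indic_event -!EFinM -!EFinD.
congr (_%:E); rewrite /count_var !big_ord_recr/=; ring.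
Qed.

Variable m : R.
Hypothesis qm : series q @ \oo --> m.

Lemma event_count_ge0 w : 0 <= event_count D w :> R.
Proof. exact: fine_ge0. Qed.

(** Monotone convergence: the partial counts increase to the count off a null
    event. *)
Lemma integral_event_count_exp a :
  (\int[P]_w (partial_count N w ^+ a)%:E @[N --> \oo] --> \int[P]_w (event_count D w ^+ a)%:E)%E.
Proof.
pose g N w := (partial_count N w ^+ a)%:E : \bar R.
have mg N : measurable_fun setT (g N).
  by apply/measurable_EFinP; apply: measurable_funX; exact: partial_count_measurable.
have g0 N w : setT w -> (0 <= g N w)%E by rewrite lee_fin exprn_ge0// partial_count_ge0.
have gnd w : setT w -> nondecreasing_seq (g^~ w).
  move=> _ n n' nn'; rewrite lee_fin lerXn2r ?nnegrE ?partial_count_ge0//.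
  rewrite /partial_count -!(big_mkord xpredT (fun k => \1_(D k) w)).
  by rewrite (@big_cat_nat _ _ _ n 0 n')//= lerDl sumr_ge0.
have cv := cvg_monotone_convergence measurableT mg g0 gnd.
rewrite (_ : (\int[P]_w (event_count D w ^+ a)%:E)%E = (\int[P]_w limn (g^~ w))%E)//.
have mX : measurable_fun setT (event_count D : T -> R).
  by apply: event_count_measurable => k; exact: (event_measurable F_measurable DF).
have mL : measurable_fun setT (fun w => limn (g^~ w)).
  apply: (@emeasurable_fun_cvg _ _ _ _ g) => // w _.
  exact: ereal_nondecreasing_is_cvgn (gnd w I).
apply: ge0_ae_eq_integral => //.
- by apply/measurable_EFinP; exact: measurable_funX.
- by move=> w _; rewrite lee_fin exprn_ge0// event_count_ge0.
- move=> w _; apply: lime_ge; first exact: ereal_nondecreasing_is_cvgn (gnd w I).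
  by apply: nearW => n; exact: g0.
exists (lim_sup_set D); split.
- exact: (lim_sup_measurable F_measurable DF).
- exact: (lim_sup_null F_measurable DF qm).
move=> w /= h; apply: contrapT => nD; apply: h => _.
apply/esym/cvg_lim => //; apply: cvg_EFin; first exact: nearW.
have h : (fun N => partial_count N w ^+ a) @ \oo --> (event_count D w : R) ^+ a.
  by apply: cvg_exp_seq; exact: event_count_cvg.
exact: h.
Qed.

Lemma event_count_mean : ('E_P[event_count D] = m%:E)%E.
Proof.
rewrite unlock.
have := @integral_event_count_exp 1; rewrite [X in _ --> X](_ : _ = \int[P]_w (event_count D w)%:E)%E; last first.
  by apply: eq_integral => w _; rewrite expr1.
move=> cv; apply: (cvg_unique _ cv) => //.
rewrite (_ : (fun N => _) = EFin \o series q); first by apply: cvg_EFin => //; exact: nearW.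
apply/funext => N /=; rewrite /series/= big_mkord -integral_partial_count.
by apply: eq_integral => w _; rewrite expr1.
Qed.

Lemma event_count_variance (v : R) : count_var P D @ \oo --> v -> ('V_P[event_count D] = v%:E)%E.
Proof.
move=> vv; pose X : T -> R := event_count D.
have mX : measurable_fun setT X.
  by apply: event_count_measurable => k; exact: (event_measurable F_measurable DF).
have m0 : 0 <= m.
  apply: (cvgr_to_ge qm); apply: nearW => n; apply: sumr_ge0 => k _.
  exact: (event_prob_ge0 P F_measurable DF).
have E1 : (\int[P]_w (X w)%:E = m%:E)%E by have := event_count_mean; rewrite unlock.
have E2 : (\int[P]_w (X w ^+ 2)%:E = (v + m ^+ 2)%:E)%E.
  apply: (cvg_unique _ (@integral_event_count_exp 2)) => //.
  rewrite (_ : (fun N => _) = EFin \o (fun N => count_var P D N + series q N ^+ 2)).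
    apply: cvg_EFin; first exact: nearW.
    have h : (fun N => count_var P D N + series q N ^+ 2) @ \oo --> (v : R) + m ^+ 2.
      by apply: cvgD => //; exact: cvg_exp_seq.
    exact: h.
  by apply/funext => N /=; rewrite integral_partial_count_sqr /series/= big_mkord.
rewrite /variance unlock event_count_mean /=.
rewrite unlock.
have mX2 : measurable_fun setT (fun w => ((X w - m) ^+ 2)%:E : \bar R).
  by apply/measurable_EFinP; apply: measurable_funX; exact: measurable_funB.
have : (\int[P]_w (((X w - m) ^+ 2)%:E + (2 * m)%:E * (X w)%:E) =
        \int[P]_w ((X w ^+ 2)%:E + (m ^+ 2)%:E))%E.
  by apply: eq_integral => w _; rewrite -EFinM -!EFinD; congr (_%:E); ring.
rewrite ge0_integralD//; last 3 first.
- by move=> w _; rewrite lee_fin sqr_ge0.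
- by move=> w _; rewrite lee_fin mulr_ge0 ?mulr_ge0// event_count_ge0.
- by apply: measurable_funeM; apply/measurable_EFinP.
rewrite ge0_integralD//; last 3 first.
- by move=> w _; rewrite lee_fin sqr_ge0.
- by apply/measurable_EFinP; exact: measurable_funX.
- by move=> w _; rewrite lee_fin sqr_ge0.
rewrite ge0_integralZl//; last 3 first.
- exact/measurable_EFinP.
- by move=> w _; rewrite lee_fin event_count_ge0.
- by rewrite lee_fin mulr_ge0.
rewrite (integral_prob_cst P (m ^+ 2)%:E) E1 E2.
rewrite (_ : (\int[P]_w ((X w - m) ^+ 2)%:E)%E =
   (\int[P]_x (((event_count D \- cst m) * (event_count D \- cst m)) x)%:E)%E); last first.
  by apply: eq_integral => w _; rewrite expr2.
move: (\int[P]_x _)%E => I; case: I => [r| |]//=.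
rewrite -EFinM -!EFinD => -[h]; congr (_%:E); lra.
Qed.

End event_count_moments.

(** * Sums over the boxes *)
Section linear_bound.
Context {R : realType}.
Implicit Types f g : R -> R.

(** A linear bound makes the sum over k of f (p k * t) converge, because the p
    k sum to 1. *)
Definition lin_bounded f := exists C : R, forall y, 0 <= y -> `|f y| <= C * y.

Lemma lin_bounded_le f g : (forall y, 0 <= y -> `|f y| <= g y) -> lin_bounded g -> lin_bounded f.
Proof.
move=> fg [C gC]; exists C => y y0; apply: le_trans (fg _ y0) _.
exact: le_trans (ler_norm _) (gC _ y0).
Qed.

Lemma lin_boundedD f g : lin_bounded f -> lin_bounded g -> lin_bounded (fun y => f y + g y).
Proof.
move=> [C fC] [D gD]; exists (C + D) => y y0; rewrite mulrDl.
by apply: le_trans (ler_normD _ _) _; apply: lerD; [exact: fC|exact: gD].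
Qed.

Lemma lin_boundedZ a f : lin_bounded f -> lin_bounded (fun y => a * f y).
Proof.
move=> [C fC]; exists (`|a| * C) => y y0; rewrite normrM -mulrA.
by rewrite ler_wpM2l//; exact: fC.
Qed.

Lemma lin_boundedB f g : lin_bounded f -> lin_bounded g -> lin_bounded (fun y => f y - g y).
Proof.
move=> hf hg; have [C hC] := lin_boundedD hf (lin_boundedZ (-1) hg).
by exists C => y /hC; rewrite mulN1r.
Qed.

Lemma lin_bounded_scale (lam : R) f : 0 <= lam -> lin_bounded f -> lin_bounded (fun y => f (lam * y)).
Proof.
move=> l0 [C fC]; exists (C * lam) => y y0; rewrite -mulrA.
by apply: fC; rewrite mulr_ge0.
Qed.

Lemma lin_bounded_sum n (F : 'I_n -> R -> R) : (forall i, lin_bounded (F i)) ->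
  lin_bounded (fun y => \sum_(i < n) F i y).
Proof.
elim: n F => [|n IH] F hF.
  by exists 0 => y y0; rewrite big_ord0 normr0 mul0r.
have [C hC] := lin_boundedD (IH (fun i => F (widen_ord (leqnSn n) i)) (fun i => hF _)) (hF ord_max).
by exists C => y /hC; rewrite big_ord_recr.
Qed.

End linear_bound.

Section box_sums.
Context {R : realType} (p : nat -> R).
Hypothesis p_ge0 : forall k, 0 <= p k.
Hypothesis p_sum : series p @ \oo --> (1 : R).
Implicit Types (f g : R -> R) (t : R).

(** The mean and the variance of the number of occupied boxes have this form,
    since box k enters through p k * t only. *)
Definition box_sum f t := limn (series (fun k => f (p k * t))).

Lemma box_sum_cvg f t : lin_bounded f -> 0 <= t ->
  series (fun k => f (p k * t)) @ \oo --> box_sum f t.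
Proof.
move=> [C fC] t0; apply: normed_cvg.
apply: (@series_le_cvg _ _ (fun k => (C * t) *: p k)) => [k||k|] //.
- exact: normr_ge0.
- move=> k; rewrite /GRing.scale/= -mulrA [t * _]mulrC.
  by apply: le_trans (fC _ _); rewrite ?mulr_ge0.
- have := fC (p k * t); rewrite mulr_ge0// => /(_ isT).
  by rewrite /GRing.scale/= -mulrA [p k * t]mulrC.
- by apply: is_cvg_seriesZ; apply/cvg_ex; exists 1.
Qed.

Lemma eq_box_sum f g t : 0 <= t -> (forall y, 0 <= y -> f y = g y) -> box_sum f t = box_sum g t.
Proof.
move=> t0 fg; rewrite /box_sum; congr (limn (series _)).
by apply/funext => k; apply: fg; rewrite mulr_ge0.
Qed.

Lemma box_sumD f g t : lin_bounded f -> lin_bounded g -> 0 <= t ->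
  box_sum (fun y => f y + g y) t = box_sum f t + box_sum g t.
Proof.
move=> hf hg t0; apply/cvg_lim => //.
rewrite (_ : series _ = series (fun k => f (p k * t)) \+ series (fun k => g (p k * t))).
  by apply: cvgD; exact: box_sum_cvg.
by apply/funext => n; rewrite /series/= -big_split.
Qed.

Lemma box_sumZ a f t : lin_bounded f -> 0 <= t ->
  box_sum (fun y => a * f y) t = a * box_sum f t.
Proof.
move=> hf t0; apply/cvg_lim => //.
rewrite (_ : series _ = fun n => a * series (fun k => f (p k * t)) n).
  by apply: cvgM; [exact: cvg_cst|exact: box_sum_cvg].
by apply/funext => n; rewrite /series/= mulr_sumr.
Qed.

Lemma box_sumB f g t : lin_bounded f -> lin_bounded g -> 0 <= t ->
  box_sum (fun y => f y - g y) t = box_sum f t - box_sum g t.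
Proof.
move=> hf hg t0; rewrite -[- box_sum g t]mulN1r -box_sumZ// -box_sumD//.
  by apply: eq_box_sum => // y _; rewrite mulN1r.
exact: lin_boundedZ.
Qed.

Lemma box_sum_sum n (F : 'I_n -> R -> R) t : (forall i, lin_bounded (F i)) -> 0 <= t ->
  box_sum (fun y => \sum_(i < n) F i y) t = \sum_(i < n) box_sum (F i) t.
Proof.
elim: n F => [|n IH] F hF t0.
  rewrite big_ord0; under eq_fun do rewrite big_ord0.
  apply/cvg_lim => //; rewrite (_ : series _ = cst 0); first exact: cvg_cst.
  by apply/funext => n; rewrite /series/= big1.
under eq_fun do rewrite big_ord_recr/=.
rewrite box_sumD//; last exact: lin_bounded_sum.
by rewrite IH// big_ord_recr.
Qed.

Lemma box_sum_scale (lam : R) f t : box_sum (fun y => f (lam * y)) t = box_sum f (lam * t).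
Proof.
by rewrite /box_sum; congr (limn (series _)); apply/funext => k; rewrite mulrCA.
Qed.

Lemma ler_box_sum f g t : lin_bounded f -> lin_bounded g -> 0 <= t ->
  (forall y, 0 <= y -> f y <= g y) -> box_sum f t <= box_sum g t.
Proof.
move=> hf hg t0 fg.
apply: (ler_cvg_to (box_sum_cvg hf t0) (box_sum_cvg hg t0)).
apply: nearW => n; apply: ler_sum => k _; apply: fg; by rewrite mulr_ge0.
Qed.

Lemma box_sum_ge0 f t : lin_bounded f -> 0 <= t -> (forall y, 0 <= y -> 0 <= f y) ->
  0 <= box_sum f t.
Proof.
move=> hf t0 f0; apply: (cvgr_to_ge (box_sum_cvg hf t0)).
by apply: nearW => n; apply: sumr_ge0 => k _; rewrite f0// mulr_ge0.
Qed.

Lemma box_sum_id t : box_sum id t = t.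
Proof.
apply/cvg_lim => //; rewrite -[X in _ --> X]mul1r.
rewrite (_ : series _ = fun n => series p n * t).
  by apply: cvgM => //; exact: cvg_cst.
by apply/funext => n; rewrite /series/= mulr_suml.
Qed.

Lemma lin_bounded_id : lin_bounded (@id R).
Proof. by exists 1 => y y0; rewrite mul1r ger0_norm. Qed.

Lemma box_sum_partial f t N : lin_bounded f -> 0 <= t -> (forall y, 0 <= y -> 0 <= f y) ->
  \sum_(k < N) f (p k * t) <= box_sum f t.
Proof.
move=> hf t0 f0; apply: (cvgr_to_ge (box_sum_cvg hf t0)).
exists N => // n /= Nn; rewrite /series/= (@big_cat_nat _ _ _ N)//= big_mkord lerDl.
by apply: sumr_ge0 => k _; rewrite f0// mulr_ge0.
Qed.

Lemma box_sum_le_partial f t c : lin_bounded f -> 0 <= t ->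
  (forall N, \sum_(k < N) f (p k * t) <= c) -> box_sum f t <= c.
Proof.
move=> hf t0 h; apply: (cvgr_to_le (box_sum_cvg hf t0)).
by apply: nearW => n; rewrite /series/= big_mkord; exact: h.
Qed.

Definition ge1 (y : R) : R := (1 <= y)%R%:R.

Lemma ge1_lin : lin_bounded ge1.
Proof.
exists 1 => y y0; rewrite mul1r /ge1; case: (leP 1 y) => h; last by rewrite normr0.
by rewrite normr1.
Qed.

Lemma box_sum_counting t : 0 < t -> box_sum ge1 t = counting_function p t.
Proof.
move=> t0; rewrite /counting_function; apply/cvg_lim => //.
have e k : ge1 (p k * t) = (k \in [set k | 0 < p k /\ (p k)^-1 <= t])%:R.
  rewrite /ge1; congr ((nat_of_bool _)%:R); apply/idP/idP.
    move=> h; rewrite inE/=; have pk : 0 < p k.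
      rewrite lt_neqAle p_ge0 andbT; apply: contraTneq h => <-.
      by rewrite mul0r -ltNge.
    by split=> //; rewrite -(ler_pM2l pk) mulfV// lt0r_neq0.
  rewrite inE/= => -[pk] h; by rewrite -(mulfV (lt0r_neq0 pk)) ler_pM2l.
have cv := box_sum_cvg ge1_lin (ltW t0).
have := @counting_partial_cvg R [set k | 0 < p k /\ (p k)^-1 <= t].
set X := [set k | _].
have -> : (fun n => (\sum_(i < n) (nat_of_ord i \in X))%N%:R%:E : \bar R) =
    EFin \o series (fun k => ge1 (p k * t)).
  apply/funext => n /=; congr EFin; rewrite natr_sum /series/= big_mkord.
  by apply: eq_bigr => i _; rewrite e.
have cv' : (EFin \o series (fun k => ge1 (p k * t))) @ \oo --> (box_sum ge1 t)%:E.
  by apply: cvg_EFin => //; exact: nearW.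
by move=> h; rewrite (cvg_unique _ h cv').
Qed.

End box_sums.

(** * Asymptotic densities *)
Section limits_at_infinity.
Context {R : realType}.

Lemma near_pinfty_gt (a : R) : \forall t \near +oo, a < t.
Proof. by apply: nbhs_pinfty_gt; exact: num_real. Qed.

Lemma near_pinfty_ge (a : R) : \forall t \near +oo, a <= t.
Proof. by apply: nbhs_pinfty_ge; exact: num_real. Qed.

Lemma near_cvg (h g : R -> R) (F : set_system R) (l : R) : Filter F ->
  h x @[x --> F] --> l -> (\forall t \near F, h t = g t) -> g x @[x --> F] --> l.
Proof. by move=> FF hl e; apply: cvg_trans hl; exact: near_eq_cvg. Qed.

Lemma near_scale (lam : R) (Q : R -> Prop) : 0 < lam ->
  (\forall t \near +oo, Q t) -> \forall t \near +oo, Q (lam * t).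
Proof.
move=> l0 [A [Ar AQ]]; exists (A / lam); split; first exact: num_real.
by move=> t; rewrite ltr_pdivrMr// mulrC => /AQ.
Qed.

Lemma cvg_scale (lam : R) (h : R -> R) (l : R) : 0 < lam ->
  h t @[t --> +oo] --> l -> h (lam * t) @[t --> +oo] --> l.
Proof.
move=> l0 hl; apply: cvg_trans hl => A; exact: near_scale.
Qed.

End limits_at_infinity.

Section pi_class.
Context {R : realType} (p : nat -> R) (ell : R -> R).
Hypothesis p_ge0 : forall k, 0 <= p k.
Hypothesis p_sum : series p @ \oo --> (1 : R).
Hypothesis pi_ell : de_Haan_Pi ell (counting_function p).
Implicit Types (f g : R -> R) (t c : R).

Local Notation bsum := (box_sum p).

Lemma ell_gt0 : \forall t \near +oo, 0 < ell t.
Proof.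
case: pi_ell => -[A [_ A0]] _; exists A; split => //; exact: num_real.
Qed.

Lemma counting_scale_cvg (a b : R) : 0 < a -> 0 < b ->
  (counting_function p (a * t) - counting_function p (b * t)) / ell t @[t --> +oo] --> ln a - ln b.
Proof.
move=> a0 b0; case: pi_ell => _ h.
apply: (near_cvg _ (cvgB (h _ a0) (h _ b0))); apply: nearW => t /=.
by rewrite -mulrBl; congr (_ / _); ring.
Qed.

(** The increment of the counting function over [lam t, 2 lam t] is asymptotic
    to ln 2 times ell t and to ln 2 times ell (lam t). *)
Lemma ell_slowly_varying (lam : R) : 0 < lam -> ell (lam * t) / ell t @[t --> +oo] --> (1 : R).
Proof.
move=> l0; have ln2 : (0 : R) < ln 2 by rewrite ln_gt0// ltr1n.
have h1 : (counting_function p ((2 * lam) * t) - counting_function p (lam * t)) / ell t @[t --> +oo] --> (ln 2 : R).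
  have -> : ln 2 = ln (2 * lam) - ln lam :> R by rewrite lnM ?posrE// addrK.
  by apply: counting_scale_cvg => //; rewrite mulr_gt0.
have h2 : (counting_function p (2 * (lam * t)) - counting_function p (lam * t)) / ell (lam * t) @[t --> +oo] --> (ln 2 : R).
  case: pi_ell => _ /(_ 2 (ltr0Sn _ _)).
  exact: (cvg_scale l0).
rewrite -(mulfV (lt0r_neq0 ln2)).
apply: (near_cvg _ (cvgM h1 (cvgV (lt0r_neq0 ln2) h2))); near=> t.
have c0 : 0 < (counting_function p (2 * (lam * t)) - counting_function p (lam * t)) / ell (lam * t).
  near: t; have := cvgr_gt (ln 2) h2 0 ln2; exact.
have e0 : 0 < ell t by near: t; exact: ell_gt0.
have e1 : 0 < ell (lam * t) by near: t; exact: (near_scale l0 ell_gt0).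
set u := _ - _ in c0.
have -> : counting_function p (2 * lam * t) - counting_function p (lam * t) = u by rewrite /u mulrA.
move: c0; rewrite pmulr_lgt0 ?invr_gt0// => c0.
change (u / ell t * (u / ell (lam * t))^-1 = ell (lam * t) / ell t).
by field; rewrite !lt0r_neq0.
Unshelve. all: by end_near. Qed.

(** The density of f has to be its integral against dy / y, as the arguments p
    k * t are spread like ell t times dy / y. *)
Definition upper_density f c := \forall t \near +oo, bsum f t <= c * ell t.
Definition lower_density f c := \forall t \near +oo, c * ell t <= bsum f t.
Definition has_density f c := bsum f t / ell t @[t --> +oo] --> c.

Lemma has_densityP f c : has_density f c <->
  forall e, 0 < e -> upper_density f (c + e) /\ lower_density f (c - e).
Proof.
split=> [/cvgrPdist_lt h e e0|h].
  have {}h := h _ e0; split; near=> t.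
    have l0 : 0 < ell t by near: t; exact: ell_gt0.
    rewrite -ler_pdivrMr//.
    have : `|c - bsum f t / ell t| < e by near: t.
    by rewrite ltr_norml => /andP[]; lra.
  have l0 : 0 < ell t by near: t; exact: ell_gt0.
  rewrite -ler_pdivlMr//.
  have : `|c - bsum f t / ell t| < e by near: t.
  by rewrite ltr_norml => /andP[]; lra.
apply/cvgrPdist_le => e e0; have [h1 h2] := h e e0.
near=> t; have l0 : 0 < ell t by near: t; exact: ell_gt0.
have : bsum f t / ell t <= c + e by rewrite ler_pdivrMr//; near: t.
have : c - e <= bsum f t / ell t by rewrite ler_pdivlMr//; near: t.
by rewrite ler_norml; lra.
Unshelve. all: by end_near. Qed.

Lemma upper_density_le f g c : lin_bounded f -> lin_bounded g ->
  (forall y, 0 <= y -> f y <= g y) -> upper_density g c -> upper_density f c.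
Proof.
move=> hf hg fg h; near=> t.
apply: (@le_trans _ _ (bsum g t)); last by near: t.
by apply: ler_box_sum => //; near: t; exact: near_pinfty_ge.
Unshelve. all: by end_near. Qed.

Lemma upper_density_weaken f c c' : c <= c' -> upper_density f c -> upper_density f c'.
Proof.
move=> cc h; near=> t; have l0 : 0 < ell t by near: t; exact: ell_gt0.
apply: (@le_trans _ _ (c * ell t)); last by rewrite ler_wpM2r// ltW.
by near: t.
Unshelve. all: by end_near. Qed.

Lemma upper_densityD f g c c' : lin_bounded f -> lin_bounded g ->
  upper_density f c -> upper_density g c' -> upper_density (fun y => f y + g y) (c + c').
Proof.
move=> hf hg h h'; near=> t.
have t0 : 0 <= t by near: t; exact: near_pinfty_ge.
rewrite box_sumD//.
by rewrite mulrDl; apply: lerD; near: t.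
Unshelve. all: by end_near. Qed.

Lemma upper_densityZ a f c : 0 <= a -> lin_bounded f ->
  upper_density f c -> upper_density (fun y => a * f y) (a * c).
Proof.
move=> a0 hf h; near=> t.
have t0 : 0 <= t by near: t; exact: near_pinfty_ge.
rewrite box_sumZ//.
by rewrite -mulrA ler_wpM2l//; near: t.
Unshelve. all: by end_near. Qed.

Lemma eq_has_density f g c : (forall y, 0 <= y -> f y = g y) -> has_density f c -> has_density g c.
Proof.
move=> fg; apply: cvg_trans; apply: near_eq_cvg; near=> t.
by rewrite (eq_box_sum p_ge0 _ fg)//; near: t; exact: near_pinfty_ge.
Unshelve. all: by end_near. Qed.

Lemma has_densityD f g c c' : lin_bounded f -> lin_bounded g ->
  has_density f c -> has_density g c' -> has_density (fun y => f y + g y) (c + c').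
Proof.
move=> hf hg h h'; apply: (near_cvg _ (cvgD h h')); near=> t.
have t0 : 0 <= t by near: t; exact: near_pinfty_ge.
rewrite box_sumD//.
by rewrite /= mulrDl.
Unshelve. all: by end_near. Qed.

Lemma has_densityZ a f c : lin_bounded f ->
  has_density f c -> has_density (fun y => a * f y) (a * c).
Proof.
move=> hf h; apply: (near_cvg _ (cvgM (cvg_cst a) h)); near=> t.
have t0 : 0 <= t by near: t; exact: near_pinfty_ge.
rewrite box_sumZ//.
by rewrite /= mulrA.
Unshelve. all: by end_near. Qed.

Lemma has_densityB f g c c' : lin_bounded f -> lin_bounded g ->
  has_density f c -> has_density g c' -> has_density (fun y => f y - g y) (c - c').
Proof.
move=> hf hg h h'; rewrite -[- c']mulN1r.
apply: (@eq_has_density (fun y => f y + -1 * g y)).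
  by move=> y _; rewrite mulN1r.
by apply: has_densityD => //; [exact: lin_boundedZ|exact: has_densityZ].
Qed.

Lemma has_density_sum n (F : 'I_n -> R -> R) (c : 'I_n -> R) : (forall i, lin_bounded (F i)) ->
  (forall i, has_density (F i) (c i)) ->
  has_density (fun y => \sum_(i < n) F i y) (\sum_(i < n) c i).
Proof.
elim: n F c => [|n IH] F c hF h.
  rewrite big_ord0; apply: cvg_near_cst; near=> t.
  by rewrite box_sum_sum ?big_ord0 ?mul0r => // -[].
rewrite big_ord_recr/=.
apply: (@eq_has_density (fun y => \sum_(i < n) F (widen_ord (leqnSn n) i) y + F ord_max y)).
  by move=> y _; rewrite big_ord_recr.
apply: has_densityD => //; first exact: lin_bounded_sum.
by apply: IH.
Unshelve. all: by end_near. Qed.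

Lemma has_density_scale (lam : R) f c : 0 < lam -> has_density f c ->
  has_density (fun y => f (lam * y)) c.
Proof.
move=> l0 h; rewrite -[c]mulr1.
apply: (near_cvg _ (cvgM (cvg_scale l0 h) (ell_slowly_varying l0))); near=> t.
have e1 : 0 < ell (lam * t) by near: t; exact: (near_scale l0 ell_gt0).
by rewrite box_sum_scale /= mulrA mulfVK// lt0r_neq0.
Unshelve. all: by end_near. Qed.

Lemma has_density_squeeze f c : lin_bounded f ->
  (forall e, 0 < e -> upper_density f (c + e)) ->
  (forall e, 0 < e -> lower_density f (c - e)) -> has_density f c.
Proof. by move=> hf h1 h2; apply/has_densityP => e e0; split; [exact: h1|exact: h2]. Qed.

Definition shell (a b y : R) : R := (a <= y < b)%R%:R.

Lemma shell_ge1 (a b y : R) : 0 < a -> a <= b -> shell a b y = ge1 (a^-1 * y) - ge1 (b^-1 * y).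
Proof.
move=> a0 ab; have b0 := lt_le_trans a0 ab.
rewrite /shell /ge1 ![_^-1 * y]mulrC !ler_pdivlMr// !mul1r.
case: (leP a y) => ay; case: (leP b y) => bY /=; rewrite ?subrr ?subr0//.
by have := lt_le_trans (lt_le_trans ay ab) bY; rewrite ltxx.
Qed.

Lemma shell_lin (a b : R) : 0 < a -> lin_bounded (shell a b).
Proof.
move=> a0; exists a^-1 => y y0; rewrite /shell; case: andP => [[h _]|_].
  by rewrite normr1 mulrC ler_pdivlMr ?mul1r.
by rewrite normr0 mulr_ge0// invr_ge0 ltW.
Qed.

(** This is the defining condition of the class: the shell is a difference of
    two rescaled counting functions. *)
Lemma shell_density (a b : R) : 0 < a -> a <= b -> has_density (shell a b) (ln b - ln a).
Proof.
move=> a0 ab; have b0 := lt_le_trans a0 ab.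
have -> : ln b - ln a = ln a^-1 - ln b^-1 by rewrite !lnV ?posrE//; ring.
apply: (@eq_has_density (fun y => ge1 (a^-1 * y) - ge1 (b^-1 * y))).
  by move=> y _; rewrite shell_ge1.
have := @counting_scale_cvg a^-1 b^-1; rewrite !invr_gt0 => /(_ a0 b0) cv.
apply: (near_cvg _ cv); near=> t.
have t0 : 0 < t by near: t; exact: near_pinfty_gt.
have hl (c : R) : 0 < c -> lin_bounded (fun y => ge1 (c^-1 * y)).
  by move=> c0; apply: lin_bounded_scale; [rewrite invr_ge0 ltW|exact: ge1_lin].
rewrite (box_sumB p_ge0 p_sum (hl _ a0) (hl _ b0) (ltW t0)).
by rewrite /= !box_sum_scale !box_sum_counting ?mulr_gt0 ?invr_gt0.
Unshelve. all: by end_near. Qed.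

End pi_class.

(** * Tails of the densities *)
Section pi_class_tails.
Context {R : realType} (p : nat -> R) (ell : R -> R).
Hypothesis p_ge0 : forall k, 0 <= p k.
Hypothesis p_sum : series p @ \oo --> (1 : R).
Hypothesis pi_ell : de_Haan_Pi ell (counting_function p).
Implicit Types (f g : R -> R) (t c : R).
Local Notation bsum := (box_sum p).

Lemma ln2_lt1 : ln 2 < 1 :> R.
Proof.
rewrite -[X in _ < X]expRK ltr_ln ?posrE ?expR_gt0//.
by have := expR_gt1Dx (oner_neq0 R); lra.
Qed.

Lemma ell_scale_le (lam c : R) : 0 < lam -> 1 < c -> \forall t \near +oo, ell (lam * t) <= c * ell t.
Proof.
move=> l0 c1; near=> t.
have e0 : 0 < ell t by near: t; exact: (ell_gt0 pi_ell).
rewrite -ler_pdivrMr//; near: t.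
exact: (cvgr_le _ (ell_slowly_varying pi_ell l0) c c1).
Unshelve. all: by end_near. Qed.

Lemma upper_density_scale (lam : R) f c c' : 0 < lam -> 0 <= c -> c < c' ->
  upper_density p ell f c -> upper_density p ell (fun y => f (lam * y)) c'.
Proof.
move=> l0 c0 cc h.
have h1 : \forall t \near +oo, bsum f (lam * t) <= c * ell (lam * t) by exact: (near_scale l0 h).
have r1 : (1 : R) < 1 + (c' - c) / (c + 1) by rewrite ltrDl divr_gt0// ?subr_gt0// ltr_wpDl.
have h2 := ell_scale_le l0 r1.
near=> t; rewrite box_sum_scale.
have e0 : 0 < ell t by near: t; exact: (ell_gt0 pi_ell).
apply: (@le_trans _ _ (c * ell (lam * t))); first by near: t.
apply: (@le_trans _ _ (c * ((1 + (c' - c) / (c + 1)) * ell t))).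
  by rewrite ler_wpM2l//; near: t.
rewrite mulrA ler_wpM2r ?(ltW e0)// mulrDr mulr1 -lerBrDl mulrA ler_pdivrMr ?ltr_wpDl//.
by rewrite mulrC ler_wpM2l ?subr_ge0 ?(ltW cc)// lerDl.
Unshelve. all: by end_near. Qed.

(** Together with big, this dominates the profiles at the two ends of (0, oo),
    which finitely many shells do not reach. *)
Definition small (a y : R) : R := y * (y < a)%R%:R.
Definition big (a y : R) : R := (a <= y)%R%:R / y.

Lemma small_ge0 a y : 0 <= y -> 0 <= small a y.
Proof. by move=> y0; rewrite mulr_ge0. Qed.

Lemma small_le a y : 0 <= y -> small a y <= y.
Proof. by move=> y0; rewrite /small; case: (y < a); rewrite ?mulr1 ?mulr0. Qed.

Lemma small_lin a : lin_bounded (small a).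
Proof. by exists 1 => y y0; rewrite mul1r ger0_norm ?small_ge0 ?small_le. Qed.

Lemma big_ge0 a y : 0 <= y -> 0 <= big a y.
Proof. by move=> y0; rewrite divr_ge0. Qed.

Lemma big_lin a : 0 < a -> lin_bounded (big a).
Proof.
move=> a0; exists (a^-1 ^+ 2) => y y0; rewrite ger0_norm ?big_ge0// /big.
case: (leP a y) => ay; last by rewrite mul0r mulr_ge0// exprn_ge0// invr_ge0 ltW.
have y1 : 0 < y by exact: lt_le_trans ay.
rewrite ler_pdivrMr// -mulrA -expr2 -exprMn -[leLHS](expr1n _ 2) lerXn2r ?nnegrE//.
  by rewrite mulr_ge0// invr_ge0 ltW.
by rewrite mulrC ler_pdivlMr ?mul1r.
Qed.

Lemma big_le a y : 1 <= a -> 0 <= y -> big a y <= y.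
Proof.
move=> a1 y0; rewrite /big; case: (leP a y) => ay; last by rewrite mul0r.
have y1 := le_trans a1 ay.
by rewrite mul1r; apply: (le_trans _ y1); rewrite invf_le1 ?(lt_le_trans ltr01).
Qed.

(** An argument below 1 lies in [1/2, 1) or is half of an argument below 1, so
    S t <= shell t + S (2 t) / 2. As ell (2 t) <= (3 / 2) ell t for large t,
    iterating upwards gives a bounded multiple of ell t; for finitely many
    boxes S vanishes at large times, which ends the iteration. *)
Lemma small1_density : upper_density p ell (small 1) 4.
Proof.
have h2 : (0 : R) < 2^-1 by rewrite invr_gt0.
have h21 : 2^-1 <= 1 :> R by rewrite invf_le1// ler1n.
have sh : upper_density p ell (shell 2^-1 1) 1.
  have := shell_density p_ge0 p_sum pi_ell h2 h21.
  rewrite lnV ?posrE// opprK ln1 add0r => /(has_densityP pi_ell)/(_ (1 - ln 2)).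
  by rewrite subr_gt0 => /(_ ln2_lt1)[]; rewrite addrC subrK.
have r : (1 : R) < 3 / 2 by rewrite ltr_pdivlMr// mul1r ltr_nat.
have e2 := ell_scale_le (ltr0Sn _ 1) r.
have e0 := ell_gt0 pi_ell.
have [T0 [T0r hT]] : \forall t \near +oo,
   [/\ bsum (shell 2^-1 1) t <= ell t, ell (2 * t) <= 3 / 2 * ell t, 0 < ell t & 1 <= t].
  near=> t; split; [|by near: t|by near: t|by near: t; exact: near_pinfty_ge].
  by rewrite -[leRHS]mul1r; near: t.
exists T0; split=> // x Tx.
have [_ _ _ x1] := hT _ Tx.
apply: (box_sum_le_partial p_ge0 p_sum (small_lin 1)); first exact: le_trans x1.
move=> N; pose S x := \sum_(k < N) small 1 (p k * x).
pose X := \sum_(k < N) (p k)^-1.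
have S0 z : X <= z -> S z <= 0.
  move=> Xz; rewrite /S big1// => k _; rewrite /small.
  case: ltP => h; last by rewrite mulr0.
  move: (p_ge0 k); rewrite le_eqVlt => /orP[/eqP<-|pk]; first by rewrite !mul0r.
  have : (p k)^-1 <= z.
    apply: le_trans Xz; rewrite /X (bigD1 k)//= lerDl.
    by apply: sumr_ge0 => i _; rewrite invr_ge0.
  rewrite -(ler_pM2l pk) mulfV ?lt0r_neq0// => h'.
  by have := lt_le_trans h h'; rewrite ltxx.
have Srec z : 0 <= z -> S z <= bsum (shell 2^-1 1) z + 2^-1 * S (2 * z).
  move=> z0.
  apply: le_trans (_ : \sum_(k < N) shell 2^-1 1 (p k * z) + 2^-1 * S (2 * z) <= _); last first.
    rewrite lerD2r; apply: box_sum_partial => //; exact: shell_lin.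
  rewrite /S mulr_sumr -big_split/=; apply: ler_sum => k _.
  rewrite [p k * (2 * z)]mulrCA; move: (p k * z) (mulr_ge0 (p_ge0 k) z0) => y y0.
  rewrite /small /shell.
  case: (ltP y 1) => y1; last first.
    by rewrite mulr0 addr_ge0// !mulr_ge0// ltW.
  rewrite andbT; case: (leP 2^-1 y) => y2; rewrite ?mulr1.
    by apply: (le_trans (ltW y1)); rewrite lerDl !mulr_ge0// ltW.
  have -> : (2 * y < 1) = true by apply/idP; lra.
  by rewrite !mulr1 add0r; lra.
(* The constant 4 solves 1 + (1 / 2) (3 / 2) c = c. *)
have main n : forall z, T0 < z -> X <= 2 ^+ n * z -> S z <= 4 * ell z.
  elim: n => [|n IH] z Tz; have [za zb zc z1] := hT _ Tz.
    rewrite expr0 mul1r => /S0 h; apply: le_trans h _; by rewrite mulr_ge0// ltW.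
  rewrite exprSr -mulrA => hX.
  have T2 : T0 < 2 * z by apply: lt_trans Tz _; rewrite ltr_pMl ?ltr1n// (lt_le_trans ltr01).
  have := IH _ T2 hX; have := Srec z (le_trans ler01 z1); lra.
apply: (main (Num.truncn X).+1) => //.
apply: (@le_trans _ _ ((Num.truncn X).+1%:R)); first by rewrite ltW// truncnS_gt.
apply: (@le_trans _ _ (2 ^+ (Num.truncn X).+1)).
  by rewrite -natrX ler_nat; apply: ltnW; exact: ltn_expl.
by rewrite ler_peMr// exprn_ge0.
Unshelve. all: by end_near. Qed.

Lemma small_density a : 0 < a -> upper_density p ell (small a) (8 * a).
Proof.
move=> a0.
have := upper_density_scale (c' := 8) (eqbRL (invr_gt0 a) a0) _ _ small1_density.
rewrite ler0n ltr_nat => /(_ isT isT) h.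
have := upper_densityZ p_ge0 p_sum (ltW a0) _ h.
have ll : lin_bounded (fun y => small 1 (a^-1 * y)).
  by apply: lin_bounded_scale; [rewrite invr_ge0 ltW|exact: small_lin].
move=> /(_ ll); rewrite mulrC; apply: upper_density_le => //; first exact: small_lin.
  exact: lin_boundedZ.
move=> y y0; rewrite /small mulrA mulrA mulfV ?lt0r_neq0// mul1r.
by rewrite [a^-1 * y]mulrC ltr_pdivrMr// mul1r.
Qed.

Hypothesis ell_oo : ell t @[t --> +oo] --> +oo.

(** The same recursion downwards: V t <= shell t + V (t / 2) / 2. It is
    started at bounded times from V t <= t, which leaves a constant that ell
    absorbs since it tends to infinity. *)
Lemma big1_density : upper_density p ell (big 1) 5.
Proof.
have sh : upper_density p ell (shell 1 2) 1.
  have := shell_density p_ge0 p_sum pi_ell (@ltr01 R) (ler1n _ 2).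
  rewrite ln1 subr0 => /(has_densityP pi_ell)/(_ (1 - ln 2)).
  by rewrite subr_gt0 => /(_ ln2_lt1)[]; rewrite addrC subrK.
have r : (1 : R) < 3 / 2 by rewrite ltr_pdivlMr// mul1r ltr_nat.
have h2 : (0 : R) < 2^-1 by rewrite invr_gt0.
have e2 := ell_scale_le h2 r.
have e0 := ell_gt0 pi_ell.
have [T1 [T1r hT']] : \forall t \near +oo,
   [/\ bsum (shell 1 2) t <= ell t, ell (2^-1 * t) <= 3 / 2 * ell t & 0 < ell t].
  near=> t; split; [|by near: t|by near: t].
  by rewrite -[leRHS]mul1r; near: t.
(* Downwards the recursion has to stop at bounded times, where only the bound
   by t is available. *)
pose T0 := Num.max 1 T1.
have T01 : 1 <= T0 by rewrite /T0 le_max lexx.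
have hT x : T0 < x -> [/\ bsum (shell 1 2) x <= ell x, ell (2^-1 * x) <= 3 / 2 * ell x & 0 < ell x].
  by move=> h; apply: hT'; apply: le_lt_trans h; rewrite /T0 le_max lexx orbT.
have blin := big_lin (@ltr01 R).
pose V := bsum (big 1).
have Vid x : 0 <= x -> V x <= x.
  move=> x0; rewrite -[leRHS](box_sum_id p_sum); apply: ler_box_sum => //.
    exact: lin_bounded_id.
  by move=> y y0; exact: big_le.
have Vrec x : 0 <= x -> V x <= bsum (shell 1 2) x + 2^-1 * V (2^-1 * x).
  move=> x0; have bl2 : lin_bounded (fun y => big 1 (2^-1 * y)).
    by apply: lin_bounded_scale => //; exact: ltW.
  rewrite /V -(box_sum_scale _ _ (big 1)) -box_sumZ// -box_sumD//; last 2 first.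
  - exact: shell_lin.
  - exact: lin_boundedZ.
  apply: ler_box_sum => //.
    by apply: lin_boundedD; [exact: shell_lin|exact: lin_boundedZ].
  move=> y y0; rewrite /big /shell.
  case: (leP 1 y) => y1 /=; last by rewrite mul0r add0r !mulr_ge0// ?invr_ge0 ?mulr_ge0// ltW.
  have y2 : 0 < y by exact: lt_le_trans y1.
  case: (ltP y 2) => y3 /=.
    apply: (@le_trans _ _ 1); first by rewrite mul1r invf_le1.
    by rewrite lerDl !mulr_ge0// ?invr_ge0 ?mulr_ge0// ltW.
  have -> : 1 <= 2^-1 * y by rewrite mulrC ler_pdivlMr// mul1r.
  rewrite add0r -[true%:R]/(1 : R) le_eqVlt; apply/orP; left; apply/eqP; field.
    by rewrite lt0r_neq0.
have main n : forall x, T0 < x -> x <= 2 ^+ n * (2 * T0) -> V x <= 4 * ell x + 2 * T0.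
  elim: n => [|n IH] x Tx hx; have [xa xb xc] := hT _ Tx.
    rewrite expr0 mul1r in hx; have := Vid x; rewrite (le_trans _ (ltW Tx)) ?(le_trans ler01)//.
    by move=> /(_ isT); lra.
  have x0 : 0 <= x by apply: le_trans (ltW Tx); exact: le_trans T01.
  have [x2|x2] := leP x (2 * T0); first by have := Vid x x0; lra.
  have x3 : T0 < 2^-1 * x by lra.
  have x4 : 2^-1 * x <= 2 ^+ n * (2 * T0) by move: hx; rewrite exprS; lra.
  by have := IH _ x3 x4; have := Vrec x x0; lra.
have loo : \forall t \near +oo, 2 * T0 <= ell t by move/cvgryPge : ell_oo; exact.
near=> t.
have Tt : T0 < t by near: t; exact: near_pinfty_gt.
have t0 : 0 <= t by apply: le_trans (ltW Tt); exact: le_trans T01.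
have : V t <= 4 * ell t + 2 * T0.
  apply: (main (Num.truncn t).+1) => //.
  apply: (@le_trans _ _ ((Num.truncn t).+1%:R)); first by rewrite ltW// truncnS_gt.
  apply: (@le_trans _ _ (2 ^+ (Num.truncn t).+1)).
    by rewrite -natrX ler_nat; apply: ltnW; exact: ltn_expl.
  by rewrite ler_peMr ?exprn_ge0//; lra.
have : 2 * T0 <= ell t by near: t.
rewrite /V; lra.
Unshelve. all: by end_near. Qed.

Lemma big_density a : 0 < a -> upper_density p ell (big a) (10 / a).
Proof.
move=> a0.
have := upper_density_scale (c' := 10) (eqbRL (invr_gt0 a) a0) _ _ big1_density.
rewrite ler0n ltr_nat => /(_ isT isT) h.
have ai : 0 <= a^-1 by rewrite invr_ge0 ltW.
have ll : lin_bounded (fun y => big 1 (a^-1 * y)).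
  by apply: lin_bounded_scale => //; exact: big_lin.
have := upper_densityZ p_ge0 p_sum ai ll h.
rewrite mulrC; apply: upper_density_le => //; first exact: big_lin.
  exact: lin_boundedZ.
move=> y y0; rewrite /big [X in (1 <= X)%R]mulrC ler_pdivlMr// mul1r.
move: y0; rewrite le_eqVlt => /orP[/eqP<-|y0]; first by rewrite mulr0 invr0 !mulr0.
by rewrite le_eqVlt; apply/orP; left; apply/eqP; field; rewrite !lt0r_neq0.
Qed.

End pi_class_tails.

(** * Density of a difference of exponentials *)
Section abelian.
Context {R : realType}.

Lemma sum_shift (g : nat -> R) (n K : nat) :
  \sum_(i < K) (g i - g (i + n)%N) = \sum_(i < n) g i - \sum_(i < n) g (K + i)%N.
Proof.
elim: K => [|K IH]; first by rewrite big_ord0 subrr.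
rewrite big_ord_recr/= IH.
have e : \sum_(i < n) g (K.+1 + i)%N + g K = \sum_(i < n) g (K + i)%N + g (K + n)%N.
  transitivity (\sum_(i < n.+1) g (K + i)%N); last by rewrite big_ord_recr.
  rewrite big_ord_recl addn0 addrC; congr (_ + _); apply: eq_bigr => i _.
  by rewrite /= /bump/= add1n addnS addSn.
lra.
Qed.

Lemma shell_partition (a : nat -> R) K y : (forall i, a i <= a i.+1) ->
  \sum_(i < K) shell (a i) (a i.+1) y = shell (a 0%N) (a K) y.
Proof.
move=> ai; have a0 i : a 0%N <= a i by elim: i => // i /le_trans; exact.
elim: K => [|K IH].
  by rewrite big_ord0 /shell; case: leP => //= h; case: ltP => // h'; have := le_lt_trans h h'; rewrite ltxx.
rewrite big_ord_recr/= IH /shell.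
case: (leP (a 0%N) y) => h0 /=; last first.
  have -> : (a K <= y) = false by apply/negbTE; rewrite -ltNge (lt_le_trans h0 (a0 K)).
  by rewrite add0r.
case: (ltP y (a K)) => hK /=; first by rewrite addr0 (lt_le_trans hK (ai K)).
by rewrite add0r.
Qed.

Lemma exp_diff_ge0 (lam y : R) : 1 <= lam -> 0 <= y -> 0 <= expR (- y) - expR (- (lam * y)).
Proof. by move=> l1 y0; rewrite subr_ge0 ler_expR lerN2 ler_peMl. Qed.

Lemma exp_diff_small (lam y : R) : 1 <= lam -> 0 <= y ->
  expR (- y) - expR (- (lam * y)) <= (lam - 1) * y.
Proof.
move=> l1 y0.
have -> : expR (- (lam * y)) = expR (- y) * expR (- ((lam - 1) * y)).
  by rewrite -expRD; congr expR; ring.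
rewrite -{1}[expR (- y)]mulr1 -mulrBr -[leRHS]mul1r.
apply: ler_pM; rewrite ?expR_ge0//.
- by rewrite subr_ge0 -[leRHS]expR0 ler_expR oppr_le0 mulr_ge0// subr_ge0.
- by rewrite -[leRHS]expR0 ler_expR oppr_le0.
- by rewrite lerBlDr -lerBlDl; have := expR_ge1Dx (- ((lam - 1) * y)); lra.
Qed.

Lemma expRN_le_inv (y : R) : 0 < y -> expR (- y) <= y^-1.
Proof.
move=> y0; rewrite expRN lef_pV2 ?posrE ?expR_gt0//.
by have := expR_ge1Dx y; lra.
Qed.

Lemma exists_inv_le (c e : R) : 0 < e -> exists n : nat, c / n.+1%:R <= e.
Proof.
move=> e0; exists (Num.truncn (c / e)); rewrite ler_pdivrMr// mulrC -ler_pdivrMr//.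
by rewrite ltW// truncnS_gt.
Qed.

(** On this grid multiplication by lam shifts the index by N + 1, and all
    shells have the same logarithmic width. *)
Lemma grid_geometry (lam : R) (N M : nat) : 0 < lam ->
  let a i := expR ((i%:R - M%:R) * (ln lam / N.+1%:R)) in
  (forall i, lam * a i = a (i + N.+1)%N) /\
  (forall i, ln (a i.+1) - ln (a i) = ln lam / N.+1%:R).
Proof.
move=> l0 /=; split=> i; last by rewrite !expRK -mulrBl -natr1; ring.
by rewrite -{1}(lnK l0) -expRD; congr expR; rewrite natrD; field; rewrite addrC natr1 pnatr_eq0.
Qed.

End abelian.

Section exponential_density.
Context {R : realType} (p : nat -> R) (ell : R -> R).
Hypothesis p_ge0 : forall k, 0 <= p k.
Hypothesis p_sum : series p @ \oo --> (1 : R).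
Hypothesis pi_ell : de_Haan_Pi ell (counting_function p).
Hypothesis ell_oo : ell t @[t --> +oo] --> +oo.
Implicit Types (f g : R -> R) (t c : R).

Lemma exp_diff_lin (lam : R) : 1 <= lam -> lin_bounded (fun y : R => expR (- y) - expR (- (lam * y))).
Proof.
by move=> l1; exists (lam - 1) => y y0; rewrite ger0_norm ?exp_diff_ge0// exp_diff_small.
Qed.

Variable lam : R.
Hypothesis lam1 : 1 < lam.
Let D (y : R) := expR (- y) - expR (- (lam * y)).
Variables N M : nat.
Let h := ln lam / N.+1%:R.
Let a i := expR ((i%:R - M%:R) * h).
Let G (y : R) := expR (- y).
Let lam0 : 0 < lam. Proof. exact: lt_trans lam1. Qed.
Let h0 : 0 < h. Proof. by rewrite divr_gt0// ln_gt0. Qed.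
Let a0 i : 0 < a i. Proof. exact: expR_gt0. Qed.
Let aS i : a i <= a i.+1.
Proof. by rewrite ler_expR ler_wpM2r ?(ltW h0)// lerD2r ler_nat. Qed.
Let alam i : lam * a i = a (i + N.+1)%N. Proof. by case: (grid_geometry N M lam0) => ->. Qed.
Let aln i : ln (a i.+1) - ln (a i) = h. Proof. exact: (grid_geometry N M lam0).2. Qed.
Let amono i j : (i <= j)%N -> a i <= a j.
Proof. by move=> ij; rewrite ler_expR ler_wpM2r ?(ltW h0)// lerD2r ler_nat. Qed.

Let sum_density (c : nat -> R) :
  has_density p ell (fun y => \sum_(i < (M + M)%N) c i * shell (a i) (a i.+1) y) (\sum_(i < (M + M)%N) c i * h).
Proof.
apply: has_density_sum => // i; first by apply: lin_boundedZ; exact: shell_lin.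
apply: has_densityZ => //; first exact: shell_lin.
by rewrite -(aln i); exact: shell_density.
Qed.

Let sum_lin (c : nat -> R) : lin_bounded (fun y => \sum_(i < (M + M)%N) c i * shell (a i) (a i.+1) y).
Proof. by apply: lin_bounded_sum => i; apply: lin_boundedZ; exact: shell_lin. Qed.

(** On each shell of the grid the function is bounded through its values at
    the end points. Since multiplication by lam shifts the index, the sum over
    the shells telescopes to at most N + 2 terms of width h, that is ln lam +
    h. Outside the grid the tails take over. *)
Lemma exp_diff_upper (e : R) : 0 < e ->
  upper_density p ell D (ln lam + h + (8 * lam + 10) * expR (- (M%:R * h)) + e).
Proof.
move=> e0.
(* On the shell i, exp (- y) <= G (a i) and lam * y < a (i + N.+2). *)
pose c i := G (a i) - G (a (i + N.+2)%N).
have l8 : 0 <= lam - 1 by rewrite subr_ge0 ltW.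
pose U y := (lam - 1) * small (a 0%N) y + \sum_(i < (M + M)%N) c i * shell (a i) (a i.+1) y + big (a (M + M)%N) y.
have l1 : lin_bounded (fun y => (lam - 1) * small (a 0%N) y) by apply: lin_boundedZ; exact: small_lin.
have l2 := big_lin (a0 (M + M)).
have DU y : 0 <= y -> D y <= U y.
  move=> y0; have [y1|y1] := ltP y (a 0%N).
    apply: (@le_trans _ _ ((lam - 1) * small (a 0%N) y)).
      by rewrite /small y1 mulr1; apply: exp_diff_small => //; exact: ltW.
    rewrite /U -addrA lerDl addr_ge0 ?big_ge0//; apply: sumr_ge0 => i _.
    by rewrite mulr_ge0// subr_ge0 ler_expR lerN2 amono// leq_addr.
  have [y2|y2] := leP (a (M + M)%N) y.
    apply: (@le_trans _ _ (big (a (M + M)%N) y)).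
      rewrite /big y2 /D lerBlDr mul1r; apply: (le_trans (expRN_le_inv _)).
        exact: lt_le_trans y2.
      by rewrite lerDl expR_ge0.
    rewrite /U lerDr addr_ge0 ?mulr_ge0 ?small_ge0//; apply: sumr_ge0 => i _.
    by rewrite mulr_ge0// subr_ge0 ler_expR lerN2 amono// leq_addr.
  have -> : D y = \sum_(i < (M + M)%N) D y * shell (a i) (a i.+1) y.
    by rewrite -mulr_sumr shell_partition// /shell y1 y2 mulr1.
  rewrite /U /small ltNge y1 mulr0 mulr0 add0r.
  apply: (@le_trans _ _ (\sum_(i < (M + M)%N) c i * shell (a i) (a i.+1) y)); last first.
    by rewrite lerDl big_ge0.
  apply: ler_sum => i _; rewrite /shell; case: andP => [[z1 z2]|]; last by rewrite !mulr0.
  rewrite !mulr1; apply: lerB; first by rewrite ler_expR lerN2.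
  by rewrite ler_expR lerN2 -addSnnS -alam ler_pM2l// ltW.
have /(has_densityP pi_ell)/(_ _ e0)[hc _] := @sum_density c.
have h1 := upper_densityZ p_ge0 p_sum l8 (small_lin _) (small_density p_ge0 p_sum pi_ell (a0 0%N)).
have h2 := big_density p_ge0 p_sum pi_ell ell_oo (a0 (M + M)).
have := upper_densityD p_ge0 p_sum (lin_boundedD l1 (sum_lin c)) l2
  (upper_densityD p_ge0 p_sum l1 (sum_lin c) h1 hc) h2.
move=> /(upper_density_le p_ge0 p_sum (exp_diff_lin (ltW lam1)) _ DU)/=.
have lU : lin_bounded U by apply: lin_boundedD => //; exact: lin_boundedD.
move=> /(_ lU); apply: upper_density_weaken => //.
have -> : a 0%N = expR (- (M%:R * h)) by rewrite /a sub0r mulNr.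
have -> : (a (M + M)%N)^-1 = expR (- (M%:R * h)) by rewrite /a natrD addrK expRN.
rewrite -mulr_suml /c (sum_shift (G \o a) N.+2).
have : (\sum_(i < N.+2) (G \o a) i - \sum_(i < N.+2) (G \o a) (M + M + i)%N) * h <= ln lam + h.
  have -> : ln lam + h = N.+2%:R * h.
    have hN : N.+1%:R * h = ln lam by rewrite /h mulrC mulfVK.
    by rewrite -(natr1 N.+1) mulrDl mul1r hN.
  rewrite ler_wpM2r ?(ltW h0)//.
  apply: (@le_trans _ _ (\sum_(i < N.+2) (G \o a) i)).
    by rewrite gerBl; apply: sumr_ge0 => i _; exact: expR_ge0.
  apply: (@le_trans _ _ (\sum_(i < N.+2) 1)); last by rewrite sumr_const card_ord.
  by apply: ler_sum => i _; rewrite /= /G -expR0 ler_expR oppr_le0 ltW.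
have := expR_ge0 (- (M%:R * h)); move: (expR (- _)) => x; nra.
Qed.

(** The same comparison from below; the function is nonnegative, so the part
    outside the grid can be dropped. *)
Lemma exp_diff_lower (e : R) : 0 < e ->
  lower_density p ell D (ln lam - h - ln lam * (lam + 1) * expR (- (M%:R * h)) - e).
Proof.
move=> e0.
(* On the shell i, exp (- y) >= G (a i.+1) and lam * y >= a (i + N.+1). *)
pose c i := G (a i.+1) - G (a (i.+1 + N)%N).
have DU y : 0 <= y -> \sum_(i < (M + M)%N) c i * shell (a i) (a i.+1) y <= D y.
  move=> y0; apply: (@le_trans _ _ (\sum_(i < (M + M)%N) D y * shell (a i) (a i.+1) y)).
    apply: ler_sum => i _; rewrite /shell; case: andP => [[z1 z2]|]; last by rewrite !mulr0.
    rewrite !mulr1; apply: lerB; first by rewrite ler_expR lerN2 ltW.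
    by rewrite ler_expR lerN2 addSnnS -alam ler_pM2l.
  rewrite -mulr_sumr shell_partition//.
  by rewrite ler_piMr ?exp_diff_ge0 ?(ltW lam1)// /shell; case: andP.
have /(has_densityP pi_ell)/(_ _ e0)[_ hc] := @sum_density c.
near=> t.
have t0 : 0 <= t by near: t; exact: near_pinfty_ge.
have el0 : 0 < ell t by near: t; exact: (ell_gt0 pi_ell).
apply: (@le_trans _ _ (box_sum p (fun y => \sum_(i < (M + M)%N) c i * shell (a i) (a i.+1) y) t)); last first.
  by apply: ler_box_sum => //; exact: exp_diff_lin (ltW lam1).
apply: (@le_trans _ _ ((\sum_(i < (M + M)%N) c i * h - e) * ell t)); last by near: t.
rewrite ler_wpM2r ?(ltW el0)// lerD2r -mulr_suml.
rewrite (sum_shift (fun i => G (a i.+1)) N).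
set x := expR (- (M%:R * h)).
have x0 : 0 < x by exact: expR_gt0.
have lb i : (i < N)%N -> 1 - lam * x <= G (a i.+1).
  move=> iN; apply: (@le_trans _ _ (1 - a i.+1)).
    rewrite lerD2l lerN2; have -> : lam * x = a (0 + N.+1)%N by rewrite -alam /x /a sub0r mulNr.
    by apply: amono; rewrite add0n ltnS ltnW.
  by have := expR_ge1Dx (- a i.+1).
have ub i : G (a (M + M + i).+1) <= x.
  apply: (le_trans (expRN_le_inv (a0 _))).
  have -> : x = (a (M + M)%N)^-1 by rewrite /x /a natrD addrK expRN.
  by rewrite lef_pV2 ?posrE//; apply: amono; rewrite -addnS leq_addr.
have s1 : N%:R * (1 - lam * x) <= \sum_(i < N) G (a i.+1).
  rewrite -[N in N%:R]card_ord mulr_natl -sumr_const; apply: ler_sum => i _; exact: lb.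
have s2 : \sum_(i < N) G (a (M + M + i).+1) <= N%:R * x.
  rewrite -[N in N%:R]card_ord mulr_natl -sumr_const; apply: ler_sum => i _; exact: ub.
have hN : N.+1%:R * h = ln lam by rewrite /h mulrC mulfVK.
apply: (@le_trans _ _ ((N%:R * (1 - lam * x) - N%:R * x) * h)); last first.
  by rewrite ler_wpM2r ?(ltW h0)//; lra.
have -> : (N%:R * (1 - lam * x) - N%:R * x) * h = (N.+1%:R * h - h) * (1 - (lam + 1) * x).
  by rewrite -natr1; ring.
rewrite hN; have := mulr_ge0 (mulr_ge0 (ltW h0) (ltW x0)) (ltW lam0).
have := mulr_ge0 (ltW h0) (ltW x0); nra.
Unshelve. all: by end_near. Qed.

End exponential_density.

Section poisson_density.
Context {R : realType} (p : nat -> R) (ell : R -> R).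
Hypothesis p_ge0 : forall k, 0 <= p k.
Hypothesis p_sum : series p @ \oo --> (1 : R).
Hypothesis pi_ell : de_Haan_Pi ell (counting_function p).
Hypothesis ell_oo : ell t @[t --> +oo] --> +oo.
Implicit Types (f g : R -> R) (t c : R).

(** The mesh h is chosen small first, then the extent M of the grid large. *)
Lemma exp_diff_density (lam : R) : 1 < lam ->
  has_density p ell (fun y => expR (- y) - expR (- (lam * y))) (ln lam).
Proof.
move=> l1; have ll := ln_gt0 l1.
have choose (C e : R) : 0 <= C -> 0 < e -> exists N M, ln lam / N.+1%:R <= e /\
    C * expR (- (M%:R * (ln lam / N.+1%:R))) <= e.
  move=> C0 e0; have [N hN] := exists_inv_le (ln lam) e0.
  have h0 : 0 < ln lam / N.+1%:R by rewrite divr_gt0.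
  have [M hM] := exists_inv_le (C / (ln lam / N.+1%:R)) e0.
  exists N, M.+1; split=> //; apply: le_trans hM.
  rewrite -mulrA ler_wpM2l// -invfM mulrC; apply: expRN_le_inv.
  by rewrite mulr_gt0.
have sp (e : R) : 0 < e -> 0 < e / 3 by move=> e0; rewrite divr_gt0.
apply: has_density_squeeze => //; first exact: exp_diff_lin (ltW l1).
  move=> e e0; have [|N [M [h1 h2]]] := choose (8 * lam + 10) (e / 3) _ (sp _ e0).
    by lra.
  have := exp_diff_upper p_ge0 p_sum pi_ell ell_oo l1 N M (sp _ e0).
  apply: upper_density_weaken => //.
  by apply: (le_trans (lerD (lerD (lerD (lexx _) h1) h2) (lexx _))); lra.
move=> e e0; have [|N [M [h1 h2]]] := choose (ln lam * (lam + 1)) (e / 3) _ (sp _ e0).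
  by rewrite mulr_ge0 ?(ltW ll)//; lra.
have := exp_diff_lower p_ge0 p_sum pi_ell l1 N M (sp _ e0).
move=> H; near=> t.
have el0 : 0 < ell t by near: t; exact: (ell_gt0 pi_ell).
have : (ln lam - ln lam / N.+1%:R - ln lam * (lam + 1) * expR (- (M%:R * (ln lam / N.+1%:R))) - e / 3) * ell t
    <= box_sum p (fun y => expR (- y) - expR (- (lam * y))) t by near: t.
apply: le_trans; rewrite ler_wpM2r ?(ltW el0)//.
by move: h1 h2; set u := _ * expR _; set v := _ / N.+1%:R => h1 h2; lra.
Unshelve. all: by end_near. Qed.

End poisson_density.

(** * Densities of the Poisson weights *)
Section poisson_differences.
Context {R : realType}.
Implicit Types (y lam : R) (n j : nat).

Lemma poisS n y : pois n.+1 y = y / n.+1%:R * pois n y.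
Proof. by rewrite /pois factS natrM exprS invfM; ring. Qed.

Lemma pois_scale n lam y : 0 < lam ->
  lam ^- n * pois n (lam * y) = y ^+ n * expR (- (lam * y)) / n`!%:R.
Proof.
move=> l0; rewrite /pois exprMn !mulrA mulVf ?mul1r// expf_neq0// lt0r_neq0//.
Qed.

Lemma poisS_lin n : lin_bounded (@pois R n.+1).
Proof.
exists 1 => y y0; rewrite ger0_norm ?pois_ge0// poisS -[leRHS]mulr1 mul1r.
apply: ler_pM; rewrite ?pois_ge0 ?pois_le1 ?divr_ge0//.
by rewrite ler_pdivrMr// ler_peMr// ler1n.
Qed.

(** The factor lam ^- n matches the powers of y, so that only exponentials are
    subtracted. *)
Lemma pois_diff n lam y : 0 < lam ->
  pois n y - lam ^- n * pois n (lam * y) = y ^+ n / n`!%:R * (expR (- y) - expR (- (lam * y))).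
Proof. by move=> l0; rewrite pois_scale// /pois; ring. Qed.

Lemma pois_diff_le n lam y : 1 <= lam -> 0 <= y ->
  pois n y - lam ^- n * pois n (lam * y) <= (lam - 1) * n.+1%:R * pois n.+1 y.
Proof.
move=> l1 y0; have l0 : 0 < lam by apply: lt_le_trans l1.
rewrite pois_diff//.
have -> : (lam - 1) * n.+1%:R * pois n.+1 y = y ^+ n / n`!%:R * ((lam - 1) * y * expR (- y)).
  have u0 : n.+1%:R != 0 :> R by rewrite pnatr_eq0.
  have v0 : n`!%:R != 0 :> R by rewrite pnatr_eq0 -lt0n fact_gt0.
  by rewrite poisS /pois; move: (n.+1%:R) (n`!%:R) u0 v0 => u v u0 v0; field; rewrite u0 v0.
rewrite ler_wpM2l ?divr_ge0 ?exprn_ge0//.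
have -> : expR (- (lam * y)) = expR (- y) * expR (- ((lam - 1) * y)).
  by rewrite -expRD; congr expR; ring.
have := expR_ge1Dx (- ((lam - 1) * y)); have := expR_ge0 (- y).
by move: (expR (- y)) (expR _) ((lam - 1) * y) => a b c; nra.
Qed.

Lemma pois_diff_ge n lam y : 1 <= lam -> 0 <= y ->
  (lam - 1) * n.+1%:R * (lam ^- n.+1 * pois n.+1 (lam * y)) <= pois n y - lam ^- n * pois n (lam * y).
Proof.
move=> l1 y0; have l0 : 0 < lam by apply: lt_le_trans l1.
rewrite pois_diff// pois_scale//.
have -> : (lam - 1) * n.+1%:R * (y ^+ n.+1 * expR (- (lam * y)) / n.+1`!%:R) =
    y ^+ n / n`!%:R * ((lam - 1) * y * expR (- (lam * y))).
  have u0 : n.+1%:R != 0 :> R by rewrite pnatr_eq0.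
  have v0 : n`!%:R != 0 :> R by rewrite pnatr_eq0 -lt0n fact_gt0.
  by rewrite factS natrM exprS; move: (n.+1%:R) (n`!%:R) u0 v0 => u v u0 v0; field; rewrite u0 v0.
rewrite ler_wpM2l ?divr_ge0 ?exprn_ge0//.
have -> : expR (- y) = expR (- (lam * y)) * expR ((lam - 1) * y).
  by rewrite -expRD; congr expR; ring.
have := expR_ge1Dx ((lam - 1) * y); have := expR_ge0 (- (lam * y)).
by move: (expR (- (lam * y))) (expR _) ((lam - 1) * y) => a b c; nra.
Qed.

Lemma one_sub_exprV n lam : 1 <= lam ->
  n%:R * (lam - 1) * lam ^- n <= 1 - lam ^- n <= n%:R * (lam - 1).
Proof.
move=> l1; have l0 : 0 < lam by apply: lt_le_trans l1.
have ln0 := exprn_gt0 n l0.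
have e : lam ^+ n - 1 = (lam - 1) * \sum_(i < n) lam ^+ i by rewrite -subrX1.
have s1 : n%:R <= \sum_(i < n) lam ^+ i.
  rewrite -[n in n%:R]card_ord -sumr_const; apply: ler_sum => i _; exact: exprn_ege1.
have s2 : \sum_(i < n) lam ^+ i <= n%:R * lam ^+ n.
  rewrite -[n in n%:R]card_ord mulr_natl -sumr_const; apply: ler_sum => i _.
  by rewrite ler_weXn2l// ltnW.
have -> : 1 - lam ^- n = (lam ^+ n - 1) * lam ^- n by rewrite mulrBl mulfV ?mul1r ?lt0r_neq0.
rewrite ler_pM2r ?invr_gt0// ler_pdivrMr// e.
have l2 : 0 <= lam - 1 by rewrite subr_ge0.
move: (\sum_(_ < _) _) (lam ^+ n) s1 s2 => S X s1 s2.
by apply/andP; split; nra.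
Qed.

Lemma ln_bounds lam : 1 <= lam -> (lam - 1) / lam <= ln lam <= lam - 1.
Proof.
move=> l1; have l0 : 0 < lam by apply: lt_le_trans l1.
have -> : (lam - 1) / lam = 1 - lam^-1 by field; rewrite lt0r_neq0.
have u (x : R) : 0 < x -> ln x <= x - 1.
  move=> x0; have -> : ln x = ln (1 + (x - 1)) by congr ln; ring.
  by apply: le_ln1Dx; lra.
apply/andP; split; last exact: u.
have := u lam^-1; rewrite invr_gt0 => /(_ l0); rewrite lnV ?posrE//; lra.
Qed.

End poisson_differences.

Section poisson_densities.
Context {R : realType} (p : nat -> R) (ell : R -> R).
Hypothesis p_ge0 : forall k, 0 <= p k.
Hypothesis p_sum : series p @ \oo --> (1 : R).
Hypothesis pi_ell : de_Haan_Pi ell (counting_function p).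
Hypothesis ell_oo : ell t @[t --> +oo] --> +oo.
Implicit Types (f g : R -> R) (t c : R).

Lemma pois_step_lin n (lam : R) : 1 <= lam ->
  lin_bounded (fun y => pois n y - lam ^- n * pois n (lam * y)).
Proof.
move=> l1; have l0 : 0 < lam by exact: lt_le_trans l1.
have l2 : 0 <= lam - 1 by rewrite subr_ge0.
apply: (@lin_bounded_le _ _ (fun y => (lam - 1) * n.+1%:R * pois n.+1 y)).
  move=> y y0; rewrite ger0_norm ?pois_diff_le//.
  apply: le_trans (pois_diff_ge n l1 y0).
  by rewrite !mulr_ge0 ?pois_ge0 ?invr_ge0 ?exprn_ge0 ?mulr_ge0// ltW.
by apply: lin_boundedZ; exact: poisS_lin.
Qed.

(** The density is ln lam for n = 0, and (1 - lam ^- n) / n otherwise; both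
    are lam - 1 to first order. *)
Lemma pois_step_density n (lam : R) : 1 < lam ->
  ((0 < n)%N -> has_density p ell (@pois R n) n%:R^-1) ->
  exists2 c, has_density p ell (fun y => pois n y - lam ^- n * pois n (lam * y)) c &
    (lam - 1) * lam ^- n.+1 <= c <= lam - 1.
Proof.
move=> l1; have l0 : 0 < lam by exact: lt_trans l1.
have l3 := ltW l1.
case: n => [_|n /(_ isT) h].
  exists (ln lam); last by rewrite expr1; exact: ln_bounds.
  apply: (eq_has_density p_ge0 _ (exp_diff_density p_ge0 p_sum pi_ell ell_oo l1)) => y y0.
  by rewrite pois_diff// expr0 fact0 invr1 !mul1r.
exists (n.+1%:R^-1 - lam ^- n.+1 * n.+1%:R^-1).
  apply: has_densityB => //; first exact: poisS_lin.
    by apply: lin_boundedZ; apply: lin_bounded_scale; [exact: ltW|exact: poisS_lin].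
  apply: has_densityZ => //; first by apply: lin_bounded_scale; [exact: ltW|exact: poisS_lin].
  exact: has_density_scale.
have n0 : 0 < n.+1%:R :> R by [].
have -> : n.+1%:R^-1 - lam ^- n.+1 * n.+1%:R^-1 = (1 - lam ^- n.+1) / n.+1%:R by ring.
rewrite ler_pdivlMr// ler_pdivrMr//.
have /andP[h1 h2] := one_sub_exprV n.+1 l3; rewrite [X in _ && (_ <= X)]mulrC h2 andbT.
apply: le_trans h1.
rewrite [X in _ <= X](_ : _ = (lam - 1) * lam ^- n.+1 * n.+1%:R); last by ring.
rewrite ler_pM2r// ler_pM2l ?subr_gt0// lef_pV2 ?posrE ?exprn_gt0//.
by rewrite ler_weXn2l.
Qed.

Lemma near1_pow (n : nat) (e : R) : 0 < e ->
  exists2 lam : R, 1 < lam & lam ^+ n <= 1 + e /\ 1 - e <= lam ^- n.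
Proof.
move=> e0; pose lam := expR (ln (1 + e) / n.+1%:R).
have le0 : 0 < ln (1 + e) by rewrite ln_gt0// ltrDl.
have l1 : 1 < lam by rewrite -expR0 ltr_expR divr_gt0.
exists lam => //.
have h : lam ^+ n <= 1 + e.
  rewrite -[leRHS]lnK ?posrE; last by rewrite ltr_wpDl.
  rewrite /lam -expRM_natl ler_expR mulrCA ger_pMr//.
  by rewrite ler_pdivrMr// mul1r ler_nat.
split=> //; have ln0 : 0 < lam ^+ n by rewrite exprn_gt0// (lt_trans ltr01).
rewrite -[leRHS]mul1r ler_pdivlMr//.
have [e1|e1] := leP e 1; last by apply: (@le_trans _ _ 0) => //; nra.
nra.
Qed.

(** The n-th Poisson weight has integral 1 / n against dy / y. Induction on n:
    up to the factor (lam - 1) n.+1, the weight n.+1 is squeezed by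
    pois_diff_le and pois_diff_ge between differences formed with the weight
    n, whose density is known, and lam decreases to 1. *)
Lemma pois_density n : has_density p ell (@pois R n.+1) n.+1%:R^-1.
Proof.
elim: n.+1 {-2}n (ltnSn n) => // m IH {}n; rewrite ltnS => nm.
have step lam := @pois_step_density n lam ^~ _.
have prev : (0 < n)%N -> has_density p ell (@pois R n) n%:R^-1.
  by case: n nm {step} => // n nm _; apply: IH.
have n0 : 0 < n.+1%:R :> R by [].
apply: has_density_squeeze => //; first exact: poisS_lin.
  move=> e e0; have [lam l1 [h1 _]] := near1_pow n.+1 (divr_gt0 e0 (ltr0Sn _ 1)).
  have l0 : 0 < lam by exact: lt_trans l1.
  have lm : 0 < lam - 1 by rewrite subr_gt0.
  have [c hc /andP[_ c1]] := pois_step_density l1 prev.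
  have lp := exprn_gt0 n.+1 l0.
  (* pois_diff_ge bounds pois n.+1 at lam * y, hence the rescaling by 1 / lam. *)
  pose a := lam ^+ n.+1 / ((lam - 1) * n.+1%:R).
  have a0 : 0 <= a by rewrite divr_ge0 ?mulr_ge0// ltW.
  have sl := pois_step_lin n (ltW l1).
  have hd : has_density p ell
      (fun y => a * (pois n (lam^-1 * y) - lam ^- n * pois n (lam * (lam^-1 * y)))) (a * c).
    apply: has_densityZ => //.
      by apply: (lin_bounded_scale (f := fun y => pois n y - lam ^- n * pois n (lam * y))) => //; rewrite invr_ge0 ltW.
    have li : 0 < lam^-1 by rewrite invr_gt0.
    exact: (has_density_scale pi_ell (f := fun y => pois n y - lam ^- n * pois n (lam * y)) li hc).
  have /(has_densityP pi_ell)/(_ (e / 2)) [|hu _] := hd; first by rewrite divr_gt0.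
  have := upper_density_le p_ge0 p_sum (poisS_lin n) _ _ hu.
  move=> H; apply: upper_density_weaken (H _ _) => //; last first.
  - move=> y y0; have y1 : 0 <= lam^-1 * y by rewrite mulr_ge0// invr_ge0 ltW.
    have := pois_diff_ge n (ltW l1) y1.
    rewrite mulVKf ?lt0r_neq0// => h; rewrite /a mulrAC ler_pdivlMr ?mulr_gt0//.
    have := ler_wpM2l (ltW lp) h; apply: le_trans; rewrite le_eqVlt; apply/orP; left; apply/eqP.
    by field; rewrite lt0r_neq0.
  - apply: lin_boundedZ.
    by apply: (lin_bounded_scale (f := fun y => pois n y - lam ^- n * pois n (lam * y))) => //; rewrite invr_ge0 ltW.
  - have : a * c <= a * (lam - 1) by rewrite ler_wpM2l.
    have -> : a * (lam - 1) = lam ^+ n.+1 / n.+1%:R.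
      by rewrite /a; move: (n.+1%:R) (lt0r_neq0 n0) => u u0; field; rewrite u0 lt0r_neq0.
    have : lam ^+ n.+1 / n.+1%:R <= n.+1%:R^-1 + e / 2.
      rewrite ler_pdivrMr// mulrDl mulVf ?lt0r_neq0//; apply: le_trans h1 _.
      by rewrite lerD2l ler_peMr ?divr_ge0 ?(ltW e0)// ler1n.
    move=> h2 h3; apply: (le_trans (lerD h3 (lexx (e / 2)))).
    by apply: (le_trans (lerD h2 (lexx _))); rewrite -addrA -splitr.
move=> e e0; have [lam l1 [_ h1]] := near1_pow n.+1 (divr_gt0 e0 (ltr0Sn _ 1)).
have l0 : 0 < lam by exact: lt_trans l1.
have lm : 0 < lam - 1 by rewrite subr_gt0.
have [c hc /andP[c1 _]] := pois_step_density l1 prev.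
pose a := ((lam - 1) * n.+1%:R)^-1.
have a0 : 0 <= a by rewrite invr_ge0 mulr_ge0// ltW.
have sl := pois_step_lin n (ltW l1).
have hd := has_densityZ p_ge0 p_sum (a := a) sl hc.
have /(has_densityP pi_ell)/(_ (e / 2)) [|_ hu] := hd; first by rewrite divr_gt0.
near=> t.
have t0 : 0 <= t by near: t; exact: near_pinfty_ge.
have el0 : 0 < ell t by near: t; exact: (ell_gt0 pi_ell).
apply: (@le_trans _ _ (box_sum p (fun y => a * (pois n y - lam ^- n * pois n (lam * y))) t)); last first.
  apply: ler_box_sum => //; [exact: lin_boundedZ|exact: poisS_lin|move=> y y0].
  rewrite /a [leLHS]mulrC ler_pdivrMr ?mulr_gt0// [leRHS]mulrC; apply: pois_diff_le => //; exact: ltW.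
apply: (@le_trans _ _ ((a * c - e / 2) * ell t)); last by near: t.
rewrite ler_wpM2r ?(ltW el0)//.
have : a * ((lam - 1) * lam ^- n.+1) <= a * c by rewrite ler_wpM2l.
have -> : a * ((lam - 1) * lam ^- n.+1) = lam ^- n.+1 / n.+1%:R.
  by rewrite /a; move: (n.+1%:R) (lt0r_neq0 n0) => u u0; field; rewrite u0 ?expf_neq0 ?lt0r_neq0.
have : n.+1%:R^-1 - e / 2 <= lam ^- n.+1 / n.+1%:R.
  rewrite ler_pdivlMr// mulrBl mulVf ?lt0r_neq0//; apply: le_trans h1.
  by rewrite lerD2l lerN2 ler_peMr ?divr_ge0 ?(ltW e0)// ler1n.
move=> h2 h3; rewrite [X in _ - X](splitr e) opprD addrA lerD2r.
exact: le_trans h2 h3.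
Unshelve. all: by end_near. Qed.

End poisson_densities.

(** * Density of the occupancy variance *)
Section occupancy_profile.
Context {R : realType}.
Implicit Types (y : R) (i j m : nat).

Definition pois_above j y : R := 1 - pois_below j y.
(** Variance of the indicator of at least j balls, for a Poisson number of
    balls of mean y. *)
Definition occupancy_var j y : R := pois_below j y * pois_above j y.

Lemma pois_above_ge0 j y : 0 <= y -> 0 <= pois_above j y.
Proof. by move=> y0; rewrite subr_ge0 pois_below_le1. Qed.

Lemma pois_above_le1 j y : 0 <= y -> pois_above j y <= 1.
Proof. by move=> y0; rewrite gerBl pois_below_ge0. Qed.

Lemma pois0 y : pois 0 y = expR (- y).
Proof. by rewrite /pois expr0 mul1r fact0 divr1. Qed.

Lemma exp_le_pois_below j y : 0 <= y -> expR (- y) <= pois_below j.+1 y.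
Proof.
move=> y0; rewrite /pois_below big_ord_recl pois0 lerDl.
by apply: sumr_ge0 => i _; exact: pois_ge0.
Qed.

Lemma pois_above_le j y : 0 <= y -> pois_above j.+1 y <= y.
Proof.
move=> y0; have := exp_le_pois_below j y0; have := expR_ge1Dx (- y).
rewrite /pois_above; lra.
Qed.

Lemma pois_above_lin j : lin_bounded (@pois_above j.+1).
Proof. by exists 1 => y y0; rewrite mul1r ger0_norm ?pois_above_ge0 ?pois_above_le. Qed.

Lemma occupancy_var_ge0 j y : 0 <= y -> 0 <= occupancy_var j y.
Proof. by move=> y0; rewrite mulr_ge0 ?pois_below_ge0 ?pois_above_ge0. Qed.

Lemma occupancy_var_le_above j y : 0 <= y -> occupancy_var j y <= pois_above j y.
Proof. by move=> y0; rewrite ler_piMl ?pois_above_ge0 ?pois_below_le1. Qed.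

Lemma occupancy_var_le_below j y : 0 <= y -> occupancy_var j y <= pois_below j y.
Proof. by move=> y0; rewrite ler_piMr ?pois_below_ge0 ?pois_above_le1. Qed.

Lemma occupancy_var_lin j : lin_bounded (@occupancy_var j.+1).
Proof.
apply: lin_bounded_le (pois_above_lin j) => y y0.
by rewrite ger0_norm ?occupancy_var_ge0 ?occupancy_var_le_above.
Qed.

Definition triangular j : R := \sum_(i < j) i.+1%:R.

Lemma pois_below_le_inv j y : 0 < y -> pois_below j y <= triangular j / y.
Proof.
move=> y0; rewrite ler_pdivlMr// /pois_below /triangular mulr_suml; apply: ler_sum => i _.
have -> : pois i y * y = i.+1%:R * pois i.+1 y.
  rewrite poisS; have : i.+1%:R != 0 :> R by rewrite pnatr_eq0.
  by move: (i.+1%:R) => u u0; field.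
by rewrite ler_piMr// pois_le1// ltW.
Qed.

(** A product of two Poisson weights at y is a multiple of one weight at 2 y,
    which gives it a known density. *)
Lemma pois_mul i j y : pois i y * pois j y =
  ('C(i + j, i)%:R / 2 ^+ (i + j)) * pois (i + j) (2 * y).
Proof.
have e2 : expR (- (2 * y)) = expR (- y) * expR (- y) by rewrite -expRD; congr expR; ring.
have b : 'C(i + j, i)%:R * i`!%:R * j`!%:R = (i + j)`!%:R :> R.
  rewrite -!natrM; congr (_%:R); have := @bin_fact (i + j) i (leq_addr _ _).
  by rewrite addKn mulnA.
have f0 n : n`!%:R != 0 :> R by rewrite pnatr_eq0 -lt0n fact_gt0.
have c0 : 'C(i + j, i)%:R != 0 :> R by rewrite pnatr_eq0 -lt0n bin_gt0 leq_addr.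
have t0 : 2 ^+ (i + j) != 0 :> R by rewrite expf_neq0.
rewrite /pois e2 exprMn [y ^+ (i + j)]exprD -b.
move: (f0 i) (f0 j) c0 t0; move: (i`!%:R) (j`!%:R) ('C(i + j, i)%:R) (2 ^+ (i + j)) => a c u v *.
by field; apply/and4P.
Qed.

(** Pascal's rule makes the sum at m + 1 the average of itself and of the sum
    at m, as the boundary terms cancel. *)
Lemma binomial_half_sum m : \sum_(i < m.+1) 'C(m + i, i)%:R / 2 ^+ (m + i) = 1 :> R.
Proof.
elim: m => [|m IH]; first by rewrite big_ord_recl big_ord0 bin0 expr0 divr1 addr0.
pose f n i : R := 'C(n + i, i)%:R / 2 ^+ (n + i).
have pas n i : f n.+1 i.+1 = 2^-1 * (f n i.+1 + f n.+1 i).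
  rewrite /f addSn addnS -addSn binS natrD.
  have -> : (n.+1 + i).+1 = (n + i).+2 by rewrite addSn.
  rewrite !exprS; have : 2 ^+ (n + i) != 0 :> R by rewrite expf_neq0.
  by move: (_ ^+ _) => x x0; field.
have f0 n : f n 0%N = 2^-1 ^+ n by rewrite /f addn0 bin0 mul1r exprVn.
have S1 : \sum_(i < m.+2) f m.+1 i = 2^-1 ^+ m.+1 + 2^-1 * (\sum_(i < m.+1) f m i.+1 + \sum_(i < m.+1) f m.+1 i).
  rewrite big_ord_recl f0 -big_split/= mulr_sumr; congr (_ + _).
  by apply: eq_bigr => i _; rewrite -pas.
have S2 : \sum_(i < m.+1) f m i.+1 = \sum_(i < m.+1) f m i - 2^-1 ^+ m + f m m.+1.
  have : \sum_(i < m.+2) f m i = f m 0%N + \sum_(i < m.+1) f m i.+1 by rewrite big_ord_recl.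
  by rewrite big_ord_recr/= f0; lra.
have S3 : \sum_(i < m.+1) f m.+1 i = \sum_(i < m.+2) f m.+1 i - f m.+1 m.+1.
  by rewrite [in RHS]big_ord_recr/= addrK.
have sym : f m.+1 m.+1 = f m m.+1.
  rewrite pas; suff -> : f m.+1 m = f m m.+1 by lra.
  by rewrite /f addSn addnS; congr (_%:R / _);
    rewrite -(@bin_sub (m + m).+1 m) ?subSn ?addnK// ?leqW// leq_addr.
rewrite -/(f m.+1) in S1 *.
move: IH S1; rewrite (_ : \sum_(i < m.+1) _ = \sum_(i < m.+1) f m i)//.
rewrite S2 S3 sym exprS; rewrite (_ : \sum_(i < m.+2) _ = \sum_(i < m.+2) f m.+1 i)//.
by move=> -> ; lra.
Qed.

Lemma binomial_weighted_sum j : (0 < j)%N ->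
  2 * \sum_(i < j) 'C(i + j, i)%:R / 2 ^+ (i + j) / (i + j)%:R = j%:R^-1 :> R.
Proof.
case: j => // m _; rewrite mulr_sumr.
transitivity ((\sum_(i < m.+1) 'C(m + i, i)%:R / 2 ^+ (m + i)) / m.+1%:R : R); last first.
  by rewrite binomial_half_sum mul1r.
rewrite mulr_suml; apply: eq_bigr => i _.
rewrite addnC -[(m.+1 + i)%N]/(m + i).+1.
have b : m.+1%:R * 'C((m + i).+1, i)%:R = (m + i).+1%:R * 'C(m + i, i)%:R :> R.
  rewrite -!natrM; congr (_%:R).
  have e : 'C((m + i).+1, i) = 'C((m + i).+1, m.+1) by rewrite -addSn -bin_sub ?leq_addl// addnK.
  have e' : 'C(m + i, i) = 'C(m + i, m) by rewrite -bin_sub ?leq_addl// addnK.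
  by rewrite e e' mul_bin_diag.
have m0 : m.+1%:R != 0 :> R by rewrite pnatr_eq0.
have mi0 : (m + i).+1%:R != 0 :> R by rewrite pnatr_eq0.
have x0 : 2 ^+ (m + i) != 0 :> R by rewrite expf_neq0.
rewrite exprS; move: b m0 mi0 x0.
move: (m.+1%:R) ((m + i).+1%:R) ('C((m + i).+1, i)%:R) ('C(m + i, i)%:R) (2 ^+ _) => a b c e x h a0 b0 x0.
have -> : c = b * e / a by rewrite -h mulrC mulKf.
by field; apply/and3P.
Qed.

Lemma variance_constantS j : (0 < j)%N -> variance_constant j.+1 =
  variance_constant j - 'C(j + j, j)%:R / 2 ^+ (j + j) / (j + j)%:R :> R.
Proof.
move=> j0; rewrite /variance_constant big_nat_recr//= opprD addrA; congr (_ - _).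
have -> : (2 * j - 1)%N = (j + j).-1 by rewrite mul2n -addnn subn1.
have -> : (2 * j)%N = (j + j)%N by rewrite mul2n addnn.
have n0 : (0 < j + j)%N by rewrite addn_gt0 j0.
have b : 'C(j + j, j)%:R * j`!%:R ^+ 2 = (j + j)%:R * (j + j).-1`!%:R :> R.
  rewrite expr2 -!natrM -[in RHS](prednK n0) -factS (prednK n0); congr (_%:R).
  by have := @bin_fact (j + j) j (leq_addr _ _); rewrite addKn.
have f0 : j`!%:R != 0 :> R by rewrite pnatr_eq0 -lt0n fact_gt0.
have m0 : (j + j)%:R != 0 :> R by rewrite pnatr_eq0 -lt0n.
have x0 : 2 ^+ (j + j) != 0 :> R by rewrite expf_neq0.
move: b f0 m0 x0; move: ('C(j + j, j)%:R) (j`!%:R) ((j + j)%:R) ((j + j).-1`!%:R) (2 ^+ (j + j)) => c f m F x h f0 m0 x0.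
have -> : F = c * f ^+ 2 / m by rewrite h mulrC mulKf.
by field; apply/and3P.
Qed.

Lemma occupancy_varS j y : occupancy_var j.+1 y =
  occupancy_var j y + pois j y - 2 * \sum_(i < j) pois i y * pois j y - pois j y * pois j y.
Proof.
rewrite /occupancy_var /pois_above /pois_below big_ord_recr/= -mulr_suml.
by move: (\sum_(_ < _) _) => S; ring.
Qed.

End occupancy_profile.

Section occupancy_densities.
Context {R : realType} (p : nat -> R) (ell : R -> R).
Hypothesis p_ge0 : forall k, 0 <= p k.
Hypothesis p_sum : series p @ \oo --> (1 : R).
Hypothesis pi_ell : de_Haan_Pi ell (counting_function p).
Hypothesis ell_oo : ell t @[t --> +oo] --> +oo.
Implicit Types (f g : R -> R) (t c : R).

Lemma pois_mul_density i j : (0 < i + j)%N ->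
  has_density p ell (fun y => pois i y * pois j y) ('C(i + j, i)%:R / 2 ^+ (i + j) / (i + j)%:R).
Proof.
move=> ij; have ijS : (i + j)%N = (i + j).-1.+1 by rewrite prednK.
apply: (@eq_has_density _ _ _ p_ge0 (fun y => ('C(i + j, i)%:R / 2 ^+ (i + j)) * pois (i + j) (2 * y))).
  by move=> y _; rewrite pois_mul.
apply: has_densityZ => //.
  by rewrite ijS; apply: lin_bounded_scale => //; exact: poisS_lin.
by rewrite ijS; apply: has_density_scale => //; exact: pois_density.
Qed.

Lemma pois_mul_lin i j : (0 < i + j)%N -> lin_bounded (fun y : R => pois i y * pois j y).
Proof.
move=> ij; have ijS : (i + j)%N = (i + j).-1.+1 by rewrite prednK.
apply: (@lin_bounded_le _ _ (fun y => ('C(i + j, i)%:R / 2 ^+ (i + j)) * pois (i + j) (2 * y))).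
  by move=> y y0; rewrite pois_mul ger0_norm// !mulr_ge0 ?pois_ge0 ?invr_ge0 ?exprn_ge0 ?mulr_ge0.
apply: lin_boundedZ.
by rewrite ijS; apply: lin_bounded_scale => //; exact: poisS_lin.
Qed.

(** In the increment of the profile, the density of the new Poisson weight
    cancels those of its cross terms with the lower weights, by
    binomial_weighted_sum; the square of the new weight is left, and its
    density is the term subtracted in variance_constant. The first profile is
    the difference of exponentials with lam = 2. *)
Lemma occupancy_var_density j : has_density p ell (@occupancy_var R j.+1) (variance_constant j.+1).
Proof.
elim: j => [|j IH].
  rewrite /variance_constant big_geq// subr0.
  have := exp_diff_density p_ge0 p_sum pi_ell ell_oo (ltr1n R 2).
  apply: (eq_has_density p_ge0) => y _.
  rewrite /occupancy_var /pois_above /pois_below big_ord_recl big_ord0 addr0 pois0.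
  by rewrite mulrBr mulr1 -expRD; congr (_ - expR _); ring.
rewrite variance_constantS//.
have l1 := occupancy_var_lin (R := R) j.
have l2 := poisS_lin (R := R) j.
have l3 : forall i : 'I_j.+1, lin_bounded (fun y : R => pois i y * pois j.+1 y).
  by move=> i; apply: pois_mul_lin; rewrite addnS.
have l4 := lin_bounded_sum l3.
have d3 : forall i : 'I_j.+1, has_density p ell (fun y : R => pois i y * pois j.+1 y)
    ('C(i + j.+1, i)%:R / 2 ^+ (i + j.+1) / (i + j.+1)%:R).
  by move=> i; apply: pois_mul_density; rewrite addnS.
have d4 := has_densityZ p_ge0 p_sum (a := 2) l4 (has_density_sum p_ge0 p_sum l3 d3).
rewrite binomial_weighted_sum// in d4.
have d5 := pois_mul_density (i := j.+1) (j := j.+1) isT.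
have l5 := pois_mul_lin (i := j.+1) (j := j.+1) isT.
have := has_densityB p_ge0 p_sum (lin_boundedB (lin_boundedD l1 l2) (lin_boundedZ 2 l4)) l5
  (has_densityB p_ge0 p_sum (lin_boundedD l1 l2) (lin_boundedZ 2 l4)
    (has_densityD p_ge0 p_sum l1 l2 IH (pois_density p_ge0 p_sum pi_ell ell_oo (n := j))) d4) d5.
rewrite addrK; apply: (eq_has_density p_ge0) => y _; exact: esym (occupancy_varS _ _).
Qed.

End occupancy_densities.

(** * Asymptotics of the mean and of the variance *)
Section poisson_monotonicity.
Context {R : realType}.
Implicit Types (y s : R) (i j : nat).

Lemma is_derive_pois0 (x : R) : is_derive x 1 (@pois R 0) (- pois 0 x).
Proof.
rewrite (_ : @pois R 0 = fun y => expR (- y)); last by apply/funext => y; exact: pois0.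
by apply: is_derive_eq; rewrite /GRing.scale/=; ring.
Qed.

Lemma is_derive_poisS i (x : R) : is_derive x 1 (@pois R i.+1) (pois i x - pois i.+1 x).
Proof.
pose f := (i.+1`!%:R)^-1 \*: ((@id R ^+ i.+1) * (fun y => expR (- y))) : R -> R.
rewrite (_ : @pois R i.+1 = f); last first.
  by apply/funext => y; rewrite /f /pois !fctE /GRing.scale/= mulrC.
have -> : pois i x - f x =
    (i.+1`!%:R)^-1 *: ((@id R ^+ i.+1) x *: (- expR (- x)) + expR (- x) *: ((i.+1%:R * x ^+ i) *: 1)).
  rewrite /f /pois !fctE /GRing.scale/= factS natrM.
  have u0 : i.+1%:R != 0 :> R by rewrite pnatr_eq0.
  have v0 : i`!%:R != 0 :> R by rewrite pnatr_eq0 -lt0n fact_gt0.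
  have -> : (i.+1%:R * i`!%:R)^-1 *: (x ^+ i.+1 * expR (- x)) =
      (i.+1%:R * i`!%:R)^-1 * (x ^+ i.+1 * expR (- x)) by [].
  by rewrite exprS; move: (i.+1%:R) (i`!%:R) u0 v0 => u v u0 v0; field; rewrite u0 v0.
have h1 : is_derive x 1 (fun y : R => expR (- y)) (- expR (- x)).
  by apply: is_derive_eq; rewrite /GRing.scale/=; ring.
have h2 : is_derive x 1 (@id R ^+ i.+1) ((i.+1%:R * x ^+ i) *: 1) by exact: is_deriveX.
by apply: is_deriveZ; exact: is_deriveM.
Qed.

Lemma is_derive_pois_below j (x : R) : is_derive x 1 (@pois_below R j.+1) (- pois j x).
Proof.
elim: j => [|j IH].
  rewrite (_ : @pois_below R 1 = @pois R 0); first exact: is_derive_pois0.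
  by apply/funext => y; rewrite /pois_below big_ord_recl big_ord0 addr0.
rewrite (_ : @pois_below R j.+2 = @pois_below R j.+1 \+ @pois R j.+1); last first.
  by apply/funext => y; rewrite /pois_below big_ord_recr.
have h := is_derive_poisS j x.
by apply: is_derive_eq; ring.
Qed.

Lemma pois_below_nincr j y y' : 0 <= y -> y <= y' -> pois_below j y' <= pois_below j y.
Proof.
case: j => [|j] y0; first by rewrite /pois_below !big_ord0.
rewrite le_eqVlt => /orP[/eqP->//|yy'].
have dB := is_derive_pois_below j.
have [|c cy] := @MVT R (@pois_below R j.+1) (fun x => - pois j x) y y' yy'.
  apply: continuous_subspaceT => x; apply: differentiable_continuous.
  by apply/derivable1_diffP; exact: ex_derive.
move=> e; rewrite -subr_le0 e mulNr oppr_le0 mulr_ge0 ?subr_ge0 ?(ltW yy')// pois_ge0//.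
by move: cy; rewrite in_itv/= => /andP[/ltW/(le_trans y0)].
Qed.

Lemma pois_above_ndecr j y y' : 0 <= y -> y <= y' -> pois_above j y <= pois_above j y'.
Proof. by move=> y0 yy; rewrite lerD2l lerN2 pois_below_nincr. Qed.

(** Dominates y times the derivative of pois_above, and has a density. *)
Definition pois_weight j y : R := \sum_(i < j) i.+1%:R * pois i.+1 y.

Lemma pois_weight_lin j : lin_bounded (@pois_weight j).
Proof. by apply: lin_bounded_sum => i; apply: lin_boundedZ; exact: poisS_lin. Qed.

Lemma pois_above_increment j s y : 1 <= s -> 0 <= y ->
  pois_above j (s * y) - pois_above j y <= (s - 1) * pois_weight j y.
Proof.
move=> s1 y0; have s0 : 0 < s by exact: lt_le_trans s1.
have -> : pois_above j (s * y) - pois_above j y = pois_below j y - pois_below j (s * y).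
  by rewrite /pois_above; ring.
rewrite /pois_weight /pois_below -sumrB mulr_sumr.
apply: ler_sum => i _; rewrite mulrA; apply: le_trans (pois_diff_le i s1 y0).
rewrite lerD2l lerN2 ler_piMl ?pois_ge0 ?mulr_ge0 ?(ltW s0)//.
by rewrite invf_le1 ?exprn_gt0// exprn_ege1.
Qed.

Lemma occupancy_var_increment j y y' : 0 <= y -> y <= y' ->
  `|occupancy_var j y' - occupancy_var j y| <= pois_above j y' - pois_above j y.
Proof.
move=> y0 yy'; have := pois_above_ndecr j y0 yy'.
have := pois_above_ge0 j y0; have := pois_above_ge0 j (le_trans y0 yy').
have := pois_above_le1 j y0; have := pois_above_le1 j (le_trans y0 yy').
have e z : occupancy_var j z = (1 - pois_above j z) * pois_above j z.
  by rewrite /occupancy_var {2}/pois_above opprB addrC subrK.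
rewrite !e; move: (pois_above _ _) (pois_above _ _) => a b *.
by rewrite ler_norml; apply/andP; split; nra.
Qed.

End poisson_monotonicity.

Section occupancy_moments.
Context {R : realType} (p : nat -> R) (ell : R -> R).
Hypothesis p_ge0 : forall k, 0 <= p k.
Hypothesis p_sum : series p @ \oo --> (1 : R).
Hypothesis pi_ell : de_Haan_Pi ell (counting_function p).
Hypothesis ell_oo : ell t @[t --> +oo] --> +oo.
Implicit Types (f g : R -> R) (t c : R).

Variable j : nat.
Definition poisson_mean t := box_sum p (@pois_above R j.+1) t.
Definition poisson_var t := box_sum p (@occupancy_var R j.+1) t.

(** The constant is a density, and the profile is bounded below on the shell
    [1, 2), whose density is ln 2. *)
Lemma variance_constant_gt0 : 0 < variance_constant j.+1 :> R.
Proof.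
pose ka : R := expR (- 2) * (expR (- 2) / j.+1`!%:R).
have ka0 : 0 < ka by rewrite !mulr_gt0 ?expR_gt0 ?invr_gt0 ?ltr0n ?fact_gt0.
have sl := @shell_lin R 1 2 ltr01.
apply: (@lt_le_trans _ _ (ka * ln 2)); first by rewrite mulr_gt0// ln_gt0// ltr1n.
have := shell_density p_ge0 p_sum pi_ell (@ltr01 R) (ler1n _ 2).
rewrite ln1 subr0 => /(has_densityZ p_ge0 p_sum (a := ka) sl) h.
have h2 := @occupancy_var_density R p ell p_ge0 p_sum pi_ell ell_oo j.
rewrite /has_density in h h2; apply: (ler_cvg_to h h2).
near=> t.
have t0 : 0 <= t by near: t; exact: near_pinfty_ge.
have el0 : 0 < ell t by near: t; exact: (ell_gt0 pi_ell).
rewrite ler_pM2r ?invr_gt0//; apply: ler_box_sum => //.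
- exact: lin_boundedZ.
- exact: occupancy_var_lin.
move=> y y0; rewrite /shell; case: andP => [[y1 y2]|]; last by rewrite mulr0 occupancy_var_ge0.
have e2 : expR (- 2) <= expR (- y) by rewrite ler_expR lerN2 ltW.
rewrite mulr1; apply: ler_pM; rewrite ?expR_ge0 ?divr_ge0 ?expR_ge0//.
  by apply: le_trans e2 _; exact: exp_le_pois_below.
apply: (@le_trans _ _ (pois j.+1 y)).
  rewrite /pois ler_pM2r ?invr_gt0 ?ltr0n ?fact_gt0//.
  by apply: le_trans e2 _; rewrite ler_peMl ?expR_ge0// exprn_ege1.
have := pois_below_le1 j.+2 y0; rewrite {1}/pois_below big_ord_recr/=.
by rewrite -/(pois_below j.+1 y) /pois_above; lra.
Unshelve. all: by end_near. Qed.

Lemma poisson_var_equiv : poisson_var t / ell t @[t --> +oo] --> (variance_constant j.+1 : R).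
Proof. exact: occupancy_var_density. Qed.

Lemma ell_le_var : exists2 C, 0 < C & \forall t \near +oo, ell t <= C * poisson_var t.
Proof.
have c0 := variance_constant_gt0; exists (2 / variance_constant j.+1); first by rewrite divr_gt0.
have h2 : variance_constant j.+1 / 2 < variance_constant j.+1 :> R by rewrite ltr_pdivrMr//; lra.
near=> t.
have el0 : 0 < ell t by near: t; exact: (ell_gt0 pi_ell).
have : variance_constant j.+1 / 2 <= poisson_var t / ell t.
  by near: t; exact: (cvgr_ge _ poisson_var_equiv _ h2).
rewrite ler_pdivlMr// => h; rewrite mulrAC ler_pdivlMr//; lra.
Unshelve. all: by end_near. Qed.

Lemma poisson_var_gt0 : \forall t \near +oo, 0 < poisson_var t.
Proof.
have [C C0 h] := ell_le_var; near=> t.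
have el0 : 0 < ell t by near: t; exact: (ell_gt0 pi_ell).
by rewrite -(pmulr_rgt0 _ C0); apply: lt_le_trans el0 _; near: t.
Unshelve. all: by end_near. Qed.

(** The increment of each term is at most the relative increment of time
    multiplied by pois_weight, whose box sum is of order ell t, like the
    variance. *)
Lemma poisson_mean_increment : exists2 C, 0 < C & \forall t \near +oo, forall t', t <= t' ->
  poisson_mean t' - poisson_mean t <= C * ((t' - t) / t) * poisson_var t.
Proof.
have [C C0 hC] := ell_le_var.
have wd : has_density p ell (@pois_weight R j.+1) (\sum_(i < j.+1) i.+1%:R * i.+1%:R^-1).
  apply: has_density_sum => // i; first by apply: lin_boundedZ; exact: poisS_lin.
  by apply: has_densityZ => //; [exact: poisS_lin|exact: pois_density].
move/(has_densityP pi_ell)/(_ 1 ltr01): wd => [+ _].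
set D := _ + 1 => wd.
have D0 : 0 < D by rewrite ltr_wpDl// sumr_ge0// => i _; rewrite mulr_ge0.
exists (D * C); first by rewrite mulr_gt0.
near=> t => t' tt'.
have t0 : 0 < t by near: t; exact: near_pinfty_gt.
have s1 : 1 <= t' / t by rewrite ler_pdivlMr// mul1r.
have al := pois_above_lin (R := R) j.
have als : lin_bounded (fun y => pois_above j.+1 (t' / t * y)).
  by apply: lin_bounded_scale => //; exact: le_trans s1.
have -> : poisson_mean t' - poisson_mean t =
    box_sum p (fun y => pois_above j.+1 (t' / t * y) - pois_above j.+1 y) t.
  by rewrite (box_sumB p_ge0 p_sum als al (ltW t0)) box_sum_scale mulfVK ?lt0r_neq0.
apply: (@le_trans _ _ (box_sum p (fun y => (t' / t - 1) * pois_weight j.+1 y) t)).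
  apply: (ler_box_sum p_ge0 p_sum (lin_boundedB als al) (lin_boundedZ _ (@pois_weight_lin R _)) (ltW t0)).
  by move=> y y0; exact: pois_above_increment.
rewrite (box_sumZ p_ge0 p_sum _ (@pois_weight_lin R _) (ltW t0)).
have -> : t' / t - 1 = (t' - t) / t by rewrite mulrBl mulfV ?lt0r_neq0.
have r0 : 0 <= (t' - t) / t by rewrite divr_ge0 ?subr_ge0 ?(ltW t0).
have -> : D * C * ((t' - t) / t) * poisson_var t = (t' - t) / t * (D * (C * poisson_var t)) by ring.
rewrite ler_wpM2l//; apply: (@le_trans _ _ (D * ell t)); first by near: t.
by rewrite ler_wpM2l ?(ltW D0)//; near: t.
Unshelve. all: by end_near. Qed.

Lemma poisson_mean_ndecr t t' : 0 <= t -> t <= t' -> poisson_mean t <= poisson_mean t'.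
Proof.
move=> t0 tt'; have al := pois_above_lin (R := R) j.
apply: (ler_cvg_to (box_sum_cvg p_ge0 p_sum al t0) (box_sum_cvg p_ge0 p_sum al (le_trans t0 tt'))).
apply: nearW => n; apply: ler_sum => k _; apply: pois_above_ndecr; first by rewrite mulr_ge0.
by rewrite ler_wpM2l.
Qed.

Lemma poisson_var_increment t t' : 0 <= t -> t <= t' ->
  `|poisson_var t' - poisson_var t| <= poisson_mean t' - poisson_mean t.
Proof.
move=> t0 tt'; have al := pois_above_lin (R := R) j; have vl := occupancy_var_lin (R := R) j.
have t1 := le_trans t0 tt'.
apply: (ler_cvg_to (cvg_norm (cvgB (box_sum_cvg p_ge0 p_sum vl t1) (box_sum_cvg p_ge0 p_sum vl t0)))
  (cvgB (box_sum_cvg p_ge0 p_sum al t1) (box_sum_cvg p_ge0 p_sum al t0))); apply: nearW => n.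
rewrite !fctE /series/= -!sumrB; apply: le_trans (ler_norm_sum _ _ _) _; apply: ler_sum => k _.
by apply: occupancy_var_increment; [rewrite mulr_ge0|rewrite ler_wpM2l].
Qed.

(** Over each of n doublings before t the counting function increases by about
    ln 2 times ell t. *)
Lemma ell_negligible (K : R) : \forall t \near +oo, K * ell t <= counting_function p t.
Proof.
(* n doublings, so that n ln 2 exceeds K. *)
pose n := (Num.truncn ((K + 1) / ln 2)).+1.
have ln2 : (0 : R) < ln 2 by rewrite ln_gt0// ltr1n.
have n0 : (0 : R) < 2 ^+ n by rewrite exprn_gt0.
have ni : (0 : R) < (2 ^+ n)^-1 by rewrite invr_gt0.
have h := counting_scale_cvg pi_ell (@ltr01 R) ni.
have hK : K < ln 1 - ln (2 ^+ n)^-1.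
  rewrite ln1 sub0r lnV ?posrE// opprK lnXn// -[ln 2 *+ n]mulr_natl -ltr_pdivrMr//.
  apply: lt_trans (truncnS_gt _); rewrite ltr_pM2r ?invr_gt0//; lra.
near=> t.
have t0 : 0 < t by near: t; exact: near_pinfty_gt.
have el0 : 0 < ell t by near: t; exact: (ell_gt0 pi_ell).
have : K <= (counting_function p (1 * t) - counting_function p ((2 ^+ n)^-1 * t)) / ell t.
  by near: t; exact: (cvgr_ge _ h _ hK).
rewrite ler_pdivlMr// mul1r => /le_trans; apply; rewrite gerBl.
rewrite -box_sum_counting ?mulr_gt0//; apply: box_sum_ge0 => //.
- exact: ge1_lin.
- by rewrite mulr_ge0// ltW.
Unshelve. all: by end_near. Qed.

(** The profile of the mean and the indicator of [1, oo), whose box sum is the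
    counting function, differ only by what the tails dominate, hence by
    O(ell), which is o(counting_function p). *)
Lemma poisson_mean_equiv : poisson_mean t / counting_function p t @[t --> +oo] --> (1 : R).
Proof.
have al := pois_above_lin (R := R) j; have gl := @ge1_lin R.
pose g y := small 1 y + (triangular j.+1 : R) * big 1 y.
have lb := lin_boundedZ ((triangular j.+1 : R)) (big_lin (@ltr01 R)).
have lg : lin_bounded g by apply: lin_boundedD => //; exact: small_lin.
have T0 : 0 <= (triangular j.+1 : R) by apply: sumr_ge0.
have ag y : 0 <= y -> `|pois_above j.+1 y - ge1 y| <= g y.
  move=> y0; rewrite /ge1 /g /small /big; case: (leP 1 y) => y1 /=.
    rewrite mulr0 add0r /pois_above addrAC subrr add0r normrN ger0_norm ?pois_below_ge0//.
    by rewrite mul1r; apply: pois_below_le_inv; exact: lt_le_trans y1.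
  by rewrite subr0 mulr1 mul0r mulr0 addr0 ger0_norm ?pois_above_ge0 ?pois_above_le.
have := upper_densityD p_ge0 p_sum (small_lin 1) lb (small1_density p_ge0 p_sum pi_ell)
  (upper_densityZ p_ge0 p_sum T0 (big_lin (@ltr01 R)) (big1_density p_ge0 p_sum pi_ell ell_oo)).
set D := 4 + _ => gD.
have D0 : 0 < D by rewrite ltr_wpDr// mulr_ge0.
apply/cvgrPdist_le => e e0.
near=> t.
have t0 : 0 < t by near: t; exact: near_pinfty_gt.
have el0 : 0 < ell t by near: t; exact: (ell_gt0 pi_ell).
have c1 : D / e * ell t <= counting_function p t by near: t; exact: ell_negligible.
have c0 : 0 < counting_function p t by apply: lt_le_trans c1; rewrite mulr_gt0 ?divr_gt0.
have -> : 1 - poisson_mean t / counting_function p t =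
    - ((poisson_mean t - counting_function p t) / counting_function p t).
  by field; rewrite lt0r_neq0.
rewrite normrN normrM [X in _ * X]ger0_norm ?invr_ge0 ?(ltW c0)// ler_pdivrMr//.
have lB := lin_boundedB al gl.
have -> : poisson_mean t - counting_function p t = box_sum p (fun y => pois_above j.+1 y - ge1 y) t.
  by rewrite (box_sumB p_ge0 p_sum al gl (ltW t0)) box_sum_counting.
apply: (@le_trans _ _ (box_sum p g t)).
  rewrite ler_norml; apply/andP; split.
    rewrite lerNl -mulN1r -(box_sumZ p_ge0 p_sum _ lB (ltW t0)).
    apply: (ler_box_sum p_ge0 p_sum (lin_boundedZ _ lB) lg (ltW t0)) => y y0.
    by rewrite mulN1r; apply: le_trans (ag y y0); rewrite -normrN ler_norm.
  apply: (ler_box_sum p_ge0 p_sum lB lg (ltW t0)) => y y0.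
  by apply: le_trans (ag y y0); rewrite ler_norm.
apply: (@le_trans _ _ (D * ell t)); first by near: t.
by move: c1; rewrite mulrAC ler_pdivrMr// [_ * e]mulrC.
Unshelve. all: by end_near. Qed.

(** All but a fraction eta of the variance comes from boxes with p k * t in [1
    / M, M). The windows attached to times in geometric progression of ratio M
    ^ 2 are disjoint, which is the source of independence in time. *)
Lemma poisson_var_window (eta : R) : 0 < eta -> exists2 M : R, 1 < M &
  \forall t \near +oo,
    box_sum p (fun y => occupancy_var j.+1 y * (1 - shell M^-1 M y)) t <= eta * poisson_var t.
Proof.
move=> eta0; have [C C0 hC] := ell_le_var.
pose T := (triangular j.+1 : R).
have T0 : 0 <= T by apply: sumr_ge0.
pose M := 1 + (8 + 10 * T) * C / eta.
have M1 : 1 < M by rewrite ltrDl !mulr_gt0 ?invr_gt0// ltr_wpDr// mulr_ge0.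
have M0 : 0 < M by exact: lt_trans M1.
exists M => //.
have Mi : 0 < M^-1 by rewrite invr_gt0.
have lb := lin_boundedZ T (big_lin M0).
have lg := lin_boundedD (small_lin M^-1) lb.
have lw : lin_bounded (fun y => occupancy_var j.+1 y * (1 - shell M^-1 M y)).
  apply: lin_bounded_le (occupancy_var_lin (R := R) j) => y y0.
  rewrite normrM ger0_norm ?occupancy_var_ge0// ler_piMr ?occupancy_var_ge0//.
  by rewrite /shell; case: andP => _; rewrite ?subrr ?normr0// subr0 normr1.
have := upper_densityD p_ge0 p_sum (small_lin M^-1) lb (small_density p_ge0 p_sum pi_ell Mi)
  (upper_densityZ p_ge0 p_sum T0 (big_lin M0) (big_density p_ge0 p_sum pi_ell ell_oo M0)).
move=> gD; near=> t.
have t0 : 0 < t by near: t; exact: near_pinfty_gt.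
have el0 : 0 < ell t by near: t; exact: (ell_gt0 pi_ell).
have v0 : 0 < poisson_var t by near: t; exact: poisson_var_gt0.
apply: (@le_trans _ _ (box_sum p (fun y => small M^-1 y + T * big M y) t)).
  apply: (ler_box_sum p_ge0 p_sum lw lg (ltW t0)) => y y0; rewrite /shell /small /big; case: (leP M^-1 y) => y1 /=; case: (ltP y M) => y2 /=.
  - by rewrite subrr mulr0 addr_ge0// !mulr_ge0 ?invr_ge0.
  - rewrite subr0 mulr1 mulr0 add0r mul1r; apply: le_trans (occupancy_var_le_below _ y0) _.
    by apply: pois_below_le_inv; exact: lt_le_trans y2.
  - rewrite subr0 !mulr1; apply: le_trans (occupancy_var_le_above _ y0) _.
    by apply: le_trans (pois_above_le _ y0) _; rewrite lerDl !mulr_ge0 ?invr_ge0.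
  - rewrite subr0 !mulr1; apply: le_trans (occupancy_var_le_above _ y0) _.
    by apply: le_trans (pois_above_le _ y0) _; rewrite lerDl !mulr_ge0 ?invr_ge0.
apply: (@le_trans _ _ ((8 * M^-1 + T * (10 / M)) * ell t)); first by near: t.
have -> : 8 * M^-1 + T * (10 / M) = (8 + 10 * T) / M by ring.
apply: (@le_trans _ _ ((8 + 10 * T) / M * (C * poisson_var t))).
  have Mt : 0 <= (8 + 10 * T) / M by rewrite divr_ge0 ?(ltW M0)// addr_ge0// mulr_ge0.
  by rewrite ler_wpM2l//; near: t.
rewrite mulrA ler_wpM2r ?(ltW v0)// mulrAC ler_pdivrMr// /M mulrDr mulr1.
by rewrite mulrCA mulfV ?lt0r_neq0// mulr1 lerDr ltW.
Unshelve. all: by end_near. Qed.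

End occupancy_moments.

(** * Occupied boxes as independent events *)
Section occupancy_process.
Context {R : realType} {d : measure_display} {T : measurableType d}
  (P : probability T R) (p : nat -> R)
  (xi : nat -> {RV P >-> R}) (box : nat -> {RV P >-> nat}).
Hypothesis p_ge0 : forall k, 0 <= p k.
Hypothesis p_sum : series p @ \oo --> (1 : R).
Hypothesis scheme : poissonized_Karlin_scheme p xi box.
Variable j : nat.
Implicit Types (t : R) (w : T) (k : nat).

Local Notation F := (few_balls_events xi box j.+1).
Local Notation mean := (poisson_mean p j).
Local Notation var := (poisson_var p j).

Lemma counting_le (A B : set nat) : A `<=` B -> (counting A <= counting B :> \bar R)%E.
Proof.
move=> AB; rewrite !counting_dirac; apply: lee_nneseries => // n _.
rewrite !diracE lee_fin ler_nat; case: (boolP (n \in A)) => //.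
by rewrite !inE => /AB /mem_set ->.
Qed.

Lemma few_balls_decr k t t' : t <= t' -> few_balls xi box j.+1 k t' `<=` few_balls xi box j.+1 k t.
Proof.
move=> tt' w; rewrite /few_balls/=; apply: le_lt_trans; apply: counting_le => n [h1 h2].
by split => //; exact: le_trans tt'.
Qed.

Lemma few_balls_events_measurable k : F k `<=` measurable.
Proof. by move=> _ [->|[t _ ->]]; [exact: measurableT|exact: few_balls_measurable]. Qed.

Lemma few_balls_events_setT k : F k setT. Proof. by left. Qed.

Lemma few_balls_events_setI k : setI_closed (F k).
Proof.
move=> _ B [->|[t t0 ->]]; first by rewrite setTI.
case=> [->|[t' t0' ->]]; first by rewrite setIT; right; exists t.
right; have [tt'|/ltW tt'] := leP t t'.
  by exists t' => //; apply/setIidr; exact: few_balls_decr.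
by exists t => //; apply/setIidl; exact: few_balls_decr.
Qed.

Let F_measurable := few_balls_events_measurable.
Let F_setT := few_balls_events_setT.
Let F_setI := few_balls_events_setI.
Let F_indep : mutually_independent P F := few_balls_independent p_ge0 scheme (j := j.+1).

Definition occ t k : set T := ~` few_balls xi box j.+1 k t.
Definition inc t t' k : set T := occ t' k `\` occ t k.

Lemma occ_incr k t t' : t <= t' -> occ t k `<=` occ t' k.
Proof. by move=> tt'; apply: subsetC; exact: few_balls_decr. Qed.

Lemma occ_block t k : 0 <= t -> <<s block F [set k] >> (occ t k).
Proof.
move=> t0; apply: (@measurableC _ (g_sigma_algebraType _)).
by apply: sub_sigma_algebra; apply: (@block1 _ T nat F) => //; right; exists t.
Qed.

Lemma inc_block t t' k : 0 <= t -> 0 <= t' -> <<s block F [set k] >> (inc t t' k).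
Proof.
move=> t0 t0'; apply: (@measurableD _ (g_sigma_algebraType _)); exact: occ_block.
Qed.

Lemma occ_measurable t k : measurable (occ t k).
Proof. by apply: measurableC; exact: few_balls_measurable. Qed.

Lemma occ_law t k : 0 <= t -> P (occ t k) = (pois_above j.+1 (p k * t))%:E.
Proof.
move=> t0; rewrite /occ probability_setC; last exact: few_balls_measurable.
by rewrite (few_balls_law p_ge0 scheme)// -EFinB.
Qed.

Lemma occ_prob t k : 0 <= t -> event_prob P (occ t) k = pois_above j.+1 (p k * t).
Proof. by move=> t0; rewrite /event_prob occ_law. Qed.

Lemma inc_prob t t' k : 0 <= t -> t <= t' ->
  event_prob P (inc t t') k = pois_above j.+1 (p k * t') - pois_above j.+1 (p k * t).
Proof.
move=> t0 tt'; rewrite /event_prob /inc measureD; last 3 first.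
- exact: occ_measurable.
- exact: occ_measurable.
- exact: le_lt_trans (probability_le1 P (occ_measurable _ _)) (ltry 1).
have -> : occ t' k `&` occ t k = occ t k by apply/setIidr; exact: occ_incr.
rewrite [X in fine (X - _)%E](_ : _ = (pois_above j.+1 (p k * t'))%:E); last first.
  by apply: occ_law; exact: le_trans tt'.
rewrite [X in fine (_ - X)%E](_ : _ = (pois_above j.+1 (p k * t))%:E)//.
exact: occ_law.
Qed.

Lemma occupied_boxesE t w : occupied_boxes xi box j.+1 t w = event_count (occ t) w.
Proof.
rewrite /occupied_boxes /event_count; congr (fine (counting _)).
by apply/seteqP; split => k /=; rewrite /occ /few_balls/= leNgt => /negP.
Qed.

Lemma occ_mean_cvg t : 0 <= t -> series (event_prob P (occ t)) @ \oo --> mean t.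
Proof.
move=> t0; rewrite (_ : event_prob P (occ t) = fun k => pois_above j.+1 (p k * t)).
  by apply: box_sum_cvg => //; exact: pois_above_lin.
by apply/funext => k; rewrite occ_prob.
Qed.

Lemma occ_var_cvg t : 0 <= t -> count_var P (occ t) @ \oo --> var t.
Proof.
move=> t0; rewrite (_ : count_var P (occ t) = series (fun k => occupancy_var j.+1 (p k * t))).
  by apply: box_sum_cvg => //; exact: occupancy_var_lin.
apply/funext => N; rewrite /count_var /series/= big_mkord; apply: eq_bigr => k _.
by rewrite occ_prob// /occupancy_var {2}/pois_above opprB [1 + _]addrC subrK mulrC.
Qed.

Lemma mean_occupiedE t : 0 <= t -> mean_occupied xi box j.+1 t = mean t.
Proof.
move=> t0; rewrite /mean_occupied (_ : occupied_boxes _ _ _ _ = event_count (occ t)); last first.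
  by apply/funext => w; exact: occupied_boxesE.
by rewrite (event_count_mean F_measurable (fun k => @occ_block _ k t0) (occ_mean_cvg t0)).
Qed.

Lemma var_occupiedE t : 0 <= t -> var_occupied xi box j.+1 t = var t.
Proof.
move=> t0; rewrite /var_occupied (_ : occupied_boxes _ _ _ _ = event_count (occ t)); last first.
  by apply/funext => w; exact: occupied_boxesE.
by rewrite (event_count_variance F_measurable F_setT F_setI F_indep (fun k => @occ_block _ k t0)
  (occ_mean_cvg t0) (occ_var_cvg t0)).
Qed.

(** Monotonicity in t reduces the statement to integer times. *)
Lemma occ_finite : {ae P, forall w, forall t, ~ lim_sup_set (occ t) w}.
Proof.
have : P.-negligible (\bigcup_n lim_sup_set (occ n%:R)).
  apply: negligible_bigcup => n; apply/negligibleP.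
    apply: (lim_sup_measurable F_measurable (D := occ n%:R)) => k; exact: occ_block.
  by apply: (lim_sup_null F_measurable _ (occ_mean_cvg (ler0n _ n))) => k; exact: occ_block.
apply: negligibleS => w /= /existsNP[t /contrapT h].
exists (Num.truncn t).+1 => // n _; have [k nk tk] := h n I; exists k => //.
by apply: occ_incr tk; rewrite ltW// truncnS_gt.
Qed.

Lemma lim_sup_setS (D D' : nat -> set T) w : (forall k, D k `<=` D' k) ->
  lim_sup_set D w -> lim_sup_set D' w.
Proof. by move=> DD' h n _; have [k nk Dk] := h n I; exists k => //; exact: DD'. Qed.

Lemma event_countD (D D' : nat -> set T) w : (forall k, D k `<=` D' k) -> ~ lim_sup_set D' w ->
  event_count D' w = event_count D w + event_count (fun k => D' k `\` D k) w :> R.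
Proof.
move=> DD' nD'.
have nD : ~ lim_sup_set D w by apply: contra_not nD'; exact: lim_sup_setS.
have nI : ~ lim_sup_set (fun k => D' k `\` D k) w.
  by apply: contra_not nD'; apply: lim_sup_setS => k x [].
have [n1 h1] := event_count_partial (R := R) nD'.
have [n2 h2] := event_count_partial (R := R) nD.
have [n3 h3] := event_count_partial (R := R) nI.
pose n := maxn n1 (maxn n2 n3).
rewrite (h1 n) ?leq_maxl// (h2 n) ?(h3 n); last 2 first.
- by rewrite /n !leq_max leqnn !orbT.
- by rewrite /n !leq_max leqnn !orbT.
rewrite -big_split/=; apply: eq_bigr => k _; rewrite !indicE.
have [Dk|Dk] := pselect (D k w).
  by rewrite (mem_set Dk) (mem_set (DD' k w Dk)) memNset ?addr0// => -[].
rewrite [X in (nat_of_bool X)%:R + _](memNset Dk) add0r; congr ((nat_of_bool _)%:R).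
by apply/idP/idP; rewrite !inE => // -[].
Qed.

Definition centred t w : R := event_count (occ t) w - mean t.

Lemma centred_measurable t : measurable_fun setT (centred t).
Proof. by apply: measurable_funB => //; apply: event_count_measurable => k; exact: occ_measurable. Qed.

Lemma centred_chernoff t (th x : R) : 0 <= t -> `|th| <= 1 ->
  (P [set w | (x < th * centred t w)%R] <= (expR (- x + th ^+ 2 / 2 * (1 + `|th|) * var t))%:E)%E.
Proof.
move=> t0 th1.
apply: (event_count_chernoff F_measurable F_setT F_setI F_indep (fun k => @occ_block _ k t0) (occ_mean_cvg t0)) => //.
move=> N; apply: (cvgr_to_ge (occ_var_cvg t0)); exists N => // n /= Nn.
rewrite /count_var -!(big_mkord xpredT (fun k => event_prob P (occ t) k * (1 - event_prob P (occ t) k))).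
rewrite (@big_cat_nat _ _ _ N 0 n)//= lerDl; apply: sumr_ge0 => k _.
exact: (event_var_ge0 P F_measurable (fun k => @occ_block _ k t0)).
Qed.

(** The boxes that become occupied between t and t' form independent events,
    and the variance of their number is at most its mean. *)
Lemma increment_chernoff t t' (th x : R) : 0 <= t -> t <= t' -> 0 <= th <= 1 ->
  (P [set w | (x < th * (event_count (inc t t') w - (mean t' - mean t)))%R] <=
   (expR (- x + th ^+ 2 * (mean t' - mean t)))%:E)%E.
Proof.
move=> t0 tt' /andP[th0 th1]; have t0' := le_trans t0 tt'.
have hb k := @inc_block t t' k t0 t0'.
have cv : series (event_prob P (inc t t')) @ \oo --> mean t' - mean t.
  rewrite (_ : series _ = series (event_prob P (occ t')) \- series (event_prob P (occ t))).
    by apply: cvgB; exact: occ_mean_cvg.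
  by apply/funext => n; rewrite /series/= -sumrB; apply: eq_bigr => k _; rewrite inc_prob// !occ_prob.
have hV N : count_var P (inc t t') N <= mean t' - mean t.
  apply: (cvgr_to_ge cv); exists N => // n /= Nn.
  rewrite /series/= (@big_cat_nat _ _ _ N)//= -[leLHS]addr0; apply: lerD.
    rewrite big_mkord; apply: ler_sum => k _.
    have /andP[q0 q1] := event_prob01 P F_measurable hb k.
    by rewrite ler_piMr// gerBl.
  by apply: sumr_ge0 => k _; exact: (event_prob_ge0 P F_measurable hb).
have th1' : `|th| <= 1 by rewrite ger0_norm.
apply: le_trans (event_count_chernoff F_measurable F_setT F_setI F_indep hb cv x hV th1') _.
rewrite lee_fin ler_expR lerD2l ger0_norm//.
rewrite ler_wpM2r//; first by rewrite subr_ge0; exact: poisson_mean_ndecr.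
by rewrite -mulrA ler_piMr ?sqr_ge0//; lra.
Qed.

End occupancy_process.

(** * Numerical estimates for the chaining and the series *)
Section numeric.
Context {R : realType}.
Implicit Types (x y z c h : R).

(** A dyadic point of level m is reached from 0 through at most one increment
    of each level. *)
Lemma dyadic_chain (Y : nat -> nat -> R) (x : nat -> R) m :
  (forall i l, Y i.+1 l.*2 = Y i l) ->
  (forall i, 0 <= x i) ->
  (forall i l, (i <= m)%N -> (l < 2 ^ i)%N -> Y i l.+1 - Y i l <= x i) ->
  forall l, (l <= 2 ^ m)%N -> Y m l - Y 0%N 0%N <= \sum_(i < m.+1) x i.
Proof.
move=> Yd x0; elim: m => [|m IH] hY l hl.
  rewrite big_ord_recl big_ord0 addr0.
  case: l hl => [|[|//]] _; first by rewrite subrr.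
  exact: hY.
have {}IH := IH (fun i l im => hY i l (leqW im)).
rewrite big_ord_recr/= -(odd_double_half l).
have h2 : (l./2 <= 2 ^ m)%N by rewrite -(doubleK (2 ^ m)%N) -mul2n -expnS half_leq.
have := IH _ h2; case: (boolP (odd l)) => ol /=; rewrite -Yd; last first.
  by rewrite add0n; have := x0 m.+1; lra.
have h3 : (l./2.*2 < 2 ^ m.+1)%N.
  by rewrite -[X in (X <= _)%N](_ : l = _)// -{1}(odd_double_half l) ol.
have := hY m.+1 _ (leqnn _) h3; rewrite add1n; lra.
Qed.

Lemma exists_pow2 z : 1 <= z -> exists m, z <= 2 ^+ m <= 2 * z.
Proof.
move=> z1.
have ex : exists m, z <= 2 ^+ m.
  exists (Num.truncn z).+1; apply: le_trans (ltW (truncnS_gt z)) _.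
  by rewrite -natrX ler_nat; apply: ltnW; exact: ltn_expl.
case: (ex_minnP ex) => m zm mmin; exists m; rewrite zm/=.
case: m mmin {zm} => [|m] mmin; first by rewrite expr0; lra.
rewrite exprS ler_pM2l//; apply: ltW; rewrite ltNge; apply/negP => /mmin.
by rewrite ltnn.
Qed.

Lemma exists_grid N z : (0 < N)%N -> 0 <= z <= 1 ->
  exists2 l, (l < N)%N & l%:R / N%:R <= z <= l.+1%:R / N%:R.
Proof.
move=> N0 /andP[z0 z1]; have NR : 0 < N%:R :> R by rewrite ltr0n.
have zN : 0 <= z * N%:R by rewrite mulr_ge0// ltW.
have := truncn_itv zN; set l := Num.truncn _ => /andP[h1 h2].
have [lN|Nl] := ltnP l N.
  by exists l => //; rewrite ler_pdivrMr// ler_pdivlMr// h1 ltW.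
exists N.-1; first by rewrite prednK.
rewrite prednK// mulfV ?lt0r_neq0// z1 andbT ler_pdivrMr//.
apply: le_trans (_ : l%:R <= _) => //; rewrite ler_nat; apply: leq_trans Nl.
exact: leq_pred.
Qed.

Lemma add2_le_pow (i : nat) : i.+2%:R <= 2 * (3 / 2) ^+ i :> R.
Proof.
elim: i => [|i IH]; first by rewrite expr0 mulr1.
rewrite exprS mulrCA -natr1; have : 2 <= i.+2%:R :> R by rewrite ler_nat.
lra.
Qed.

Lemma geometric_bound (r : R) n : 0 <= r -> r < 1 -> \sum_(i < n) r ^+ i <= (1 - r)^-1.
Proof.
move=> r0 r1; have r2 : 0 < 1 - r by rewrite subr_gt0.
rewrite -[leRHS]mul1r ler_pdivlMr// mulrC.
have := subrX1 r n; have := exprn_ge0 n r0; lra.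
Qed.

(** The increments allowed at level i shrink like (7 / 8) ^ i, the means like
    1 / 2 ^ i. As 2 (7 / 8) ^ 2 > 3 / 2, the required exponents keep th ^ 2
    times the mean below i.+2 * q. *)
Lemma chain_level_mean (K dl e S q : R) (i : nat) : 0 <= q -> 0 < S -> 0 < e -> 0 <= K * dl -> 16 * (K * dl) <= e ^+ 2 ->
  (2 * i.+2%:R * q / (e * (7 / 8) ^+ i * (S * q))) ^+ 2 * (2 * (K * dl) / 2 ^+ i * (S ^+ 2 * q)) <= i.+2%:R * q.
Proof.
rewrite le_eqVlt => /orP[/eqP<- *|q0]; first by rewrite !mulr0.
move=> S0 e0 kd0 hkd.
have r0 : 0 < (7 / 8) ^+ i :> R by rewrite exprn_gt0.
have t0 : 0 < 2 ^+ i :> R by rewrite exprn_gt0.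
have -> : (2 * i.+2%:R * q / (e * (7 / 8) ^+ i * (S * q))) ^+ 2 * (2 * (K * dl) / 2 ^+ i * (S ^+ 2 * q)) =
    8 * i.+2%:R * (K * dl) / (e ^+ 2 * ((7 / 8) ^+ i ^+ 2 * 2 ^+ i)) * (i.+2%:R * q).
  move: ((7 / 8) ^+ i) (2 ^+ i) (i.+2%:R) (K * dl) r0 t0 => r t u v r0 t0.
  by field; rewrite !lt0r_neq0.
rewrite ler_piMl ?mulr_ge0 ?(ltW q0)//.
rewrite ler_pdivrMr ?mul1r ?mulr_gt0 ?exprn_gt0//.
have h1 := add2_le_pow i.
have h2 : (3 / 2) ^+ i <= (7 / 8) ^+ i ^+ 2 * 2 ^+ i :> R.
  by rewrite -exprM mulnC exprM -exprMn lerXn2r ?nnegrE//; lra.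
apply: (@le_trans _ _ (16 * (K * dl) * (3 / 2) ^+ i)).
  by have := ler_wpM2l kd0 h1; lra.
by apply: ler_pM => //; rewrite mulr_ge0.
Qed.

(** Down to a mesh of order 1 / (e S) the exponents stay in the range where
    the Chernoff bound holds. *)
Lemma chain_level_le1 (e S q : R) (i m : nat) : 0 < q -> 0 < S -> 0 < e -> (i <= m)%N ->
  2 ^+ m <= e / 4 * S -> 2 * i.+2%:R * q / (e * (7 / 8) ^+ i * (S * q)) <= 1.
Proof.
move=> q0 S0 e0 im hm.
have r0 : 0 < (7 / 8) ^+ i :> R by rewrite exprn_gt0.
rewrite ler_pdivrMr ?mulr_gt0// mul1r [leRHS]mulrA ler_pM2r//.
have h1 := add2_le_pow i.
have h2 : (3 / 2) ^+ i <= 2 ^+ m * (7 / 8) ^+ i :> R.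
  apply: (@le_trans _ _ (2 ^+ i * (7 / 8) ^+ i)).
    by rewrite -exprMn lerXn2r ?nnegrE//; lra.
  by rewrite ler_wpM2r ?(ltW r0)// ler_weXn2l// ler1n.
have h3 : 2 ^+ m * (7 / 8) ^+ i <= e / 4 * S * (7 / 8) ^+ i by rewrite ler_wpM2r ?(ltW r0).
by lra.
Qed.

Lemma level_union_bound (q : R) m : expR (- q) <= 4^-1 ->
  \sum_(i < m.+1) 2 ^+ i * expR (- (i.+2%:R * q)) <= 2 * expR (- (2 * q)).
Proof.
move=> hq.
apply: (@le_trans _ _ (\sum_(i < m.+1) expR (- (2 * q)) * 2^-1 ^+ i)).
  apply: ler_sum => i _.
  have -> : - (i.+2%:R * q) = - (2 * q) + i%:R * (- q) by rewrite -addn2 natrD; ring.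
  rewrite expRD mulrCA ler_wpM2l ?expR_ge0// expRM_natl -exprMn lerXn2r ?nnegrE//.
  by lra.
rewrite -mulr_sumr [leRHS]mulrC ler_wpM2l ?expR_ge0//.
have h : 2^-1 < 1 :> R by rewrite invf_lt1// ltr1n.
have := @geometric_bound 2^-1 m.+1 (ltW _) h; rewrite invr_gt0 ltr0n => /(_ isT).
by have -> : (1 - 2^-1)^-1 = 2 :> R by field.
Qed.

(** Up to a constant these are the terms n ^ - (1 + c), dominated by the
    differences of n ^ - c / c. *)
Lemma summable_iterated_log (c h : R) : 0 < c -> 0 < h ->
  cvgn (series (fun n : nat => expR (- ((1 + c) * ln (n%:R * h))))).
Proof.
move=> c0 h0; set u := (fun n : nat => _).
have u0 n : 0 <= u n by exact: expR_ge0.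
pose g (n : nat) := expR (- (1 + c) * ln h) / c * expR (- (c * ln n%:R)) : R.
have g0 n : 0 <= g n by rewrite mulr_ge0 ?divr_ge0 ?expR_ge0// ltW.
have ug n : u n.+2 <= g n.+1 - g n.+2.
  have a0 : 0 < n.+1%:R :> R by [].
  have b0 : 0 < n.+2%:R :> R by [].
  rewrite /u /g lnM ?posrE//.
  have -> : - ((1 + c) * (ln n.+2%:R + ln h)) =
    - (1 + c) * ln h + (- (c * ln n.+2%:R) + - ln n.+2%:R) by ring.
  rewrite !expRD -mulrBr -!mulrA ler_wpM2l ?expR_ge0//.
  rewrite [X in _ * X]expRN lnK ?posrE// -[leLHS](mulKf (lt0r_neq0 c0)).
  rewrite ler_wpM2l ?invr_ge0 ?(ltW c0)//.
  have -> : - (c * ln n.+1%:R) = - (c * ln n.+2%:R) + c * (ln n.+2%:R - ln n.+1%:R) :> R by ring.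
  rewrite expRD -[X in _ - X]mulr1 -mulrBr mulrCA ler_wpM2l ?expR_ge0//.
  have := expR_ge1Dx (c * (ln n.+2%:R - ln n.+1%:R)).
  have : n.+2%:R^-1 <= ln n.+2%:R - ln n.+1%:R :> R.
    have := @le_ln1Dx R (- n.+2%:R^-1).
    have -> : 1 + - n.+2%:R^-1 = n.+1%:R / n.+2%:R :> R.
      by rewrite -[in n.+1%:R](addrK 1 n.+1%:R) natr1 mulrBl mulfV ?lt0r_neq0// mul1r.
    rewrite ln_div ?posrE//.
    have -> : -1 < - n.+2%:R^-1 :> R by rewrite ltrN2 invf_lt1// ltr1n.
    by move=> /(_ isT); rewrite lerNr opprB.
  move=> h1 h2; rewrite lerBrDl; apply: le_trans h2.
  by rewrite lerD2l ler_wpM2l ?(ltW c0).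
apply: nondecreasing_is_cvgn.
  by apply/nondecreasing_seqP => n; rewrite /series/= big_nat_recr//= lerDl.
exists (u 0%N + u 1%N + g 1%N) => _ [n _ <-].
have sn k : \sum_(i < k) u i.+2 <= g 1%N - g k.+1.
  elim: k => [|k IH]; first by rewrite big_ord0 subrr.
  by rewrite big_ord_recr/=; have := ug k; lra.
rewrite /series/= big_mkord; case: n => [|[|n]].
- by rewrite big_ord0 !addr_ge0.
- by rewrite big_ord_recl big_ord0 addr0 -addrA lerDl addr_ge0.
rewrite !big_ord_recl addrA lerD2l.
by apply: le_trans (sn n) _; rewrite gerBl.
Qed.

End numeric.

(** * Chaining over an interval *)
Section borel_cantelli_eventually.
Context {R : realType} {d : measure_display} {T : measurableType d}
  (P : probability T R).

Lemma borel_cantelli_eventually (Q : nat -> T -> Prop) (u : nat -> R) :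
  (exists n0, forall n, (n0 <= n)%N -> exists B : set T,
     [/\ measurable B, (P B <= (u n)%:E)%E & forall w, ~ B w -> Q n w]) ->
  (forall n, 0 <= u n) -> cvgn (series u) ->
  {ae P, forall w, exists n0, forall n, (n0 <= n)%N -> Q n w}.
Proof.
move=> [n0 h] u0 cu.
have /choice[B hB] n : exists B : set T, [/\ measurable B, (P B <= (u n)%:E)%E &
    (n0 <= n)%N -> forall w, ~ B w -> Q n w].
  have [nn|nn] := leqP n0 n; first by have [B [? ? ?]] := h n nn; exists B; split.
  by exists set0; split => //; rewrite measure0 lee_fin.
have [|||N [mN N0 hN]] := @borel_cantelli1 _ _ _ P B u.
- by move=> n; have [] := hB n.
- by move=> n; have [] := hB n.
- exact: cu.
exists N; split => // w /= hw; apply: hN => /= -[n1 hn1]; apply: hw.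
exists (maxn n0 n1) => n; rewrite geq_max => /andP[n0n n1n].
by have [_ _ /(_ n0n)] := hB n; apply; exact: hn1.
Qed.

End borel_cantelli_eventually.

Section chaining.
Context {R : realType} {d : measure_display} {T : measurableType d}
  (P : probability T R) (p : nat -> R)
  (xi : nat -> {RV P >-> R}) (box : nat -> {RV P >-> nat}).
Hypothesis p_ge0 : forall k, 0 <= p k.
Hypothesis p_sum : series p @ \oo --> (1 : R).
Hypothesis scheme : poissonized_Karlin_scheme p xi box.
Variable j : nat.

Local Notation mean := (poisson_mean p j).
Local Notation var := (poisson_var p j).
Local Notation occ := (occ xi box j).
Local Notation inc := (inc xi box j).
Local Notation X := (centred p xi box j).

Lemma count_increment t t' w : t <= t' -> ~ lim_sup_set (occ t') w ->
  event_count (inc t t') w = event_count (occ t') w - event_count (occ t) w :> R.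
Proof.
move=> tt' h; rewrite (event_countD (D := occ t) (D' := occ t') (w := w))//.
  by rewrite addrAC subrr add0r.
by move=> k; exact: occ_incr.
Qed.

Lemma count_ndecr t t' w : t <= t' -> ~ lim_sup_set (occ t') w ->
  event_count (occ t) w <= event_count (occ t') w :> R.
Proof. by move=> tt' h; rewrite -subr_ge0 -count_increment// fine_ge0. Qed.

Section one_interval.
(* The variance at s has order S ^ 2 q, and S q is the order of the
   fluctuations that have probability exp (- q); the law of the iterated
   logarithm takes q = ln (ln s). *)
Variables (s S q K dl e : R).
Hypotheses (s0 : 0 < s) (S0 : 0 < S) (q0 : 0 < q) (K0 : 0 <= K) (dl0 : 0 < dl) (e0 : 0 < e).
Hypothesis mean_incr : forall u u', s <= u -> u <= u' -> u' <= (1 + dl) * s ->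
  mean u' - mean u <= 2 * K * ((u' - u) / s) * (S ^+ 2 * q).
Hypothesis small_step : 16 * (K * dl) <= e ^+ 2.
Hypothesis q_large : expR (- q) <= 4^-1.
Hypothesis S_large : 1 <= e / 8 * S.

(** Chaining over dyadic grids, down to a mesh at which the mean varies by at
    most e * (S * q); below it the monotonicity of the count suffices. The 2 ^
    i increments of level i are paid for by the exponent i.+2 * q. *)
Lemma interval_sup : exists B : set T,
  [/\ measurable B, (P B <= (2 * expR (- (2 * q)))%:E)%E &
    forall w, ~ B w -> (forall t, ~ lim_sup_set (occ t) w) ->
      forall u, s <= u -> u <= (1 + dl) * s -> X u w <= X s w + 9 * e * (S * q)].
Proof.
have small : 2 * (K * dl) <= e ^+ 2 / 8.
  by rewrite ler_pdivlMr//; apply: le_trans small_step; rewrite mulrAC -natrM.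
have [m /andP[m1 m2]] := exists_pow2 S_large.
have {}m2 : 2 ^+ m <= e / 4 * S by lra.
pose pt (i l : nat) := s * (1 + dl * (l%:R / 2 ^+ i)).
have t0 i : 0 < 2 ^+ i :> R by rewrite exprn_gt0.
have pt_mono i l l' : (l <= l')%N -> pt i l <= pt i l'.
  move=> ll; rewrite ler_pM2l// lerD2l ler_pM2l// ler_pM2r ?invr_gt0//.
  by rewrite ler_nat.
have pt0 i : pt i 0%N = s by rewrite /pt mul0r mulr0 addr0 mulr1.
have pt_ge i l : s <= pt i l by rewrite -(pt0 i); exact: pt_mono.
have pt_ge0 i l : 0 <= pt i l by apply: le_trans (pt_ge i l); exact: ltW.
have pt_last i : pt i (2 ^ i)%N = (1 + dl) * s.
  by rewrite /pt natrX mulfV ?mulr1 1?mulrC// lt0r_neq0.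
have pt_le i l : (l <= 2 ^ i)%N -> pt i l <= (1 + dl) * s by rewrite -(pt_last i); exact: pt_mono.
have pt_diff i l : (pt i l.+1 - pt i l) / s = dl / 2 ^+ i.
  rewrite /pt -natr1; move: (2 ^+ i) (t0 i) => x x0.
  by field; rewrite !lt0r_neq0.
have pt_double i l : pt i.+1 l.*2 = pt i l.
  rewrite /pt exprS -muln2 natrM; move: (2 ^+ i) (t0 i) => x x0.
  by congr (_ * (_ + _)); field; rewrite lt0r_neq0.
(* Increment allowed at level i of the chain, and the exponent of its Chernoff
   bound. *)
pose x (i : nat) := e * (7 / 8) ^+ i * (S * q).
have x0 i : 0 < x i by rewrite !mulr_gt0// exprn_gt0.
pose th (i : nat) := 2 * i.+2%:R * q / x i.
have th0 i : 0 < th i by rewrite divr_gt0// !mulr_gt0.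
pose mu i l := mean (pt i l.+1) - mean (pt i l).
have mu_le i l : (l < 2 ^ i)%N -> mu i l <= 2 * (K * dl) / 2 ^+ i * (S ^+ 2 * q).
  move=> l2; apply: le_trans (mean_incr _ _ _) _ => //.
  - exact: pt_mono.
  - exact: pt_le.
  - by rewrite pt_diff; rewrite le_eqVlt; apply/orP; left; apply/eqP; ring.
pose E i l := [set w | 2 * i.+2%:R * q < th i * (event_count (inc (pt i l) (pt i l.+1)) w - mu i l)].
have mE i l : measurable (E i l).
  rewrite /E -[X in measurable X]setTI.
  rewrite (_ : [set w | _] = (fun w => th i * (event_count (inc (pt i l) (pt i l.+1)) w - mu i l)) @^-1` `]2 * i.+2%:R * q, +oo[).
    have mf : measurable_fun setT (fun w => th i * (event_count (inc (pt i l) (pt i l.+1)) w - mu i l)).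
      apply: measurable_funM => //; apply: measurable_funB => //.
      apply: event_count_measurable => k; apply: measurableD; exact: occ_measurable.
    by apply: mf => //; exact: measurable_itv.
  by apply/seteqP; split => w /=; rewrite in_itv/= andbT.
have PE i l : (i <= m)%N -> (l < 2 ^ i)%N -> (P (E i l) <= (expR (- (i.+2%:R * q)))%:E)%E.
  move=> im l2; apply: (le_trans (@increment_chernoff _ _ _ _ _ _ _ p_ge0 p_sum scheme j
    (pt i l) (pt i l.+1) (th i) (2 * i.+2%:R * q) _ _ _)) => //.
  - exact: pt_mono.
  - by rewrite (ltW (th0 i))/=; apply: (@chain_level_le1 _ e S q i m).
  rewrite lee_fin ler_expR.
  have : th i ^+ 2 * mu i l <= i.+2%:R * q.
    apply: (@le_trans _ _ (th i ^+ 2 * (2 * (K * dl) / 2 ^+ i * (S ^+ 2 * q)))).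
      by rewrite ler_wpM2l ?sqr_ge0// mu_le.
    by apply: chain_level_mean => //; [exact: ltW|rewrite mulr_ge0// ltW].
  rewrite -/(mu i l); lra.
pose B := \big[setU/set0]_(i < m.+1) \big[setU/set0]_(l < 2 ^ i) E i l.
have mEi i : measurable (\big[setU/set0]_(l < 2 ^ i) E i l) by exact: bigsetU_measurable.
exists B; split.
- exact: bigsetU_measurable.
- apply: le_trans (_ : (\sum_(i < m.+1) \sum_(l < 2 ^ i) P (E i l) <= _)%E).
    apply: le_trans (Boole_inequality _ (fun i _ => mEi i)) _.
    by apply: lee_sum => i _; by apply: Boole_inequality => l _.
  apply: (@le_trans _ _ (\sum_(i < m.+1) (2 ^+ i * expR (- (i.+2%:R * q)))%:E)%E).
    apply: lee_sum => i _.
    apply: (@le_trans _ _ (\sum_(l < 2 ^ i) (expR (- (i.+2%:R * q)))%:E)%E).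
      by apply: lee_sum => l _; apply: PE => //; rewrite -ltnS.
    by rewrite sumEFin sumr_const card_ord lee_fin -[leLHS]mulr_natl natrX.
  by rewrite sumEFin lee_fin level_union_bound.
move=> w nB fin u su us.
have nE i l : (i <= m)%N -> (l < 2 ^ i)%N -> ~ E i l w.
  move=> im l2 Ew; apply: nB; have -> : B = \bigcup_(i in `I_m.+1) \big[setU/set0]_(l < 2 ^ i) E i l by rewrite bigcup_mkord.
  exists i => //=.
  have -> : \big[setU/set0]_(l < 2 ^ i) E i l = \bigcup_(l in `I_(2 ^ i)) E i l by rewrite bigcup_mkord.
  by exists l.
pose Y i l := X (pt i l) w.
have Yinc i l : (i <= m)%N -> (l < 2 ^ i)%N -> Y i l.+1 - Y i l <= x i.
  move=> im l2; have := nE i l im l2; rewrite /E/= => /negP; rewrite -leNgt.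
  have -> : event_count (inc (pt i l) (pt i l.+1)) w - mu i l = Y i l.+1 - Y i l.
    rewrite count_increment//; last exact: pt_mono.
    by rewrite /Y /centred /mu; ring.
  rewrite mulrC -ler_pdivlMr// => h; apply: le_trans h _.
  by rewrite /th invfM invrK mulrA mulfV ?mul1r// lt0r_neq0 ?mulr_gt0.
have chain := dyadic_chain (Y := Y) (x := x) (m := m) _ _ Yinc.
have xsum : \sum_(i < m.+1) x i <= 8 * e * (S * q).
  rewrite /x -mulr_suml -mulr_sumr ler_wpM2r ?mulr_ge0 ?(ltW S0) ?(ltW q0)// mulrC ler_wpM2r ?(ltW e0)//.
  have h : 7 / 8 < 1 :> R by lra.
  have := @geometric_bound R (7 / 8) m.+1 _ h.
  have -> : (1 - 7 / 8)^-1 = 8 :> R by field.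
  by apply; lra.
have [|l lm /andP[l1 l2]] := @exists_grid R (2 ^ m)%N ((u / s - 1) / dl) (expn_gt0 2 m).
  apply/andP; split.
    by rewrite divr_ge0 ?(ltW dl0)// subr_ge0 ler_pdivlMr// mul1r.
  by rewrite ler_pdivrMr// mul1r lerBlDl ler_pdivrMr.
have ul : pt m l <= u.
  move: l1; rewrite natrX ler_pdivlMr// lerBrDl ler_pdivlMr// => l1.
  by apply: le_trans l1; rewrite /pt mulrC [dl * _]mulrC.
have uS : u <= pt m l.+1.
  move: l2; rewrite natrX ler_pdivrMr// lerBlDl ler_pdivrMr// => l2.
  by apply: le_trans l2 _; rewrite /pt mulrC [dl * _]mulrC.
(* Between two points of the finest grid the count is monotone. *)
have h1 : X u w <= X (pt m l.+1) w + mu m l.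
  rewrite /centred /mu; have := count_ndecr uS (fin (pt m l.+1)).
  have := poisson_mean_ndecr p_ge0 p_sum j (pt_ge0 m l) ul; lra.
have h2 : X (pt m l.+1) w - X s w <= \sum_(i < m.+1) x i.
  rewrite -(pt0 0%N); apply: chain => //.
  - by move=> i k; rewrite /Y pt_double.
  - by move=> i; exact: ltW.
have h3 : mu m l <= e * (S * q).
  apply: le_trans (mu_le m l lm) _.
  have -> : 2 * (K * dl) / 2 ^+ m * (S ^+ 2 * q) = 2 * (K * dl) * S / 2 ^+ m * (S * q) by ring.
  rewrite ler_pM2r ?mulr_gt0// ler_pdivrMr//.
  apply: (@le_trans _ _ (e ^+ 2 / 8 * S)); first by rewrite ler_pM2r.
  rewrite expr2 -!mulrA ler_wpM2l ?(ltW e0)//; apply: le_trans m1.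
  by rewrite mulrA.
lra.
Qed.

End one_interval.

End chaining.

(** * Upper half of the law of the iterated logarithm *)
Section geometric_grid.
Context {R : realType}.

Lemma near_geometric (lam : R) (Q : R -> Prop) : 1 < lam -> (\forall t \near +oo, Q t) ->
  exists n0, forall n, (n0 <= n)%N -> Q (lam ^+ n).
Proof.
move=> l1 [A [_ AQ]].
have d0 : 0 < lam - 1 by rewrite subr_gt0.
have bern n : n%:R * (lam - 1) <= lam ^+ n.
  elim: n => [|n IH]; first by rewrite mul0r expr0.
  have : 1 <= lam ^+ n by rewrite exprn_ege1// ltW.
  by rewrite exprS -natr1; nra.
exists (Num.truncn (A / (lam - 1))).+1 => n hn; apply: AQ.
apply: lt_le_trans (bern n); rewrite -ltr_pdivrMr//.
by apply: lt_le_trans (truncnS_gt _) _; rewrite ler_nat.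
Qed.

Lemma geometric_bracket (lam t : R) (n0 : nat) : 1 < lam -> lam ^+ n0 <= t ->
  exists2 n, (n0 <= n)%N & lam ^+ n <= t < lam ^+ n.+1.
Proof.
move=> l1 h0.
have [M hM] := @near_geometric lam (fun x => t < x) l1 (near_pinfty_gt t).
have ex : exists n, (t < lam ^+ n) by exists M; exact: hM.
case: (ex_minnP ex) => n tn nmin.
have n0n : (n0 < n)%N.
  rewrite ltnNge; apply/negP => nn0.
  have := lt_le_trans tn (_ : lam ^+ n <= t); rewrite ltxx => /(_ _)/negP; apply => //.
  by apply: le_trans h0; rewrite ler_weXn2l// ltW.
case: n tn nmin n0n => // n tn nmin n0n; exists n => //.
by rewrite tn andbT leNgt; apply/negP => /nmin; rewrite ltnn.
Qed.

Lemma lnln_geometric (lam : R) n : 1 < lam -> ln (ln (lam ^+ n)) = ln (n%:R * ln lam).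
Proof. by move=> l1; rewrite lnXn ?(lt_trans ltr01)// mulr_natl. Qed.

Lemma lnln_oo : ln (ln t) @[t --> +oo] --> (+oo : set_system R).
Proof.
apply/cvgryPge => A; near=> t.
have h1 : expR (expR A) <= t by near: t; exact: near_pinfty_ge.
have h2 : expR A <= ln t by rewrite -[leLHS]expRK ler_ln ?posrE ?expR_gt0// (lt_le_trans _ h1) ?expR_gt0.
by rewrite -[leLHS]expRK ler_ln ?posrE ?expR_gt0// (lt_le_trans _ h2) ?expR_gt0.
Unshelve. all: by end_near. Qed.

Lemma lnln_ndecr (t t' : R) : expR 1 <= t -> t <= t' -> ln (ln t) <= ln (ln t').
Proof.
move=> h tt'; have t0 : 0 < t by exact: lt_le_trans (expR_gt0 _) h.
have t0' := lt_le_trans t0 tt'.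
have l1 : ln t <= ln t' by rewrite ler_ln.
have l0 : 0 < ln t.
  by apply: lt_le_trans ltr01 _; rewrite -[leLHS]expRK ler_ln ?posrE ?expR_gt0.
by rewrite ler_ln ?posrE// (lt_le_trans l0).
Qed.

End geometric_grid.

Section upper_half.
Context {R : realType} {d : measure_display} {T : measurableType d}
  (P : probability T R) (p : nat -> R)
  (xi : nat -> {RV P >-> R}) (box : nat -> {RV P >-> nat}).
Hypothesis p_ge0 : forall k, 0 <= p k.
Hypothesis p_sum : series p @ \oo --> (1 : R).
Hypothesis scheme : poissonized_Karlin_scheme p xi box.
Variable j : nat.

Local Notation mean := (poisson_mean p j).
Local Notation var := (poisson_var p j).
Local Notation occ := (occ xi box j).
Local Notation X := (centred p xi box j).
Local Notation q t := (ln (ln t)).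

Variable C : R.
Hypothesis C0 : 0 < C.
Hypothesis mean_incr : \forall t \near +oo, forall t', t <= t' ->
  mean t' - mean t <= C * ((t' - t) / t) * var t.
Hypothesis var_large : var t / q t @[t --> +oo] --> +oo.

Lemma lnln_near_ge (A : R) : \forall t \near +oo, A <= q t.
Proof. by move/cvgryPge : (@lnln_oo R); exact. Qed.

Lemma var_gt0 : \forall t \near +oo, 0 < var t.
Proof.
have h : \forall t \near +oo, 1 <= var t / q t by move/cvgryPge : var_large; exact.
near=> t.
have q0 : 1 <= q t by near: t; exact: lnln_near_ge.
have q1 : 0 < q t by exact: lt_le_trans q0.
have : 1 <= var t / q t by near: t.
by rewrite ler_pdivlMr// mul1r; apply: lt_le_trans.
Unshelve. all: by end_near. Qed.

Lemma var_over_q_large (A : R) : \forall t \near +oo, A <= Num.sqrt (var t / q t).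
Proof.
have h : \forall t \near +oo, Num.max 0 A ^+ 2 <= var t / q t by move/cvgryPge : var_large; exact.
near=> t.
have h2 : Num.max 0 A ^+ 2 <= var t / q t by near: t.
apply: (@le_trans _ _ (Num.max 0 A)); first by rewrite le_max lexx orbT.
rewrite -[leLHS]ger0_norm ?le_max ?lexx// -sqrtr_sqr ler_sqrt//.
by apply: le_trans h2; exact: sqr_ge0.
Unshelve. all: by end_near. Qed.

Local Notation a t := (Num.sqrt (2 * var t * q t)).
Local Notation S t := (Num.sqrt (var t / q t)).

Lemma scale_facts t : 0 < var t -> 0 < q t ->
  [/\ 0 < a t, 0 < S t, a t ^+ 2 = 2 * var t * q t, var t = S t ^+ 2 * q t & S t * q t <= a t].
Proof.
move=> v0 q0.
have h1 : 0 < 2 * var t * q t by rewrite !mulr_gt0.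
have h2 : 0 < var t / q t by rewrite divr_gt0.
have e2 : var t = S t ^+ 2 * q t by rewrite sqr_sqrtr ?(ltW h2)// mulfVK// lt0r_neq0.
split; rewrite ?sqrtr_gt0//; first by rewrite sqr_sqrtr// ltW.
rewrite -[leLHS]ger0_norm ?mulr_ge0 ?sqrtr_ge0 ?(ltW q0)// -sqrtr_sqr ler_sqrt ?(ltW h1)//.
rewrite exprMn [q t ^+ 2]expr2 mulrA -e2.
by have := mulr_gt0 v0 q0; lra.
Qed.

(** Chernoff's bound at a multiple of the normalisation; the exponent tends to
    0 because the variance outgrows ln (ln t). *)
Lemma exceed_event (ep : R) : 0 < ep <= 1 -> \forall t \near +oo, exists B : set T,
  [/\ measurable B, (P B <= (expR (- ((1 + ep) * q t)))%:E)%E &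
   forall w, ~ B w -> X t w <= (1 + ep) * a t].
Proof.
move=> /andP[e0 e1]; near=> t.
have v0 : 0 < var t by near: t; exact: var_gt0.
have q1 : 1 <= q t by near: t; exact: lnln_near_ge.
have q0 : 0 < q t by exact: lt_le_trans q1.
have t0 : 0 <= t by near: t; exact: near_pinfty_ge.
have Sl : 8 / ep <= S t by near: t; exact: var_over_q_large.
have [a0 S0 a2 vS Sa] := scale_facts v0 q0.
(* The optimal exponent for a Gaussian tail, (1 + ep) a / var. *)
pose th := (1 + ep) * 2 * q t / a t.
have th0 : 0 < th by rewrite divr_gt0// !mulr_gt0// addr_gt0.
have th1 : th <= ep / 2.
  rewrite /th ler_pdivrMr//.
  have : 8 * q t <= ep * a t.
    apply: (@le_trans _ _ (ep * (S t * q t))); last by rewrite ler_pM2l.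
    by rewrite mulrA ler_pM2r// mulrC -ler_pdivrMr.
  by have := mulr_ge0 (ltW e0) (ltW q0); nra.
pose B := [set w | 2 * (1 + ep) ^+ 2 * q t < th * X t w].
exists B; split.
- rewrite /B (_ : [set w | _] = (fun w => th * X t w) @^-1` `]2 * (1 + ep) ^+ 2 * q t, +oo[).
    rewrite -[Y in measurable Y]setTI.
    have mf : measurable_fun setT (fun w => th * X t w).
      by apply: measurable_funM => //; exact: centred_measurable.
    by apply: mf => //; exact: measurable_itv.
  by apply/seteqP; split => w /=; rewrite in_itv/= andbT.
- have th2 : `|th| <= 1 by rewrite ger0_norm ?(ltW th0)//; lra.
  apply: le_trans (centred_chernoff p_ge0 p_sum scheme j _ t0 th2) _.
  rewrite lee_fin ler_expR (ger0_norm (ltW th0)).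
  have -> : th ^+ 2 / 2 * (1 + th) * var t = (1 + ep) ^+ 2 * q t * (1 + th).
    have -> : th ^+ 2 / 2 * (1 + th) * var t = (th ^+ 2 * var t) / 2 * (1 + th) by ring.
    have -> : th ^+ 2 * var t = 2 * (1 + ep) ^+ 2 * q t.
      rewrite /th expr_div_n a2; field; by rewrite !lt0r_neq0.
    by field.
  have -> : - (2 * (1 + ep) ^+ 2 * q t) + (1 + ep) ^+ 2 * q t * (1 + th) = - ((1 + ep) * (1 - th) * ((1 + ep) * q t)) by ring.
  rewrite lerN2 ler_peMl ?mulr_ge0 ?(ltW q0)//; first lra.
  nra.
- move=> w; rewrite /B/= => /negP; rewrite -leNgt.
  have -> : 2 * (1 + ep) ^+ 2 * q t = th * ((1 + ep) * a t).
    by rewrite /th; field; rewrite lt0r_neq0.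
  by rewrite ler_pM2l.
Unshelve. all: by end_near. Qed.

(** Along lam ^ n, ln (ln t) is ln n up to a constant, so the exceptional
    probabilities are of order n ^ - (1 + ep). *)
Lemma upper_grid (lam ep : R) : 1 < lam -> 0 < ep <= 1 ->
  {ae P, forall w, exists n0, forall n, (n0 <= n)%N ->
     X (lam ^+ n) w <= (1 + ep) * a (lam ^+ n)}.
Proof.
move=> l1 ep01; have /andP[e0 _] := ep01.
pose u (n : nat) := expR (- ((1 + ep) * ln (n%:R * ln lam))) : R.
apply: (@borel_cantelli_eventually _ _ _ P _ u); first last.
- by apply: summable_iterated_log => //; exact: ln_gt0.
- by move=> n; exact: expR_ge0.
have [n0 h] := near_geometric l1 (exceed_event ep01).
exists n0 => n /h[B [mB PB hB]]; exists B; split => //.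
by rewrite /u -lnln_geometric.
Qed.

(** Over one step of the grid the count moves by a small multiple of the
    normalisation, except with a probability of order n ^ - 2, provided that
    lam is close to 1. *)
Lemma upper_chain (lam e : R) : 1 < lam -> 0 < e -> 16 * (C * (lam - 1)) <= e ^+ 2 -> C * (lam - 1) <= 1 ->
  {ae P, forall w, exists n0, forall n, (n0 <= n)%N -> (forall t, ~ lim_sup_set (occ t) w) ->
     forall u, lam ^+ n <= u -> u <= lam * lam ^+ n ->
     X u w <= X (lam ^+ n) w + 9 * e * a (lam ^+ n)}.
Proof.
move=> l1 e0 hC hC1; have d0 : 0 < lam - 1 by rewrite subr_gt0.
pose u (n : nat) := 2 * expR (- ((1 + 1) * ln (n%:R * ln lam))) : R.
apply: (@borel_cantelli_eventually _ _ _ P _ u); first last.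
- rewrite (_ : u = (fun n => 2 *: expR (- ((1 + 1) * ln (n%:R * ln lam)))))//.
  by apply: is_cvg_seriesZ; apply: summable_iterated_log => //; exact: ln_gt0.
- by move=> n; rewrite mulr_ge0 ?expR_ge0.
have [T0 [_ hT]] := mean_incr.
have main : \forall t \near +oo, exists B : set T,
  [/\ measurable B, (P B <= (2 * expR (- (2 * q t)))%:E)%E &
   forall w, ~ B w -> (forall t, ~ lim_sup_set (occ t) w) ->
     forall u, t <= u -> u <= lam * t -> X u w <= X t w + 9 * e * a t].
  near=> t.
  have v0 : 0 < var t by near: t; exact: var_gt0.
  have q1 : ln 4 <= q t by near: t; exact: lnln_near_ge.
  have q0 : 0 < q t by apply: lt_le_trans q1; rewrite ln_gt0// ltr1n.
  have t0 : 0 < t by near: t; exact: near_pinfty_gt.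
  have tT : T0 < t by near: t; exact: near_pinfty_gt.
  have Sl : 8 / e <= S t by near: t; exact: var_over_q_large.
  have [a0 S0 a2 vS Sa] := scale_facts v0 q0.
  have vu u' : t <= u' -> u' <= lam * t -> var u' <= 2 * var t.
    move=> tu ul; have := poisson_var_increment p_ge0 p_sum j (ltW t0) tu.
    have h1 := hT t tT u' tu.
    have h2 : C * ((u' - t) / t) * var t <= var t.
      rewrite ler_piMl ?(ltW v0)//; apply: le_trans hC1.
      rewrite ler_pM2l// ler_pdivrMr//; lra.
    by rewrite ler_norml => /andP[_]; lra.
  have [||||B [mB PB hB]] := @interval_sup _ _ _ P p xi box p_ge0 p_sum scheme j t (S t) (q t) C (lam - 1) e
    t0 S0 q0 (ltW C0) d0 e0.
  - move=> s s' ts ss'; rewrite addrC subrK => s'l.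
    have s0 := lt_le_trans t0 ts.
    apply: le_trans (hT s (lt_le_trans tT ts) s' ss') _.
    rewrite -vS.
    apply: (@le_trans _ _ (C * ((s' - s) / t) * (2 * var t))); last by rewrite le_eqVlt; apply/orP; left; apply/eqP; ring.
    have ds : 0 <= s' - s by rewrite subr_ge0.
    apply: ler_pM.
    + by rewrite mulr_ge0 ?(ltW C0)// divr_ge0// ltW.
    + apply: box_sum_ge0 => //; [exact: occupancy_var_lin|exact: ltW|move=> y y0; exact: occupancy_var_ge0].
    + by rewrite ler_pM2l// ler_wpM2l// lef_pV2.
    + by apply: vu => //; exact: le_trans s'l.
  - exact: hC.
  - by rewrite expRN lef_pV2 ?posrE ?expR_gt0// -[leLHS]lnK ?posrE// ler_expR.
  - by rewrite mulrAC ler_pdivlMr// mul1r mulrC -ler_pdivrMr.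
  exists B; split => // w nB fin u0 tu ul; apply: le_trans (hB w nB fin u0 tu _) _.
    by rewrite addrC subrK.
  by rewrite lerD2l ler_pM2l ?mulr_gt0.
have [n0 h] := near_geometric l1 main.
exists n0 => n /h[B [mB PB hB]]; exists B; split => //.
by rewrite /u -lnln_geometric.
Unshelve. all: by end_near. Qed.

Lemma lil_upper (ep : R) : 0 < ep ->
  {ae P, forall w, \forall t \near +oo, X t w <= (1 + ep) * a t}.
Proof.
move=> ep0; pose e1 := Num.min ep 1 / 5.
have m0 : 0 < Num.min ep 1 by rewrite lt_min ep0 ltr01.
have e10 : 0 < e1 by rewrite divr_gt0.
have e11 : e1 <= 1 / 5 by rewrite ler_pM2r// ge_min lexx orbT.
have e1e : e1 <= ep / 5 by rewrite ler_pM2r// ge_min lexx.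
pose e := e1 / 9.
have e0 : 0 < e by rewrite divr_gt0.
(* The ratio of the grid is so close to 1 that over one step the variance
   changes by a fraction e1 at most and chaining costs e1 * a. *)
pose dl := e ^+ 2 / 16 / C.
have dl0 : 0 < dl by rewrite !divr_gt0// exprn_gt0.
have Cdl : C * dl = e ^+ 2 / 16 by rewrite /dl mulrC mulfVK// lt0r_neq0.
have e2 : e ^+ 2 <= e1 by rewrite expr2 /e; nra.
pose lam := 1 + dl.
have l1 : 1 < lam by rewrite ltrDl.
have ll : lam - 1 = dl by rewrite /lam addrC addKr.
have h1 : {ae P, forall w, exists n0, forall n, (n0 <= n)%N -> X (lam ^+ n) w <= (1 + e1) * a (lam ^+ n)}.
  by apply: upper_grid => //; rewrite e10/=; lra.
have h2 := @upper_chain lam e l1 e0.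
rewrite ll Cdl in h2; have {}h2 := h2 _ _.
have {}h2 := h2 ltac:(lra) ltac:(lra).
have h3 := @occ_finite _ _ _ _ _ _ _ p_ge0 p_sum scheme j.
have [T0 [_ hT]] := mean_incr.
have near_facts : \forall t \near +oo, [/\ 0 < var t, 1 <= q t, expR 1 <= t & T0 < t].
  near=> t; split; near: t; [exact: var_gt0|exact: lnln_near_ge|exact: near_pinfty_ge|exact: near_pinfty_gt].
have [n3 hn3] := near_geometric l1 near_facts.
move: h1 h2 h3; apply: filterS3 => w [n1 hn1] [n2 hn2] fin.
near=> t.
pose n0 := maxn n1 (maxn n2 n3).
have tn0 : lam ^+ n0 <= t by near: t; exact: near_pinfty_ge.
have [n nn /andP[sn st]] := geometric_bracket l1 tn0.
move: nn; rewrite /n0 !geq_max => /and3P[nn1 nn2 nn3].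
have [v0 q1 se sT] := hn3 n nn3.
have {hn1}g1 := hn1 n nn1.
have {hn2}g2 := hn2 n nn2 fin t sn.
set s := lam ^+ n in sn st v0 q1 se sT g1 g2.
have q0 : 0 < q s by exact: lt_le_trans q1.
have s0 : 0 < s by exact: lt_le_trans (expR_gt0 _) se.
have tls : t <= lam * s by rewrite /s -exprS ltW.
have {}g2 := g2 tls.
have [a0 S0 a2 vS Sa] := scale_facts v0 q0.
have qq : q s <= q t by exact: lnln_ndecr.
have vv : (1 - e1) * var s <= var t.
  have := poisson_var_increment p_ge0 p_sum j (ltW s0) sn.
  have hm := hT s sT t sn.
  have hd : C * ((t - s) / s) * var s <= e1 * var s.
    rewrite ler_pM2r//; apply: (@le_trans _ _ (C * dl)); last by rewrite Cdl; lra.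
    rewrite ler_pM2l// ler_pdivrMr//; rewrite /lam in tls; lra.
  by rewrite ler_norml => /andP[h _]; lra.
have as_at : a s <= (1 + e1) * a t.
  have p1 : 0 <= 1 + e1 by lra.
  have -> : (1 + e1) * a t = Num.sqrt ((1 + e1) ^+ 2 * (2 * var t * q t)).
    by rewrite [RHS]sqrtrM ?sqr_ge0// sqrtr_sqr ger0_norm.
  rewrite ler_sqrt; last first.
    have vt0 : 0 <= var t by apply: le_trans vv; apply: mulr_ge0; [lra|exact: ltW].
    have qt0 : 0 <= q t by apply: le_trans qq; exact: ltW.
    by apply: mulr_ge0; [exact: sqr_ge0|apply: mulr_ge0 => //; exact: mulr_ge0].
  have c1 : 1 <= (1 + e1) ^+ 2 * (1 - e1) by rewrite expr2; nra.
  have c2 : var s <= (1 + e1) ^+ 2 * var t.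
    apply: (@le_trans _ _ ((1 + e1) ^+ 2 * ((1 - e1) * var s))); last by rewrite ler_wpM2l ?sqr_ge0.
    by rewrite mulrA ler_peMl// ltW.
  have -> : (1 + e1) ^+ 2 * (2 * var t * q t) = 2 * ((1 + e1) ^+ 2 * var t) * q t by ring.
  apply: ler_pM => //; [by rewrite mulr_ge0// ltW|exact: ltW|by rewrite ler_pM2l].
have g3 : X t w <= (1 + 2 * e1) * a s by rewrite /e in g2; lra.
apply: (le_trans g3); apply: (@le_trans _ _ ((1 + 2 * e1) * ((1 + e1) * a t))).
  by rewrite ler_pM2l//; lra.
rewrite mulrA ler_wpM2r ?sqrtr_ge0//; nra.
Unshelve. all: by end_near. Qed.

End upper_half.

(** * Lower half of the law of the iterated logarithm *)
Lemma harmonic_lower_diverges {R : realType} (h : R) (n0 : nat) : 0 < h -> (0 < n0)%N ->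
  series (fun n : nat => expR (- ln ((n0 + n)%:R * h))) @ \oo --> +oo.
Proof.
move=> h0 n00.
have p0 n : 0 < (n0 + n)%:R :> R by rewrite ltr0n addn_gt0 n00.
have step n : h^-1 * (ln (n0 + n.+1)%:R - ln (n0 + n)%:R) <= expR (- ln ((n0 + n)%:R * h)).
  rewrite expRN lnK ?posrE ?mulr_gt0// invfM mulrC ler_wpM2r ?invr_ge0 ?(ltW h0)//.
  rewrite -ln_div ?posrE// addnS -natr1 mulrDl mulfV ?lt0r_neq0// mul1r.
  by apply: le_ln1Dx; apply: (@lt_trans _ _ 0); rewrite ?oppr_lt0 ?invr_gt0.
have lower n : h^-1 * (ln (n0 + n)%:R - ln n0%:R) <= series (fun n : nat => expR (- ln ((n0 + n)%:R * h))) n.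
  rewrite /series/= big_mkord; elim: n => [|n IH]; first by rewrite addn0 subrr mulr0 big_ord0.
  by rewrite big_ord_recr/=; have := step n; move: IH; rewrite !mulrBr; lra.
apply/cvgryPge => A.
exists (Num.truncn (expR (A * h + ln n0%:R))).+1 => // n /= hn.
apply: le_trans (lower n); rewrite mulrC ler_pdivlMr// lerBrDr.
rewrite -[leLHS]expRK ler_ln ?posrE ?expR_gt0//.
apply: le_trans (ltW (truncnS_gt _)) _; rewrite ler_nat; apply: leq_trans hn _.
exact: leq_addl.
Qed.

Section restricted_events.
Context {R : realType} {d : measure_display} {T : measurableType d}
  (P : probability T R) (F : nat -> set_system T).
Hypothesis F_measurable : forall i, F i `<=` measurable.
Variable D : nat -> set T.
Hypothesis DF : forall k, <<s block F [set k] >> (D k).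

(** The events outside S are emptied rather than discarded, which keeps
    sequences indexed by all boxes. *)
Definition restrict_events (S : set nat) k : set T := [set w | S k /\ D k w].

Lemma restrict_in (S : set nat) k : S k -> restrict_events S k = D k.
Proof. by move=> Sk; apply/seteqP; split => w; [case|split]. Qed.

Lemma restrict_out (S : set nat) k : ~ S k -> restrict_events S k = set0.
Proof. by move=> Sk; apply/seteqP; split => w //; case. Qed.

Lemma restrict_block (S : set nat) k : <<s block F [set k] >> (restrict_events S k).
Proof.
have [Sk|Sk] := pselect (S k); first by rewrite restrict_in.
by rewrite restrict_out//; exact: (@measurable0 _ (g_sigma_algebraType _)).
Qed.

Lemma restrict_block_self (S : set nat) k : <<s block F S >> (restrict_events S k).
Proof.
have [Sk|Sk] := pselect (S k); last first.
  by rewrite restrict_out//; exact: (@measurable0 _ (g_sigma_algebraType _)).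
have sub : [set k] `<=` S by move=> i ->.
by rewrite restrict_in//; apply: (sblockS sub); exact: DF.
Qed.

Lemma restrict_prob (S : set nat) k :
  event_prob P (restrict_events S) k = event_prob P D k * (k \in S)%:R.
Proof.
rewrite /event_prob; have [Sk|Sk] := pselect (S k).
  by rewrite restrict_in// mem_set// mulr1.
by rewrite restrict_out// memNset// mulr0 measure0.
Qed.

Lemma restrict_var (S : set nat) N :
  count_var P (restrict_events S) N =
  \sum_(k < N) event_prob P D k * (1 - event_prob P D k) * (nat_of_ord k \in S)%:R.
Proof.
apply: eq_bigr => k _; rewrite restrict_prob.
by case: (_ \in S); rewrite ?mulr1 ?mulr0 ?mul0r.
Qed.

Lemma event_count_finite (E : nat -> set T) N w : (forall k, (N <= k)%N -> E k = set0) ->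
  event_count E w = \sum_(k < N) \1_(E k) w :> R.
Proof.
move=> E0; have nE : ~ lim_sup_set E w.
  by move=> /(_ N I)[k /= Nk]; rewrite E0.
have [n hn] := event_count_partial (R := R) nE.
rewrite (hn _ (leq_maxl n N)).
rewrite -!(big_mkord xpredT (fun k => \1_(E k) w : R)) (@big_cat_nat _ _ _ N) ?leq_maxr//=.
rewrite [X in _ + X]big_nat [X in _ + X]big1 ?addr0// => k /andP[Nk _].
by rewrite E0// indicE in_set0.
Qed.

Lemma restricted_count_event (S : set nat) N (x : R) :
  <<s block F S >> [set w | x <= centred_count P (restrict_events S) N w].
Proof.
have mI k : @measurable_fun _ _ (g_sigma_algebraType (block F S)) (measurableTypeR R) setT
    (\1_(restrict_events S k) : T -> R).
  by apply: (@measurable_indic _ (g_sigma_algebraType (block F S))); exact: restrict_block_self.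
have mf : @measurable_fun _ _ (g_sigma_algebraType (block F S)) (measurableTypeR R) setT
    (centred_count P (restrict_events S) N).
  by apply: measurable_sum => k; apply: measurable_funB => //; exact: mI.
have := mf measurableT `[x, +oo[%classic (measurable_itv _).
rewrite setTI; rewrite (_ : _ @^-1` _ = [set w | x <= centred_count P (restrict_events S) N w])//.
by apply/seteqP; split => w /=; rewrite in_itv/= andbT.
Qed.

End restricted_events.

Section lower_half.
Context {R : realType} {d : measure_display} {T : measurableType d}
  (P : probability T R) (p : nat -> R)
  (xi : nat -> {RV P >-> R}) (box : nat -> {RV P >-> nat}).
Hypothesis p_ge0 : forall k, 0 <= p k.
Hypothesis p_sum : series p @ \oo --> (1 : R).
Hypothesis scheme : poissonized_Karlin_scheme p xi box.
Variable j : nat.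

Local Notation mean := (poisson_mean p j).
Local Notation var := (poisson_var p j).
Local Notation occ := (occ xi box j).
Local Notation X := (centred p xi box j).
Local Notation F := (few_balls_events xi box j.+1).
Local Notation q t := (ln (ln t)).
Local Notation a t := (Num.sqrt (2 * var t * q t)).
Local Notation S t := (Num.sqrt (var t / q t)).

Hypothesis var_window : forall eta : R, 0 < eta -> exists2 M : R, 1 < M &
  \forall t \near +oo,
    box_sum p (fun y => occupancy_var j.+1 y * (1 - shell M^-1 M y)) t <= eta * var t.
Hypothesis var_large : var t / q t @[t --> +oo] --> +oo.

Let F_measurable := @few_balls_events_measurable _ _ _ P xi box j.
Let F_setT := @few_balls_events_setT _ _ _ P xi box j.
Let F_setI := @few_balls_events_setI _ _ _ P xi box j.
Let F_indep : mutually_independent P F := few_balls_independent p_ge0 scheme (j := j.+1).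

Section window.
Variables (M eta ze : R).
Hypotheses (M1 : 1 < M) (eta0 : 0 < eta) (eta1 : eta <= 8^-1) (ze0 : 0 < ze) (etaze : eta <= ze ^+ 2 / 8).
Hypothesis window : \forall t \near +oo,
    box_sum p (fun y => occupancy_var j.+1 y * (1 - shell M^-1 M y)) t <= eta * var t.

Definition window_boxes t : set nat := [set k | M^-1 <= p k * t < M].

Let inner t := restrict_events (occ t) (window_boxes t).
Let outer t := restrict_events (occ t) (~` window_boxes t).

Let M0 : 0 < M. Proof. exact: lt_trans M1. Qed.

Lemma window_boxes_finite t : 0 < t -> exists N, forall k, (N <= k)%N -> ~ window_boxes t k.
Proof.
move=> t0; have : p k @[k --> \oo] --> (0 : R) by apply: cvg_series_cvg_0; apply/cvg_ex; exists 1.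
move/cvgrPdist_lt/(_ (M^-1 / t)); rewrite divr_gt0 ?invr_gt0// => /(_ isT)[N _ hN].
exists N => k /hN; rewrite sub0r normrN ger0_norm// ltr_pdivlMr// => h /andP[].
by rewrite leNgt h.
Qed.

Lemma window_boxes_disjoint n m : (n < m)%N ->
  window_boxes ((M ^+ 2) ^+ n) `&` window_boxes ((M ^+ 2) ^+ m) = set0.
Proof.
move=> nm; apply/seteqP; split => // k [/= /andP[h1 h2] /andP[h3 h4]].
have L1 : 1 <= M ^+ 2 by rewrite exprn_ege1// ltW.
have : M <= p k * (M ^+ 2) ^+ m.
  rewrite -(subnKC nm) exprD mulrA.
  apply: (@le_trans _ _ (p k * (M ^+ 2) ^+ n.+1)); last first.
    have h : 1 <= (M ^+ 2) ^+ (m - n.+1) by exact: exprn_ege1.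
    by apply: ler_peMr => //; apply: mulr_ge0 => //; apply: exprn_ge0; exact: sqr_ge0.
  rewrite exprSr mulrA; apply: (@le_trans _ _ (M^-1 * M ^+ 2)); last first.
    by rewrite ler_wpM2r ?sqr_ge0.
  by rewrite expr2 mulKf ?lt0r_neq0.
by rewrite leNgt h4.
Qed.

Lemma outer_var_le t N : 0 <= t -> count_var P (outer t) N <=
  box_sum p (fun y => occupancy_var j.+1 y * (1 - shell M^-1 M y)) t.
Proof.
move=> t0; rewrite /outer restrict_var.
have -> : \sum_(k < N) event_prob P (occ t) k * (1 - event_prob P (occ t) k) * (nat_of_ord k \in ~` window_boxes t)%:R =
    \sum_(k < N) (fun y => occupancy_var j.+1 y * (1 - shell M^-1 M y)) (p k * t).
  apply: eq_bigr => k _; rewrite (occ_prob p_ge0 scheme)//.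
  congr (_ * _).
    by rewrite /occupancy_var {2}/pois_above opprB [1 + _]addrC subrK mulrC.
  rewrite /shell; case: (boolP (M^-1 <= p k * t < M)) => h.
    by rewrite memNset ?subrr//= => /(_ h).
  by rewrite mem_set ?subr0//; apply/negP.
apply: box_sum_partial => //.
  apply: lin_bounded_le (occupancy_var_lin (R := R) j) => y y0.
  rewrite normrM ger0_norm ?occupancy_var_ge0// ler_piMr ?occupancy_var_ge0//.
  by rewrite /shell; case: andP => _; rewrite ?subrr ?normr0// subr0 normr1.
move=> y y0; rewrite mulr_ge0 ?occupancy_var_ge0// subr_ge0 /shell.
by case: andP.
Qed.

Lemma inner_outer_var t N : 0 <= t ->
  count_var P (inner t) N + count_var P (outer t) N = count_var P (occ t) N.
Proof.
move=> t0; rewrite /inner /outer !restrict_var -big_split/=; apply: eq_bigr => k _.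
rewrite -mulrDr in_setC; case: (_ \in _); rewrite /= ?addr0 ?add0r mulr1//.
Qed.

Lemma inner_var_ge t N : 0 <= t -> (forall k, (N <= k)%N -> ~ window_boxes t k) ->
  box_sum p (fun y => occupancy_var j.+1 y * (1 - shell M^-1 M y)) t <= eta * var t ->
  (1 - eta) * var t <= count_var P (inner t) N.
Proof.
move=> t0 hN hw.
have h : forall n, (N <= n)%N -> count_var P (inner t) n = count_var P (inner t) N.
  move=> n Nn; rewrite /inner !restrict_var.
  pose f k : R := event_prob P (occ t) k * (1 - event_prob P (occ t) k) * (k \in window_boxes t)%:R.
  rewrite -!(big_mkord xpredT f) (@big_cat_nat _ _ _ N)//=.
  rewrite [X in _ + X]big_nat [X in _ + X]big1 ?addr0// => k /andP[Nk _].
  by rewrite /f memNset ?mulr0//; exact: hN.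
have := occ_var_cvg p_ge0 p_sum scheme (j := j) t0 => cv.
suff : var t <= count_var P (inner t) N + eta * var t by lra.
apply: (cvgr_to_le cv); exists N => // n /= Nn.
rewrite -(inner_outer_var n t0) h// lerD2l; apply: le_trans hw; exact: outer_var_le.
Qed.

Lemma inner_var_le t N : 0 <= t -> count_var P (inner t) N <= var t.
Proof.
move=> t0; have cv := occ_var_cvg p_ge0 p_sum scheme (j := j) t0.
have hb k := @occ_block _ _ _ P xi box j t k t0.
apply: (@le_trans _ _ (count_var P (occ t) N)).
  rewrite -(inner_outer_var N t0) lerDl.
  by apply: (count_var_ge0 P F_measurable) => k; exact: restrict_block.
apply: (cvgr_to_ge cv); exists N => // n /= Nn.
rewrite /count_var -!(big_mkord xpredT (fun k => event_prob P (occ t) k * (1 - event_prob P (occ t) k))).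
rewrite (@big_cat_nat _ _ _ N 0 n)//= lerDl; apply: sumr_ge0 => k _.
exact: (event_var_ge0 P F_measurable hb).
Qed.

(** The boxes outside the window have variance at most eta times the total, so
    by Chernoff's bound they lower the count by more than ze * a with summable
    probability only. *)
Lemma outer_event : \forall t \near +oo, exists B : set T,
  [/\ measurable B, (P B <= (expR (- (2 * q t)))%:E)%E &
   forall w, ~ B w -> forall N, (forall k, (N <= k)%N -> ~ window_boxes t k) ->
     ~ lim_sup_set (occ t) w ->
     centred_count P (inner t) N w - ze * a t <= X t w].
Proof.
near=> t.
have v0 : 0 < var t by near: t; exact: var_gt0.
have q1 : 1 <= q t by near: t; exact: lnln_near_ge.
have q0 : 0 < q t by exact: lt_le_trans q1.
have t0 : 0 < t by near: t; exact: near_pinfty_gt.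
have Sl : 4 / ze <= S t by near: t; exact: var_over_q_large.
have hw : box_sum p (fun y => occupancy_var j.+1 y * (1 - shell M^-1 M y)) t <= eta * var t by near: t.
have [a0 S0 a2 vS Sa] := scale_facts v0 q0.
have hb k := @occ_block _ _ _ P xi box j t k (ltW t0).
have hob k : <<s block F [set k] >> (outer t k) by exact: restrict_block.
have [N hN] := window_boxes_finite t0.
pose mi := \sum_(k < N) event_prob P (inner t) k.
have io k : event_prob P (outer t) k = event_prob P (occ t) k - event_prob P (inner t) k.
  rewrite /outer /inner !restrict_prob in_setC; case: (_ \in _); rewrite /= ?mulr1 ?mulr0 ?subrr ?subr0//.
have inner0 k : (N <= k)%N -> inner t k = set0 by move=> /hN h; exact: restrict_out.
have cvo : series (event_prob P (outer t)) @ \oo --> mean t - mi.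
  have cv1 : series (event_prob P (inner t)) @ \oo --> mi.
    apply: cvg_near_cst; exists N => // n /= Nn.
    rewrite /series/= (@big_cat_nat _ _ _ N)//= /mi big_mkord.
    rewrite [X in _ + X]big_nat [X in _ + X]big1 ?addr0// => k /andP[Nk _].
    by rewrite /event_prob inner0// measure0.
  rewrite (_ : series _ = series (event_prob P (occ t)) \- series (event_prob P (inner t))).
    by apply: cvgB => //; apply: occ_mean_cvg => //; exact: ltW.
  by apply/funext => n; rewrite /series/= -sumrB; apply: eq_bigr => k _; exact: io.
(* This exponent makes th * ze * a at least 4 q, while th ^ 2 var is 16 q / ze
   ^ 2, which eta brings down to 2 q. *)
pose th := 4 / ze / S t.
have th0 : 0 < th by rewrite !divr_gt0.
have th1 : th <= 1 by rewrite /th ler_pdivrMr// mul1r.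
pose Y w := event_count (outer t) w - (mean t - mi).
pose B := [set w | 4 * q t < - th * Y w].
have mY : measurable_fun setT (fun w => - th * Y w).
  apply: measurable_funM => //; apply: measurable_funB => //.
  by apply: event_count_measurable => k; exact: (event_measurable F_measurable hob).
exists B; split.
- rewrite /B (_ : [set w | _] = (fun w => - th * Y w) @^-1` `]4 * q t, +oo[).
    rewrite -[Z in measurable Z]setTI.
    by apply: mY => //; exact: measurable_itv.
  by apply/seteqP; split => w /=; rewrite in_itv/= andbT.
- have th2 : `|- th| <= 1 by rewrite normrN ger0_norm ?(ltW th0).
  have hV n : count_var P (outer t) n <= eta * var t.
    by apply: le_trans hw; apply: outer_var_le; exact: ltW.
  apply: le_trans (event_count_chernoff F_measurable F_setT F_setI F_indep hob cvo _ hV th2) _.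
  rewrite lee_fin ler_expR normrN (ger0_norm (ltW th0)) sqrrN.
  suff : th ^+ 2 / 2 * (1 + th) * (eta * var t) <= 2 * q t by lra.
  apply: (@le_trans _ _ (th ^+ 2 * (eta * var t))).
    rewrite ler_wpM2r ?mulr_ge0 ?(ltW eta0) ?(ltW v0)//.
    by rewrite -mulrA ler_piMr ?sqr_ge0//; lra.
  have -> : th ^+ 2 * (eta * var t) = 16 * eta / ze ^+ 2 * q t.
    by rewrite {1}vS /th; move: (S t) S0 => s s0; field; rewrite !lt0r_neq0.
  have ez := etaze; rewrite ler_wpM2r ?(ltW q0)// ler_pdivrMr ?exprn_gt0//; lra.
move=> w; rewrite /B/= => /negP; rewrite -leNgt => hY N' hN' fin.
have -> : centred_count P (inner t) N' w = event_count (inner t) w - mi.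
  have e k : (N' <= k)%N -> inner t k = set0 by move=> /hN' h; exact: restrict_out.
  rewrite /centred_count sumrB -(event_count_finite w e); congr (_ - _).
  rewrite /mi; pose f k := event_prob P (inner t) k.
  have fN n n' : (n <= n')%N -> (forall k, (n <= k)%N -> inner t k = set0) -> \sum_(k < n') f k = \sum_(k < n) f k.
    move=> nn h; rewrite -!(big_mkord xpredT f) (@big_cat_nat _ _ _ n)//=.
    rewrite [X in _ + X]big_nat [X in _ + X]big1 ?addr0// => k /andP[nk _].
    by rewrite /f /event_prob h// measure0.
  by case/orP: (leq_total N N') => h; [rewrite (fN _ _ h inner0)|rewrite (fN _ _ h e)].
have hc : event_count (occ t) w = event_count (inner t) w + event_count (outer t) w :> R.
  rewrite (event_countD (D := inner t) (D' := occ t))//; last by move=> k x [].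
  congr (_ + event_count _ _); apply/funext => k; apply/seteqP; split => x /=.
    by move=> [ox nx]; split => // wk; apply: nx.
  by move=> [nk ox]; split => // -[].
have : - (ze * a t) <= Y w.
  have : - th * Y w <= th * (ze * a t).
    apply: le_trans hY _; rewrite /th.
    have -> : 4 / ze / S t * (ze * a t) = 4 * (a t / S t) by field; rewrite !lt0r_neq0.
    by rewrite ler_pM2l// ler_pdivlMr// mulrC.
  by rewrite mulNr -mulrN ler_pM2l// lerNl.
rewrite /centred hc /Y; lra.
Unshelve. all: by end_near. Qed.

Definition overshoot t N := [set w |
  (1 - eta) * ((1 - 4 * eta) * Num.sqrt (2 * q t / count_var P (inner t) N)) * count_var P (inner t) N
    <= centred_count P (inner t) N w].

(** Kolmogorov's bound at 1 - 4 eta times the natural exponent: the reduction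
    compensates the losses of that bound, so that the probability is at least
    exp (- q), which is not summable along a geometric sequence. *)
Lemma overshoot_prob : \forall t \near +oo, forall N,
  (forall k, (N <= k)%N -> ~ window_boxes t k) ->
  [/\ ((expR (- q t))%:E <= P (overshoot t N))%E &
   forall w, overshoot t N w -> (1 - 6 * eta) * a t <= centred_count P (inner t) N w].
Proof.
near=> t => N hN.
have e8 := eta1; have e0 := eta0.
have v0 : 0 < var t by near: t; exact: var_gt0.
have q1 : 16 * (8 / eta ^+ 2) <= q t by near: t; exact: lnln_near_ge.
have q0 : 0 < q t by apply: lt_le_trans q1; rewrite mulr_gt0// divr_gt0// exprn_gt0.
have t0 : 0 < t by near: t; exact: near_pinfty_gt.
have Sl : 2 * (8 / eta ^+ 2) <= S t by near: t; exact: var_over_q_large.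
have hw : box_sum p (fun y => occupancy_var j.+1 y * (1 - shell M^-1 M y)) t <= eta * var t by near: t.
have [a0 S0 a2 vS Sa] := scale_facts v0 q0.
have W1 := inner_var_ge (ltW t0) hN hw.
have W2 := inner_var_le N (ltW t0).
rewrite /overshoot; set W := count_var P (inner t) N in W1 W2 *.
have W3 : var t / 2 <= W by apply: le_trans W1; rewrite mulrC ler_pM2r//; lra.
have W0 : 0 < W by apply: lt_le_trans W3; rewrite divr_gt0.
have r0 : 0 < 2 * q t / W by rewrite divr_gt0// mulr_gt0.
(* r * W is the normalisation attached to the variance W of the window. *)
pose r := Num.sqrt (2 * q t / W).
have r00 : 0 < r by rewrite sqrtr_gt0.
have r2 : r ^+ 2 * W = 2 * q t by rewrite sqr_sqrtr ?(ltW r0)// mulfVK// lt0r_neq0.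
have e4 : 2^-1 <= 1 - 4 * eta by lra.
pose th := (1 - 4 * eta) * r.
have th0 : 0 < th by rewrite mulr_gt0//; lra.
have rS : r <= 2 / S t.
  rewrite -[leLHS]ger0_norm ?(ltW r00)// -[leRHS]ger0_norm ?divr_ge0 ?(ltW S0)//.
  rewrite -ler_sqr ?nnegrE ?normr_ge0// !real_normK ?num_real//.
  rewrite -(ler_pM2r W0) r2 expr_div_n.
  have key (s v : R) : v = s ^+ 2 * q t -> 0 < s -> 2 * q t = 2 ^+ 2 / s ^+ 2 * (v / 2).
    by move=> -> s0; field; rewrite lt0r_neq0.
  by rewrite (key _ _ vS S0) ler_wpM2l// divr_ge0 ?sqr_ge0.
have th1 : th <= eta ^+ 2 / 8.
  apply: (@le_trans _ _ r); first by rewrite /th ler_piMl ?(ltW r00)//; lra.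
  apply: le_trans rS _; rewrite ler_pdivrMr//.
  rewrite -ler_pdivrMl ?divr_gt0 ?exprn_gt0// invf_div mulrC.
  exact: Sl.
have thW : th ^+ 2 * W = (1 - 4 * eta) ^+ 2 * (2 * q t) by rewrite exprMn -mulrA r2.
have th2 : 8 <= th ^+ 2 * W * eta ^+ 2.
  rewrite thW.
  have : 16 * 8 <= q t * eta ^+ 2.
    by move: q1; rewrite mulrA ler_pdivrMr ?exprn_gt0.
  have : 4^-1 <= (1 - 4 * eta) ^+ 2 by rewrite expr2; nra.
  have -> : (1 - 4 * eta) ^+ 2 * (2 * q t) * eta ^+ 2 = (1 - 4 * eta) ^+ 2 * (2 * (q t * eta ^+ 2)) by ring.
  by move: ((1 - 4 * eta) ^+ 2) (q t * eta ^+ 2) => u z h1 h2; nra.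
have hb k : <<s block F [set k] >> (inner t k).
  by apply: restrict_block => i; apply: occ_block; exact: ltW.
have eta4 : 0 < eta <= 4^-1 by rewrite eta0/=; lra.
split.
  apply: le_trans (kolmogorov_lower F_measurable F_setT F_setI F_indep hb eta4 th0 th1 th2).
  rewrite lee_fin ler_expR lerN2 -/W thW.
  have -> : (1 - 4 * eta) ^+ 2 * (2 * q t) * (2^-1 + 2 * eta) = (1 - 4 * eta) ^+ 2 * (1 + 4 * eta) * q t.
    by field.
  rewrite ler_piMl ?(ltW q0)// expr2; nra.
move=> w /=; apply: le_trans.
rewrite -/r -mulrA -mulrA -mulrA.
have Wr : (1 - eta) * a t <= r * W.
  have e1 : 0 <= 1 - eta by lra.
  rewrite -ler_sqr ?nnegrE ?mulr_ge0 ?(ltW a0) ?(ltW r00) ?(ltW W0)//.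
  have -> : (r * W) ^+ 2 = 2 * q t * W by rewrite -r2; ring.
  rewrite exprMn a2.
  have h : (1 - eta) ^+ 2 * var t <= W.
    by apply: le_trans W1; rewrite ler_pM2r// expr2; nra.
  have := ler_wpM2r (ltW q0) h; lra.
apply: (@le_trans _ _ ((1 - eta) * ((1 - 4 * eta) * ((1 - eta) * a t)))).
  rewrite !mulrA ler_pM2r//; nra.
by rewrite ler_pM2l ?ler_pM2l//; lra.
Unshelve. all: by end_near. Qed.

(** The windows are disjoint, so their overshoots are independent and occur
    infinitely often; the boxes outside the windows eventually do not undo
    them. *)
Lemma lower_window : {ae P, forall w, forall n0, exists2 n, (n0 <= n)%N &
  (1 - 6 * eta - ze) * a ((M ^+ 2) ^+ n) <= X ((M ^+ 2) ^+ n) w}.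
Proof.
have L1 : 1 < M ^+ 2 by rewrite exprn_egt1.
set L := M ^+ 2.
have h3 := @occ_finite _ _ _ _ _ _ _ p_ge0 p_sum scheme j.
have L0 n : 0 < L ^+ n by rewrite exprn_gt0// (lt_trans ltr01).
have /choice[N hN] n : exists N, forall k, (N <= k)%N -> ~ window_boxes (L ^+ n) k.
  exact: window_boxes_finite.
have [n1 hn1] := near_geometric L1 overshoot_prob.
have h1 : {ae P, forall w, exists n0, forall n, (n0 <= n)%N -> ~ lim_sup_set (occ (L ^+ n)) w ->
    centred_count P (inner (L ^+ n)) (N n) w - ze * a (L ^+ n) <= X (L ^+ n) w}.
  apply: (@borel_cantelli_eventually _ _ _ P _ (fun n => expR (- ((1 + 1) * ln (n%:R * ln L))))).
  - have [n0 h] := near_geometric L1 outer_event.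
    exists n0 => n /h[B [mB PB hB]]; exists B; split => //.
      by rewrite -lnln_geometric.
    by move=> w nB fin; apply: hB => //; exact: hN.
  - by move=> n; exact: expR_ge0.
  - by apply: summable_iterated_log => //; exact: ln_gt0.
have h2 : {ae P, forall w, forall n, exists2 k, (n <= k)%N & overshoot (L ^+ (n1.+1 + k)) (N (n1.+1 + k)%N) w}.
  apply: (@borel_cantelli2 _ _ _ P F F_measurable F_setT F_setI F_indep
    (fun n => window_boxes (L ^+ (n1.+1 + n))) _ (fun n => expR (- ln ((n1.+1 + n)%:R * ln L)))).
  - by move=> n m nm; apply: window_boxes_disjoint; rewrite ltn_add2l.
  - move=> n; have hb k := @occ_block _ _ _ P xi box j (L ^+ (n1.+1 + n)) k (ltW (L0 _)).
    exact: (restricted_count_event P hb).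
  - move=> n; have n1n : (n1 <= n1.+1 + n)%N by rewrite addSn leqW// leq_addr.
    have [+ _] := hn1 _ n1n _ (hN _).
    by rewrite lnln_geometric.
  - by apply: harmonic_lower_diverges => //; exact: ln_gt0.
move: h1 h2 h3; apply: filterS3 => w [n2 hn2] hinf fin n0.
have [k nk ov] := hinf (maxn n0 n2); move: nk; rewrite geq_max => /andP[n0k n2k].
exists (n1.+1 + k)%N; first by rewrite (leq_trans n0k)// leq_addl.
have n1n : (n1 <= n1.+1 + k)%N by rewrite addSn leqW// leq_addr.
have [_ /(_ _ ov)] := hn1 _ n1n _ (hN _).
have := hn2 (n1.+1 + k)%N (leq_trans n2k (leq_addl _ _)) (fin _).
lra.
Qed.

End window.

Lemma lil_lower (ep : R) : 0 < ep ->
  {ae P, forall w, forall A : R, exists2 t, A <= t & (1 - ep) * a t <= X t w}.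
Proof.
move=> ep0; pose ze := Num.min ep 1 / 2.
have m0 : 0 < Num.min ep 1 by rewrite lt_min ep0 ltr01.
have ze0 : 0 < ze by rewrite divr_gt0.
have ze1 : ze <= 1 / 2 by rewrite ler_pM2r// ge_min lexx orbT.
have zee : ze <= ep / 2 by rewrite ler_pM2r// ge_min lexx.
pose eta := ze ^+ 2 / 8.
have eta0 : 0 < eta by rewrite divr_gt0// exprn_gt0.
have etaz : eta <= ze / 16 by rewrite /eta expr2; nra.
have [M M1 hM] := var_window eta0.
have := lower_window (M := M) (eta := eta) (ze := ze) M1 eta0 _ ze0 (lexx _) hM.
move=> /(_ ltac:(lra)); apply: filterS => w hw A.
have L1 : 1 < M ^+ 2 by rewrite expr2; nra.
have [n0 hn0] := near_geometric L1 (near_pinfty_ge A).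
have [n nn hn] := hw n0; exists ((M ^+ 2) ^+ n); first exact: hn0.
apply: le_trans hn; rewrite ler_wpM2r ?sqrtr_ge0//; lra.
Qed.

End lower_half.

(** * Uniform convergence for slowly varying functions *)
Section uniform_convergence.
Context {R : realType}.
Local Notation mu := (@lebesgue_measure R).
Variable h : measurableTypeR R -> measurableTypeR R.
Hypothesis mh : measurable_fun setT h.
Hypothesis h_slow : forall u : R, h (x + u) - h x @[x --> +oo] --> (0 : R).

Let near_shift (x : nat -> R) (e : R) n : set (measurableTypeR R) :=
  [set u | 0 <= u <= 2 /\ forall m, (n <= m)%N -> `|h (x m + u) - h (x m)| < e].

Let near_shift_measurable x e n : measurable (near_shift x e n).
Proof.
rewrite (_ : near_shift x e n = `[0, 2]%classic `&`
   \bigcap_(m in [set m | (n <= m)%N]) ((fun u => h (x m + u) - h (x m)) @^-1` `]- e, e[%classic)); last first.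
  apply/seteqP; split => u /=.
    by move=> [u2 hu]; split; [rewrite in_itv|move=> m /= /hu; rewrite in_itv/= ltr_norml].
  by move=> [+ hu]; rewrite in_itv/= => u2; split => // m nm; move: (hu m nm); rewrite /= in_itv/= ltr_norml.
apply: measurableI; first exact: measurable_itv.
apply: bigcap_measurable; first by exists n => /=.
move=> m _; rewrite -[X in measurable X]setTI.
have mf : measurable_fun setT (fun u => h (x m + u) - h (x m)).
  apply: measurable_funB => //; apply: (measurableT_comp mh).
  exact: measurable_funD.
by apply: mf => //; exact: measurable_itv.
Qed.

Let near_shift_large x e : x n @[n --> \oo] --> +oo -> 0 < e ->
  exists n0, forall n, (n0 <= n)%N -> ((3 / 2)%:E < mu (near_shift x e n))%E.
Proof.
move=> xoo e0.
have cup : \bigcup_n near_shift x e n = `[0, 2]%classic.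
  apply/seteqP; split => u /=; first by move=> [n _ [u2 _]]; rewrite in_itv.
  rewrite in_itv/= => u2.
  have /cvgrPdist_lt/(_ e e0) : h (x n + u) - h (x n) @[n --> \oo] --> (0 : R).
    exact: (cvg_comp _ _ xoo (h_slow u)).
  move=> [n _ hn]; exists n => //; split => // m nm.
  by have := hn m nm; rewrite sub0r normrN.
have : mu (near_shift x e n) @[n --> \oo] --> mu `[0, 2]%classic.
  rewrite -cup; apply: nondecreasing_cvg_mu => //.
    by rewrite cup; exact: measurable_itv.
  move=> n m nm; apply/subsetPset => u [u2 hu]; split => // k mk; apply: hu; exact: leq_trans mk.
rewrite lebesgue_measure_itv/= lte_fin ltr0n/= -EFinD subr0 => cv.
move/fine_cvgP : cv => [fin cv].
have lt2 : (3 / 2 : R) < 2 by rewrite ltr_pdivrMr//; lra.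
have [n _ hn] := cvgr_gt _ cv _ lt2; have [m _ hm] := fin.
exists (maxn n m) => k; rewrite geq_max => /andP[nk mk].
by rewrite -(fineK (hm k mk)) lte_fin; exact: hn.
Qed.

(** The argument of Csiszar and Erdos. If uniformity fails along x n and y n =
    x n + u n, then for large n the shifts that are good for x, and those that
    are good for y translated by u n, both fill more than 3 / 2 of [0, 3] in
    measure. A common point contradicts the lower bound on the difference of h
    at y n and x n. *)
Lemma uniform_slow_variation (e : R) : 0 < e ->
  exists X0 : R, forall x u, X0 <= x -> 0 <= u <= 1 -> `|h (x + u) - h x| < e.
Proof.
move=> e0; apply: contrapT => /forallNP no.
(* Counterexamples to uniformity, at arbitrarily large points. *)
have /choice[xu hxu] n : exists xu : R * R,
    [/\ n%:R <= xu.1, 0 <= xu.2 <= 1 & e <= `|h (xu.1 + xu.2) - h xu.1|].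
  have /existsNP[x /existsNP[u]] := no n%:R.
  rewrite not_implyE => -[nx]; rewrite not_implyE => -[u1 /negP]; rewrite -leNgt => eu.
  by exists (x, u).
pose x n := (xu n).1; pose y n := (xu n).1 + (xu n).2.
have xoo : x n @[n --> \oo] --> +oo.
  apply/cvgryPge => A; exists (Num.truncn A).+1 => // n /= nA.
  have [h1 _ _] := hxu n; apply: le_trans h1.
  by apply: le_trans (ltW (truncnS_gt A)) _; rewrite ler_nat.
have yoo : y n @[n --> \oo] --> +oo.
  apply/cvgryPge => A; move/cvgryPge/(_ A) : xoo; apply: filterS => n /= hA.
  by rewrite /y; have [_ /andP[h1 _] _] := hxu n; rewrite -/(x n); lra.
have e2 : 0 < e / 2 by rewrite divr_gt0.
have [n1 hV] := near_shift_large xoo e2.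
have [n2 hW] := near_shift_large yoo e2.
pose n := maxn n1 n2.
pose V := near_shift x (e / 2) n; pose W := near_shift y (e / 2) n.
pose W' : set (measurableTypeR R) := [set u | W (- (xu n).2 + u)].
have mV : measurable V by exact: near_shift_measurable.
have mW : measurable W by exact: near_shift_measurable.
have mW' : measurable W'.
  rewrite /W' -[X in measurable X]setTI.
  have mf : measurable_fun setT (fun u : measurableTypeR R => - (xu n).2 + u : measurableTypeR R).
    exact: measurable_funD.
  exact: mf.
have [_ /andP[u0 u1] hu] := hxu n.
have VW : V `&` W' = set0.
  apply/seteqP; split => // u [[u2 hVu] [w2 hWu]].
  have h1 := hVu n (leqnn n); have h2 := hWu n (leqnn n).
  have e1 : y n + (- (xu n).2 + u) = x n + u by rewrite /y /x; ring.
  rewrite e1 in h2.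
  have : e < e.
    apply: (le_lt_trans hu); rewrite [X in _ < X](splitr e).
    have -> : h ((xu n).1 + (xu n).2) - h (xu n).1 = (h (x n + u) - h (x n)) - (h (x n + u) - h (y n)).
      by rewrite /x /y; ring.
    by apply: le_lt_trans (ler_normB _ _) _; exact: ltrD.
  by rewrite ltxx.
have muW' : mu W' = mu W by rewrite /W' (lebesgue_measure_shift (- (xu n).2) mW).
have : (mu (V `|` W') <= 3%:E)%E.
  apply: (@le_trans _ _ (mu `[0, 3]%classic)).
    apply: le_measure; rewrite ?inE//; [exact: measurableU|].
    move=> u [[/andP[a b] _]|[/andP[a b] _]] /=; rewrite in_itv/=; apply/andP; split; lra.
  by rewrite lebesgue_measure_itv/= lte_fin ltr0n/= -EFinD subr0.
have -> : mu (V `|` W') = (mu V + mu W)%E by rewrite -muW'; exact: measureU.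
have := hV n (leq_maxl _ _); have := hW n (leq_maxr _ _).
rewrite -/V -/W; move: (mu V) (mu W) => [a| |] [b| |]//=.
rewrite !lte_fin -EFinD lee_fin; lra.
Qed.

(** Far out, a unit step changes h by at most e / 2. *)
Lemma slow_variation_sublinear : h x / x @[x --> +oo] --> (0 : R).
Proof.
apply/cvgrPdist_le => e e0.
have e2 : 0 < e / 2 by rewrite divr_gt0.
have [X0 hX] := uniform_slow_variation e2.
pose X1 := Num.max X0 0.
have X10 : X0 <= X1 by rewrite le_max lexx.
have X11 : 0 <= X1 by rewrite le_max lexx orbT.
have bound (n : nat) : forall s, 0 <= s <= 1 -> `|h (X1 + n%:R + s) - h X1| <= n.+1%:R * (e / 2).
  elim: n => [|n IH] s s01.
    by rewrite addr0 mul1r; apply/ltW; apply: hX.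
  have := IH 1; rewrite ler01 lexx => /(_ isT) h1.
  have h2 : `|h (X1 + n.+1%:R + s) - h (X1 + n.+1%:R)| < e / 2.
    by apply: hX => //; apply: le_trans X10 _; rewrite lerDl.
  have e1 : X1 + n%:R + 1 = X1 + n.+1%:R by rewrite -addrA natr1.
  rewrite e1 in h1.
  have -> : h (X1 + n.+1%:R + s) - h X1 = (h (X1 + n.+1%:R + s) - h (X1 + n.+1%:R)) + (h (X1 + n.+1%:R) - h X1).
    by ring.
  apply: le_trans (ler_normD _ _) _; rewrite -(natr1 n.+1) mulrDl mul1r addrC; lra.
have c0 : 0 <= 2 * (`|h X1| + e) / e + X1 + 1 by rewrite !addr_ge0// divr_ge0 ?(ltW e0)// mulr_ge0// addr_ge0// ltW.
near=> t.
have t1 : 2 * (`|h X1| + e) / e + X1 + 1 <= t by near: t; exact: near_pinfty_ge.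
have q0 : 0 <= 2 * (`|h X1| + e) / e by rewrite divr_ge0 ?(ltW e0)// mulr_ge0// addr_ge0// ltW.
have t0 : 0 < t by lra.
have tX : 0 <= t - X1 by lra.
have /andP[n1 n2] := truncn_itv tX.
set n := Num.truncn _ in n1 n2.
have s01 : 0 <= t - X1 - n%:R <= 1 by move: n2; rewrite -natr1; lra.
have := bound n _ s01.
have -> : X1 + n%:R + (t - X1 - n%:R) = t by ring.
move=> hb; rewrite sub0r normrN normrM [X in _ * X]ger0_norm ?invr_ge0 ?(ltW t0)//.
rewrite ler_pdivrMr//.
have h1 : `|h t| <= `|h X1| + n.+1%:R * (e / 2).
  have := ler_normD (h t - h X1) (h X1); rewrite subrK; lra.
have h2 : n.+1%:R * (e / 2) <= (t + 1) * (e / 2).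
  by rewrite ler_pM2r// -natr1 lerD2r; lra.
have h3 : 2 * (`|h X1| + e) <= t * e.
  by rewrite -ler_pdivrMr//; lra.
apply: (le_trans h1); apply: (le_trans (lerD (lexx _) h2)); lra.
Unshelve. all: by end_near. Qed.

End uniform_convergence.

Section slowly_varying.
Context {R : realType}.

(** In logarithmic scale slow variation says that the increments of h = ln o l
    o exp vanish at infinity; l is first cut off to an interval where it is
    measurable. *)
Lemma slowly_varying_ln (l : R -> R) : slowly_varying l ->
  ln (l x) / ln x @[x --> +oo] --> (0 : R).
Proof.
move=> [[A [ml l0]] hl].
pose g : R -> R := l \_ `]A, +oo[.
have mg : measurable_fun setT (g : measurableTypeR R -> measurableTypeR R).
  by apply/(measurable_restrictT l) => //; exact: measurable_itv.
pose h : measurableTypeR R -> measurableTypeR R := fun x => ln (g (expR x)).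
have mh : measurable_fun setT h.
  apply: (measurableT_comp (f := @ln R)) => //; apply: (measurableT_comp mg) => //.
have gE x : A < x -> g x = l x.
  by move=> Ax; rewrite /g /patch mem_set//= in_itv/= andbT.
have expoo : expR x @[x --> +oo] --> (+oo : set_system R).
  apply/cvgryPge => B; near=> x.
  have : B - 1 <= x by near: x; exact: near_pinfty_ge.
  by have := expR_ge1Dx x; lra.
have hs u : h (x + u) - h x @[x --> +oo] --> (0 : R).
  have cv : ln (l (expR u * t) / l t) @[t --> +oo] --> (0 : R).
    rewrite -(@ln1 R); apply: (cvg_comp _ _ (hl _ (expR_gt0 u))).
    exact: continuous_ln.
  apply: (near_cvg _ (cvg_comp _ _ expoo cv)).
  near=> x.
  have x1 : A < expR x by near: x; move/cvgryPgt : expoo; exact.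
  have x2 : A < expR u * expR x.
    by near: x; exact: (expoo _ (near_scale (expR_gt0 u) (near_pinfty_gt A))).
  rewrite /= /h expRD [expR x * expR u]mulrC !gE// ln_div ?posrE//; exact: l0.
have lnoo : ln x @[x --> +oo] --> (+oo : set_system R).
  apply/cvgryPge => B; near=> x.
  have : expR B <= x by near: x; exact: near_pinfty_ge.
  by move=> h1; rewrite -[leLHS]expRK ler_ln ?posrE ?expR_gt0// (lt_le_trans _ h1) ?expR_gt0.
have := cvg_comp _ _ lnoo (slow_variation_sublinear mh hs).
move=> cv; apply: (near_cvg _ cv); near=> x.
have x0 : 0 < x by near: x; exact: near_pinfty_gt.
have xA : A < x by near: x; exact: near_pinfty_gt.
by rewrite /= /h lnK ?posrE// gE.
Unshelve. all: by end_near. Qed.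

End slowly_varying.

(** * Growth of the auxiliary function *)
Section growth.
Context {R : realType}.
Local Notation q t := (ln (ln t)).
Implicit Types (E : R -> R).

Lemma ln_oo : ln t @[t --> +oo] --> (+oo : set_system R).
Proof.
apply/cvgryPge => B; near=> x.
have : expR B <= x by near: x; exact: near_pinfty_ge.
by move=> h1; rewrite -[leLHS]expRK ler_ln ?posrE ?expR_gt0// (lt_le_trans _ h1) ?expR_gt0.
Unshelve. all: by end_near. Qed.

Lemma expR_ge_sqr (y : R) : 0 <= y -> y ^+ 2 / 4 <= expR y.
Proof.
move=> y0; have h : 1 + y / 2 <= expR (y / 2) by exact: expR_ge1Dx.
have -> : expR y = expR (y / 2) ^+ 2 by rewrite -expRM_natl; congr expR; field.
have : 0 <= y / 2 by rewrite divr_ge0.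
have -> : y ^+ 2 / 4 = (y / 2) ^+ 2 by field.
by move=> h2; rewrite lerXn2r ?nnegrE ?expR_ge0//; lra.
Qed.

Lemma growth_over_q E (c : R) : 0 < c -> (\forall t \near +oo, 0 < E t) ->
  ln (E t) / q t @[t --> +oo] --> c -> E t / q t @[t --> +oo] --> +oo.
Proof.
move=> c0 E0 cv; have c2 : c / 2 < c by rewrite ltr_pdivrMr//; lra.
apply/cvgryPge => A; near=> t.
have q1 : 1 <= q t by near: t; exact: lnln_near_ge.
have q2 : A / (c ^+ 2 / 16) <= q t by near: t; exact: lnln_near_ge.
have q0 : 0 < q t by exact: lt_le_trans q1.
have Et : 0 < E t by near: t; exact: E0.
have : c / 2 <= ln (E t) / q t by near: t; exact: (cvgr_ge _ cv _ c2).
rewrite ler_pdivlMr// => h.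
have h0 : 0 <= c / 2 * q t by rewrite mulr_ge0 ?divr_ge0 ?(ltW c0) ?(ltW q0).
rewrite ler_pdivlMr//; apply: (@le_trans _ _ ((c / 2 * q t) ^+ 2 / 4)); last first.
  by apply: le_trans (expR_ge_sqr h0) _; rewrite -[leRHS]lnK ?posrE// ler_expR.
have -> : (c / 2 * q t) ^+ 2 / 4 = c ^+ 2 / 16 * q t * q t by field.
rewrite ler_pM2r//; move: q2; rewrite ler_pdivrMr ?divr_gt0 ?exprn_gt0//.
by rewrite mulrC.
Unshelve. all: by end_near. Qed.

Lemma over_q_oo E : E t / q t @[t --> +oo] --> +oo -> E t @[t --> +oo] --> +oo.
Proof.
move=> cv; apply/cvgryPge => A; near=> t.
have q1 : 1 <= q t by near: t; exact: lnln_near_ge.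
have q2 : A <= q t by near: t; exact: lnln_near_ge.
have q0 : 0 < q t by exact: lt_le_trans q1.
have : 1 <= E t / q t by near: t; move/cvgryPge : cv; exact.
by rewrite ler_pdivlMr// mul1r; exact: le_trans.
Unshelve. all: by end_near. Qed.

Lemma ln_ratio_cvg E E' (c : R) : 0 < c ->
  (\forall t \near +oo, 0 < E t) -> (\forall t \near +oo, 0 < E' t) ->
  E t / E' t @[t --> +oo] --> c -> ln (E t) - ln (E' t) @[t --> +oo] --> ln c.
Proof.
move=> c0 E0 E0' cv.
have h : ln (E t / E' t) @[t --> +oo] --> ln c.
  by apply: (cvg_comp _ _ cv); exact: continuous_ln.
by apply: (near_cvg _ h); near=> t; rewrite ln_div ?posrE//; near: t.
Unshelve. all: by end_near. Qed.

Lemma bounded_over_oo (f g : R -> R) (c : R) : f t @[t --> +oo] --> c ->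
  g t @[t --> +oo] --> +oo -> f t / g t @[t --> +oo] --> (0 : R).
Proof.
move=> fc goo; rewrite -(mulr0 c); apply: cvgM => //.
apply/gtr0_cvgV0; last exact: goo.
by move/cvgryPgt : goo; exact.
Qed.

(** An equivalence up to a constant changes the logarithm by a bounded
    quantity, which ln (ln t) absorbs. *)
Lemma ln_growth_equiv E E' (beta c : R) : 0 < c ->
  (\forall t \near +oo, 0 < E t) -> (\forall t \near +oo, 0 < E' t) ->
  E t / E' t @[t --> +oo] --> c -> ln (E' t) / q t @[t --> +oo] --> beta ->
  ln (E t) / q t @[t --> +oo] --> beta.
Proof.
move=> c0 E0 E0' cv cv'.
have h := bounded_over_oo (ln_ratio_cvg c0 E0 E0' cv) lnln_oo.
rewrite -[beta]add0r; apply: (near_cvg _ (cvgD h cv')).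
by apply: nearW => t; rewrite /= -mulrDl subrK.
Qed.

Lemma log_power_growth_ln (ell l : R -> R) (beta : R) : log_power_growth ell beta l ->
  (\forall t \near +oo, 0 < ell t) -> ln (ell t) / q t @[t --> +oo] --> beta.
Proof.
move=> [b0 sl ae] ell0.
have [[A [_ l0]] _] := sl.
have sv := cvg_comp _ _ ln_oo (slowly_varying_ln sl).
pose E' t := ln t `^ beta * l (ln t).
have E0' : \forall t \near +oo, 0 < E' t.
  near=> t; have : Num.max 0 A < ln t by near: t; move/cvgryPgt : ln_oo; exact.
  rewrite gt_max => /andP[h1 h2]; rewrite /E' mulr_gt0 ?powR_gt0//; exact: l0.
apply: (ln_growth_equiv ltr01 ell0 E0' ae).
rewrite -[beta]addr0; apply: (near_cvg _ (cvgD (cvg_cst beta) sv)).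
near=> t.
have : Num.max 1 A < ln t by near: t; move/cvgryPgt : ln_oo; exact.
rewrite gt_max => /andP[h1 h2].
have h0 : 0 < ln t by exact: lt_trans h1.
have q0 : q t != 0 by rewrite lt0r_neq0// ln_gt0.
rewrite /= /E' lnM ?posrE ?powR_gt0//; last exact: l0.
by rewrite ln_powR mulrDl mulfK.
Unshelve. all: by end_near. Qed.

(** ln_growth_equiv applies to ln E, and ln (sig * ln t `^ lam) is ln sig +
    lam * ln (ln t). *)
Lemma growth_exp_log E (sig lam : R) : 0 < sig -> 0 < lam ->
  (\forall t \near +oo, 0 < E t) ->
  ln (E t) / (sig * ln t `^ lam) @[t --> +oo] --> (1 : R) ->
  ln (ln (E t)) / q t @[t --> +oo] --> lam /\ E t / q t @[t --> +oo] --> +oo.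
Proof.
move=> s0 l0 E0 cv.
have lnE0 : \forall t \near +oo, 0 < ln (E t).
  near=> t.
  have h0 : 0 < ln t by near: t; move/cvgryPgt : ln_oo; exact.
  have : 0 < ln (E t) / (sig * ln t `^ lam) by near: t; exact: (cvgr_gt _ cv _ ltr01).
  by rewrite pmulr_lgt0// invr_gt0 mulr_gt0// powR_gt0.
have F0 : \forall t \near +oo, 0 < sig * ln t `^ lam.
  near=> t; have h0 : 0 < ln t by near: t; move/cvgryPgt : ln_oo; exact.
  by rewrite mulr_gt0// powR_gt0.
have cvF : ln (sig * ln t `^ lam) / q t @[t --> +oo] --> lam.
  have hs : ln sig / q t @[t --> +oo] --> (0 : R).
    by apply: (bounded_over_oo (c := ln sig)); [exact: cvg_cst|exact: lnln_oo].
  rewrite -[lam in _ --> lam]add0r; apply: (near_cvg _ (cvgD hs (cvg_cst lam))).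
  near=> t; have h0 : 1 < ln t by near: t; move/cvgryPgt : ln_oo; exact.
  have q0 : q t != 0 by rewrite lt0r_neq0// ln_gt0.
  have h1 : 0 < ln t by exact: lt_trans h0.
  have -> : ln (sig * ln t `^ lam) = ln sig + lam * q t by rewrite lnM ?posrE ?powR_gt0// ln_powR.
  by rewrite mulrDl mulfK.
have h := ln_growth_equiv ltr01 lnE0 F0 cv cvF.
split => //.
have h2 := growth_over_q l0 lnE0 h.
apply/cvgryPge => A; near=> t.
have q1 : 1 <= q t by near: t; exact: lnln_near_ge.
have q2 : A * 4 <= q t by near: t; exact: lnln_near_ge.
have q0 : 0 < q t by exact: lt_le_trans q1.
have Et : 0 < E t by near: t.
have : 1 <= ln (E t) / q t by near: t; move/cvgryPge : h2; exact.
rewrite ler_pdivlMr// mul1r => h3.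
rewrite ler_pdivlMr//; apply: (@le_trans _ _ (q t ^+ 2 / 4)).
  by rewrite expr2; nra.
by apply: le_trans (expR_ge_sqr (ltW q0)) _; rewrite -[leRHS]lnK ?posrE// ler_expR.
Unshelve. all: by end_near. Qed.

Lemma limf_esup_eq (f : R -> R) (s : R) :
  (forall c, s < c -> \forall t \near +oo, f t <= c) ->
  (forall c, c < s -> forall A, exists2 t, A <= t & c <= f t) ->
  limf_esup (fun t => (f t)%:E) +oo = s%:E.
Proof.
move=> hu hl; rewrite limf_esupE; apply/eqP; rewrite eq_le; apply/andP; split.
  apply/lee_addgt0Pr => e e0.
  have h : \forall t \near +oo, f t <= s + e by apply: hu; rewrite ltrDl.
  apply: (@le_trans _ _ (ereal_sup ((fun t => (f t)%:E) @` [set t | f t <= s + e]))).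
    by apply: ereal_inf_lbound; exists [set t | f t <= s + e].
  by apply: ge_ereal_sup => _ [t /= ft <-]; rewrite -EFinD lee_fin.
apply: le_ereal_inf_tmp => _ [V [A [_ AV]] <-].
apply/lee_subgt0Pr => e e0.
have [|t At ft] := hl (s - e) _ (A + 1); first by rewrite gtrBl.
apply: (@le_trans _ _ (f t)%:E); first by rewrite -EFinB lee_fin.
by apply: ereal_sup_ubound; exists t => //; apply: AV; apply: lt_le_trans At; rewrite ltrDl.
Qed.

Lemma sqrt_cvg (F : set_system R) (f : R -> R) (c : R) : Filter F -> 0 < c ->
  f x @[x --> F] --> c -> Num.sqrt (f x) @[x --> F] --> Num.sqrt c.
Proof.
move=> FF c0 cv; apply: (cvg_comp _ _ cv); exact: sqrt_continuous.
Qed.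

(** If D t is asymptotic to c ln (ln t), the ratio of the normalisations tends
    to the square root of 2 / c. Countably many bounds determine the upper
    limit, which is what almost sure statements provide. *)
Lemma limsup_renormalise (X v D f : R -> R) (c : R) : 0 < c ->
  (\forall t \near +oo, 0 < v t) -> D t / q t @[t --> +oo] --> c ->
  (forall n : nat, \forall t \near +oo, X t <= (1 + n.+1%:R^-1) * Num.sqrt (2 * v t * q t)) ->
  (forall n : nat, forall A, exists2 t, A <= t & (1 - n.+1%:R^-1) * Num.sqrt (2 * v t * q t) <= X t) ->
  (\forall t \near +oo, f t = X t / Num.sqrt (v t * D t)) ->
  limf_esup (fun t => (f t)%:E) +oo = (Num.sqrt (2 / c))%:E.
Proof.
move=> c0 v0 Dc hu hl fE.
set s := Num.sqrt (2 / c).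
have s0 : 0 < s by rewrite sqrtr_gt0 divr_gt0.
have D0 : \forall t \near +oo, 0 < D t.
  near=> t.
  have q1 : 1 <= q t by near: t; exact: lnln_near_ge.
  have q0 : 0 < q t by exact: lt_le_trans q1.
  have : 0 < D t / q t by near: t; exact: (cvgr_gt _ Dc _ c0).
  by rewrite pmulr_lgt0// invr_gt0.
have rs : Num.sqrt (2 * v t * q t) / Num.sqrt (v t * D t) @[t --> +oo] --> s.
  have c2 : 0 < 2 / c by rewrite divr_gt0.
  have h1 : 2 / (D t / q t) @[t --> +oo] --> 2 / c.
    by apply: cvgM; [exact: cvg_cst|apply: cvgV => //; exact: lt0r_neq0].
  apply: (near_cvg _ (sqrt_cvg _ c2 h1)); near=> t.
  have q1 : 1 <= q t by near: t; exact: lnln_near_ge.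
  have q0 : 0 < q t by exact: lt_le_trans q1.
  have vt : 0 < v t by near: t.
  have Dt : 0 < D t by near: t.
  have g0 : 0 < v t * D t by rewrite mulr_gt0.
  apply: (@mulIf _ (Num.sqrt (v t * D t))); first by rewrite lt0r_neq0// sqrtr_gt0.
  rewrite mulfVK; last by rewrite lt0r_neq0// sqrtr_gt0.
  rewrite -sqrtrM; last by rewrite divr_ge0// divr_ge0 ?(ltW Dt) ?(ltW q0).
  by congr Num.sqrt; field; rewrite !lt0r_neq0.
have near_f (e : R) : 0 < e -> \forall t \near +oo,
   [/\ 0 < Num.sqrt (v t * D t), f t = X t / Num.sqrt (v t * D t),
       Num.sqrt (2 * v t * q t) / Num.sqrt (v t * D t) <= s + e &
       s - e <= Num.sqrt (2 * v t * q t) / Num.sqrt (v t * D t)].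
  move=> e0; near=> t; split.
  - by rewrite sqrtr_gt0 mulr_gt0//; near: t.
  - by near: t.
  - by near: t; apply: (cvgr_le _ rs); rewrite ltrDl.
  - by near: t; apply: (cvgr_ge _ rs); rewrite gtrBl.
have small (b : R) : 0 < b -> exists n : nat, n.+1%:R^-1 * (2 + s) <= b.
  move=> b0; have [n hn] := exists_inv_le (2 + s) b0.
  by exists n; rewrite mulrC.
have inv1 (n : nat) : (0 < n.+1%:R^-1 :> R) && (n.+1%:R^-1 <= 1 :> R).
  by rewrite invr_gt0 ltr0n/= invf_le1// ler1n.
apply: limf_esup_eq => b hb.
  have key (i : R) : 0 < i -> i <= 1 -> i * (2 + s) <= b - s -> (1 + i) * (s + i) <= b.
    by move=> *; nra.
  have [|n hn] := small (b - s); first by rewrite subr_gt0.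
  have /andP[i0 i1] := inv1 n.
  near=> t.
  have [g0 -> r1 _] : [/\ 0 < Num.sqrt (v t * D t), f t = X t / Num.sqrt (v t * D t),
       Num.sqrt (2 * v t * q t) / Num.sqrt (v t * D t) <= s + n.+1%:R^-1 &
       s - n.+1%:R^-1 <= Num.sqrt (2 * v t * q t) / Num.sqrt (v t * D t)].
    by near: t; exact: near_f.
  have hX : X t <= (1 + n.+1%:R^-1) * Num.sqrt (2 * v t * q t) by near: t; exact: hu.
  apply: (@le_trans _ _ ((1 + n.+1%:R^-1) * (Num.sqrt (2 * v t * q t) / Num.sqrt (v t * D t)))).
    by rewrite mulrA ler_pM2r ?invr_gt0.
  apply: (@le_trans _ _ ((1 + n.+1%:R^-1) * (s + n.+1%:R^-1))).
    by rewrite ler_wpM2l// addr_ge0// ltW.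
  exact: key.
move=> A.
have [|n hn] := small (s - b); first by rewrite subr_gt0.
have /andP[i0 i1] := inv1 n.
have [T [_ hT]] := near_f _ i0.
have [t At hX] := hl n (Num.max A (T + 1)).
move: At; rewrite ge_max => /andP[At Tt].
have [|g0 fE' _ r1] := hT t; first by apply: lt_le_trans Tt; rewrite ltrDl.
exists t => //; rewrite fE'.
apply: (@le_trans _ _ ((1 - n.+1%:R^-1) * (Num.sqrt (2 * v t * q t) / Num.sqrt (v t * D t)))); last first.
  by rewrite mulrA ler_pM2r ?invr_gt0.
apply: (@le_trans _ _ ((1 - n.+1%:R^-1) * (s - n.+1%:R^-1))); last first.
  by rewrite ler_wpM2l// subr_ge0.
by move: (n.+1%:R^-1) i0 i1 hn => i; nra.
Unshelve. all: by end_near. Qed.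

End growth.

(** * Almost sure and moment asymptotics *)
Section ae_countable.
Context {R : realType} {d : measure_display} {T : measurableType d}
  (P : probability T R).

Lemma ae_all_nat (Q : nat -> T -> Prop) :
  (forall n, {ae P, forall w, Q n w}) -> {ae P, forall w, forall n, Q n w}.
Proof.
move=> h; have : P.-negligible (\bigcup_n ~` [set w | Q n w]).
  by apply: negligible_bigcup => n; exact: h.
apply: negligibleS => w /= /existsNP[n hn]; by exists n.
Qed.

End ae_countable.

Section karlin_lil.
Context {R : realType} {d : measure_display} {T : measurableType d}
  (P : probability T R) (p : nat -> R)
  (xi : nat -> {RV P >-> R}) (box : nat -> {RV P >-> nat}) (ell : R -> R).
Hypothesis p_dist : infinite_distribution p.
Hypothesis scheme : poissonized_Karlin_scheme p xi box.
Hypothesis pi_ell : de_Haan_Pi ell (counting_function p).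

Lemma distribution_ge0 k : 0 <= p k. Proof. by case: p_dist. Qed.

Lemma distribution_sum : series p @ \oo --> (1 : R).
Proof.
have [p0 p1 _] := p_dist.
have : (\sum_(0 <= k < n) (p k)%:E)%E @[n --> \oo] --> (1%:E : \bar R).
  rewrite -p1; apply: is_cvg_nneseries => n _ _; rewrite lee_fin; exact: p0.
rewrite (_ : (fun n => _) = EFin \o series p).
  by move/fine_cvgP => [_].
by apply/funext => n; rewrite /series/= -sumEFin.
Qed.

Let p_ge0 := distribution_ge0.
Let p_sum := distribution_sum.

Section moments.
Hypothesis ell_oo : ell t @[t --> +oo] --> +oo.
Variable j : nat.

Lemma mean_occupied_equiv : asymp_equiv (mean_occupied xi box j.+1) (counting_function p).
Proof.
apply: (near_cvg _ (poisson_mean_equiv p_ge0 p_sum pi_ell ell_oo j)).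
near=> t; have t0 : 0 <= t by near: t; exact: near_pinfty_ge.
by rewrite (mean_occupiedE p_ge0 p_sum scheme).
Unshelve. all: by end_near. Qed.

Lemma var_occupied_equiv :
  asymp_equiv (var_occupied xi box j.+1) (fun t => variance_constant j.+1 * ell t).
Proof.
have c0 := variance_constant_gt0 p_ge0 p_sum pi_ell ell_oo j.
rewrite /asymp_equiv -(mulVf (lt0r_neq0 c0)).
apply: (near_cvg _ (cvgM (cvg_cst _) (@poisson_var_equiv _ _ _ p_ge0 p_sum pi_ell ell_oo j))).
near=> t; have t0 : 0 <= t by near: t; exact: near_pinfty_ge.
by rewrite (var_occupiedE p_ge0 p_sum scheme)// invfM mulrCA mulrA mulrC mulrA.
Unshelve. all: by end_near. Qed.

Variables (D : R -> R) (c : R).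
Hypotheses (c0 : 0 < c) (Dc : D t / ln (ln t) @[t --> +oo] --> c).
Hypothesis var_large : poisson_var p j t / ln (ln t) @[t --> +oo] --> +oo.
Variable V : R -> R.
Hypothesis VD : forall t, 0 <= t -> V t = poisson_var p j t * D t.

Lemma occupancy_limsup : {ae P, forall w,
  limf_esup (fun t => ((occupied_boxes xi box j.+1 t w - mean_occupied xi box j.+1 t) /
    Num.sqrt (V t))%:E) +oo = (Num.sqrt (2 / c))%:E}.
Proof.
have [C C0 mi] := poisson_mean_increment p_ge0 p_sum pi_ell ell_oo j.
have i0 (n : nat) : 0 < n.+1%:R^-1 :> R by rewrite invr_gt0.
have hu := ae_all_nat (fun n => lil_upper p_ge0 p_sum scheme C0 mi var_large (i0 n)).
have hl := ae_all_nat (fun n => lil_lower p_ge0 p_sum scheme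
  (poisson_var_window p_ge0 p_sum pi_ell ell_oo j) var_large (i0 n)).
move: hu hl; apply: filterS2 => w hu hl.
apply: (limsup_renormalise c0 (poisson_var_gt0 p_ge0 p_sum pi_ell ell_oo j) Dc hu hl).
near=> t; have t0 : 0 <= t by near: t; exact: near_pinfty_ge.
by rewrite VD// (mean_occupiedE p_ge0 p_sum scheme)// occupied_boxesE.
Unshelve. all: by end_near. Qed.

End moments.

Lemma poisson_var_ln (j : nat) : ell t @[t --> +oo] --> +oo ->
  ln (poisson_var p j t) - ln (ell t) @[t --> +oo] --> ln (variance_constant j.+1 : R).
Proof.
move=> ell_oo; apply: ln_ratio_cvg.
- exact: (variance_constant_gt0 p_ge0 p_sum pi_ell ell_oo j).
- exact: (poisson_var_gt0 p_ge0 p_sum pi_ell ell_oo j).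
- exact: (ell_gt0 pi_ell).
- exact: (@poisson_var_equiv _ _ _ p_ge0 p_sum pi_ell ell_oo j).
Qed.

Lemma log_power_ell_oo beta l : log_power_growth ell beta l -> ell t @[t --> +oo] --> +oo.
Proof.
move=> gr; have b0 : 0 < beta by case: gr.
have e0 := ell_gt0 pi_ell.
exact: (over_q_oo (growth_over_q b0 e0 (log_power_growth_ln gr e0))).
Qed.

Lemma exp_log_ell_ln sigma lam : exp_log_growth ell sigma lam ->
  ln (ell t) - sigma * ln t `^ lam @[t --> +oo] --> (0 : R).
Proof.
move=> [s0 /andP[l0 l1] ae]; rewrite -(@ln1 R).
have e0 := ell_gt0 pi_ell.
have E0 : \forall t \near +oo, 0 < expR (sigma * ln t `^ lam) by apply: nearW => t; exact: expR_gt0.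
apply: (near_cvg _ (ln_ratio_cvg ltr01 e0 E0 ae)); apply: nearW => t.
by rewrite expRK.
Qed.

Lemma power_ln_oo (sigma lam : R) : 0 < sigma -> 0 < lam ->
  sigma * ln t `^ lam @[t --> +oo] --> (+oo : set_system R).
Proof.
move=> s0 l0; apply/cvgryPge => A; near=> t.
have h0 : 0 < ln t by near: t; move/cvgryPgt : (@ln_oo R); exact.
have q1 : ln (Num.max 1 (A / sigma)) / lam <= ln (ln t) by near: t; exact: lnln_near_ge.
have m0 : 0 < Num.max 1 (A / sigma) by rewrite lt_max ltr01.
rewrite mulrC -ler_pdivrMr//; apply: (@le_trans _ _ (Num.max 1 (A / sigma))).
  by rewrite le_max lexx orbT.
by rewrite -ler_ln ?posrE ?powR_gt0// ln_powR [leRHS]mulrC -ler_pdivrMr.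
Unshelve. all: by end_near. Qed.

Lemma exp_log_ratio (E : R -> R) (sigma lam b : R) : exp_log_growth ell sigma lam ->
  ln (E t) - ln (ell t) @[t --> +oo] --> b ->
  ln (E t) / (sigma * ln t `^ lam) @[t --> +oo] --> (1 : R).
Proof.
move=> gr Eb; have [s0 /andP[l0 l1] _] := gr.
have h : (ln (E t) - ln (ell t) + (ln (ell t) - sigma * ln t `^ lam)) / (sigma * ln t `^ lam) @[t --> +oo] --> (0 : R).
  exact: (bounded_over_oo (cvgD Eb (exp_log_ell_ln gr)) (power_ln_oo s0 l0)).
have e : 1 = 0 + 1 :> R by rewrite add0r.
rewrite e; apply: (near_cvg _ (cvgD h (cvg_cst (1 : R)))); near=> t.
have h0 : 0 < ln t by near: t; move/cvgryPgt : (@ln_oo R); exact.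
by rewrite /=; field; rewrite !lt0r_neq0// powR_gt0.
Unshelve. all: by end_near. Qed.

Lemma exp_log_ell_oo sigma lam : exp_log_growth ell sigma lam -> ell t @[t --> +oo] --> +oo.
Proof.
move=> gr; have [s0 /andP[l0 l1] _] := gr.
have e0 := ell_gt0 pi_ell.
have h : ln (ell t) - ln (ell t) @[t --> +oo] --> (0 : R).
  by apply: cvg_near_cst; apply: nearW => t; rewrite subrr.
have [_ h2] := growth_exp_log s0 l0 e0 (exp_log_ratio gr h).
exact: over_q_oo h2.
Qed.

End karlin_lil.

Unset Implicit Arguments.
Set Strict Implicit.

Theorem theorem4p1 (R : realType) (d : measure_display) (T : measurableType d)
  (P : probability T R) (p : nat -> R)
  (xi : nat -> {RV P >-> R}) (box : nat -> {RV P >-> nat}) (ell : R -> R)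
  (K := occupied_boxes xi box) (EK := mean_occupied xi box)
  (VarK := var_occupied xi box) :
  infinite_distribution p ->
  poissonized_Karlin_scheme p xi box ->
  de_Haan_Pi ell (counting_function p) ->
  [/\ forall (beta : R) (l : R -> R), log_power_growth ell beta l ->
        forall j, (0 < j)%N ->
        {ae P, forall w,
          limf_esup (fun t => ((K j t w - EK j t)
                        / Num.sqrt (VarK j t * ln (VarK j t)))%:E) +oo
          = (Num.sqrt (2 / beta))%:E},
      forall (sigma lam : R), exp_log_growth ell sigma lam ->
        forall j, (0 < j)%N ->
        {ae P, forall w,
          limf_esup (fun t => ((K j t w - EK j t)
                        / Num.sqrt (VarK j t * ln (ln (VarK j t))))%:E) +oo
          = (Num.sqrt (2 / lam))%:E},
      (exists beta l, log_power_growth ell beta l) \/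
      (exists sigma lam, exp_log_growth ell sigma lam) ->
        ell t @[t --> +oo] --> +oo
    & ell t @[t --> +oo] --> +oo ->
        forall j, (0 < j)%N ->
        asymp_equiv (EK j) (counting_function p) /\
        asymp_equiv (VarK j) (fun t => variance_constant j * ell t)].
Proof.
move=> dist sch pi_ell.
have p0 := distribution_ge0 dist; have p1 := distribution_sum dist.
split.
- move=> beta l gr [//|j] _.
  have ell_oo := log_power_ell_oo pi_ell gr.
  have b0 : 0 < beta by case: gr.
  have v0 := poisson_var_gt0 p0 p1 pi_ell ell_oo j.
  have e0 := ell_gt0 pi_ell.
  have Dc := ln_growth_equiv (variance_constant_gt0 p0 p1 pi_ell ell_oo j) v0 e0
    (@poisson_var_equiv _ _ _ p0 p1 pi_ell ell_oo j) (log_power_growth_ln gr e0).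
  apply: (occupancy_limsup dist sch pi_ell ell_oo b0 Dc (growth_over_q b0 v0 Dc)) => t t0.
  by rewrite /VarK (var_occupiedE p0 p1 sch).
- move=> sigma lam gr [//|j] _.
  have ell_oo := exp_log_ell_oo pi_ell gr.
  have [s0 /andP[l0 l1] _] := gr.
  have v0 := poisson_var_gt0 p0 p1 pi_ell ell_oo j.
  have [Dc vl] := growth_exp_log s0 l0 v0
    (exp_log_ratio pi_ell gr (poisson_var_ln dist pi_ell (j := j) ell_oo)).
  apply: (occupancy_limsup dist sch pi_ell ell_oo l0 Dc vl) => t t0.
  by rewrite /VarK (var_occupiedE p0 p1 sch).
- by case=> [[beta [l /(log_power_ell_oo pi_ell)]]|[sigma [lam /(exp_log_ell_oo pi_ell)]]].
- move=> ell_oo [//|j] _; split.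
    exact: (mean_occupied_equiv dist sch pi_ell ell_oo).
  exact: (var_occupied_equiv dist sch pi_ell ell_oo).
Qed.
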